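(* Let $\{f_\theta:\theta\in\Theta\subset\mathbb{R}\}$ be a parametric family of densities with scalar parameter $\theta$, let $\gamma\in[0,1]$, $\lambda\in\mathbb{R}$, $\beta\ge0$, $\theta_0\in\Theta$, and let $X_1,\dots,X_n$ be i.i.d. from a distribution $G$ (which may or may not belong to the model family) with density $g$, under the regularity conditions listed in the context. Then under the null hypothesis $H_0:T_\beta(G)=\theta_0$, $$\xi_n^{\gamma,\lambda}(\hat\theta_\beta,\theta_0)\ \xrightarrow{\ \mathcal D\ }\ c(g)\,\chi^2_1\qquad(n\to\infty),$$ where $c(g)=A_\gamma(\theta_0)V_\beta(g)J_\beta^{-2}(g)$ with $$A_\gamma(\theta_0)=(1+\gamma)\int u_{\theta_0}^2f_{\theta_0}^{1+\gamma},\qquad J_\beta(g)=\int u_{\theta_0}^2f_{\theta_0}^{1+\beta}+\int(i_{\theta_0}-\beta u_{\theta_0}^2)(g-f_{\theta_0})f_{\theta_0}^\beta,$$ $$V_\beta(g)=\int u_{\theta_0}^2f_{\theta_0}^{2\beta}g-\Big(\int u_{\theta_0}f_{\theta_0}^\beta g\Big)^2,$$ $u_\theta=\nabla\log f_\theta$ and $i_\theta=-\nabla u_\theta$.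
   Context: $\nabla$ denotes differentiation with respect to $\theta$; $\chi^2_1$ is a chi-square variable with one degree of freedom. S-divergence. For $\gamma\in[0,1]$, $\lambda\in\mathbb{R}$ put $A=1+\lambda(1-\gamma)$, $B=\gamma-\lambda(1-\gamma)$. For densities $g,f$, $$S_{(\gamma,\lambda)}(g,f)=\frac1A\int f^{1+\gamma}-\frac{1+\gamma}{AB}\int f^Bg^A+\frac1B\int g^{1+\gamma}\quad(A\ne0,B\ne0);$$ for $A=0$ it is $\int f^{1+\gamma}\log(f/g)-\int\frac{f^{1+\gamma}-g^{1+\gamma}}{1+\gamma}$, and for $B=0$ it is $\int g^{1+\gamma}\log(g/f)-\int\frac{g^{1+\gamma}-f^{1+\gamma}}{1+\gamma}$. Density power divergence (DPD). $d_\beta(g,f_\theta)=\int f_\theta^{1+\beta}-\frac{1+\beta}\beta\int f_\theta^\beta g+\frac1\beta\int g^{1+\beta}$ for $\beta>0$, and $d_0(g,f_\theta)=\int g\log(g/f_\theta)$. The minimum DPD functional $T_\beta(G)$ minimizes over $\theta$ the DPD between $G$ and $f_\theta$, i.e. $\int f_\theta^{1+\beta}-\frac{1+\beta}\beta\int f_\theta^\beta\,dG$ (for $\beta=0$, $-\int\log f_\theta\,dG$); the minimum DPD estimator is $\hat\theta_\beta=T_\beta(G_n)$, $G_n$ the empirical distribution of $X_1,\dots,X_n$. Test statistic: $\xi_n^{\gamma,\lambda}(\hat\theta_\beta,\theta_0)=2nS_{(\gamma,\lambda)}(f_{\hat\theta_\beta},f_{\theta_0})$. Regularity conditions (the paper's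 standing conditions for all asymptotic results, with true distribution $G$ and target parameter $\theta_0=T_\beta(G)$). Lehmann conditions: (A) there is an open subset $\omega$ of $\Theta$ containing $\theta_0$ such that for almost all $x\in\mathcal X$ and all $\theta\in\omega$, $f_\theta(x)$ is three times differentiable in $\theta$. (B) $E_\theta[\nabla\log f_\theta(X)]=0$ and $I(\theta)=E_\theta[(\nabla\log f_\theta(X))^2]=E_\theta[-\nabla^2\log f_\theta(X)]$. (C) $I(\theta)$ is positive and finite for all $\theta\in\omega$. (D) There is $M$ with finite expectation under the true distribution such that $|\nabla^3\log f_\theta(x)|\le M(x)$ for all $\theta\in\omega$. Basu et al. conditions: (D1) $\mathcal X=\{x:f_\theta(x)>0\}$ is independent of $\theta$. (D2) As in (A), with moreover the third derivative continuous in $\theta$. (D3) $\int f_\theta^{1+\beta}(x)dx$ can be differentiated three times in $\theta$, and the derivatives can be taken under the integral sign. (D4) $J_\beta(\theta)=\int u_\theta^2f_\theta^{1+\beta}$ is positive. (D5) There is $M(x)$ with finite expectation under the true distribution such that $|\nabla^3d_\beta(\delta_x,f_\theta)|\le M(x)$ for all $\theta\in\omega$, where $\delta_x$ is the degenerate density at $x$ (only the $\theta$-dependent part, $\int f_\theta^{1+\beta}-\frac{1+\beta}\beta f_\theta^\beta(x)$, or $-\log f_\theta(x)$ if $\beta=0$, matters).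
   Formalization: Added assumptions: the estimator converges to θ0 in probability; the integrals of f_θ^{1+γ} and of the cross term of S(f_θ,f_θ0) can be differentiated twice under the integral near θ0; the integrals in J_β(g), V_β(g) are finite and J_β(g)≠0; ξ_n is measurable. *)

(* Defs.v *)
From HB Require Import structures.
From mathcomp Require Import all_boot all_order all_algebra.
From mathcomp Require Import all_classical all_reals all_analysis.
From mathcomp Require Import measurable_realfun.
Import Order.TTheory GRing.Theory Num.Theory.
Import numFieldNormedType.Exports.

Set Implicit Arguments.
Unset Strict Implicit.
Unset Printing Implicit Defensive.

Local Open Scope classical_set_scope.
Local Open Scope ring_scope.

(* A parametric family is a function [f : R -> T -> R], [f theta] being a
   density with respect to the dominating measure [mu] when theta is in the
   parameter set [Theta]. Values at parameters outside [Theta] are never used: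
   derivatives in theta are only taken on an open subset of [Theta]. *)

Definition is_density d (T : measurableType d) (R : realType)
    (mu : {measure set T -> \bar R}) (h : T -> R) : Prop :=
  [/\ measurable_fun [set: T] h, (forall x, 0 <= h x) &
      (\int[mu]_x (h x)%:E = 1)%E].

(* u_theta(x) = d/dtheta log f_theta(x) *)
Definition score (T : Type) (R : realType) (f : R -> T -> R)
    (theta : R) (x : T) : R :=
  derive1 (fun t => ln (f t x)) theta.

(* i_theta(x) = - d/dtheta u_theta(x) *)
Definition info (T : Type) (R : realType) (f : R -> T -> R)
    (theta : R) (x : T) : R :=
  - derive1 (score f ^~ x) theta.

(* On [omega], theta |-> \int h_theta dmu can be differentiated [k] times, and
   the derivatives can be taken under the integral sign. The existence of the
   pointwise derivatives of [h] is a separate condition. *)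
Definition diff_under_integral d (T : measurableType d) (R : realType)
    (mu : {measure set T -> \bar R}) (k : nat) (omega : set R)
    (h : R -> T -> R) : Prop :=
  (forall theta j, omega theta -> (j <= k)%N ->
     mu.-integrable [set: T] (fun x => (derive1n j (h ^~ x) theta)%:E)) /\
  (forall theta j, omega theta -> (j < k)%N ->
     is_derive theta 1 (fun t => \int[mu]_x (derive1n j (h ^~ x) t))
                       (\int[mu]_x (derive1n j.+1 (h ^~ x) theta))).

Section s_divergence.
Context d (T : measurableType d) (R : realType).
Variables (mu : {measure set T -> \bar R}) (gam lam : R).

Definition sdivA : R := 1 + lam * (1 - gam).
Definition sdivB : R := gam - lam * (1 - gam).

(* The integrand of the only term of S(g, f) which involves both g and f. *)
Definition sdiv_cross (g f : T -> R) (x : T) : R :=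
  if sdivA == 0 then f x `^ (1 + gam) * ln (f x / g x)
  else if sdivB == 0 then g x `^ (1 + gam) * ln (g x / f x)
  else f x `^ sdivB * g x `^ sdivA.

(* A + B = 1 + gam > 0, so that A and B do not vanish simultaneously. *)
Definition sdiv (g f : T -> R) : \bar R :=
  if sdivA == 0 then
    (\int[mu]_x (sdiv_cross g f x)%:E
     - \int[mu]_x ((f x `^ (1 + gam) - g x `^ (1 + gam)) / (1 + gam))%:E)%E
  else if sdivB == 0 then
    (\int[mu]_x (sdiv_cross g f x)%:E
     - \int[mu]_x ((g x `^ (1 + gam) - f x `^ (1 + gam)) / (1 + gam))%:E)%E
  else
    ((sdivA^-1)%:E * \int[mu]_x (f x `^ (1 + gam))%:E
     - ((1 + gam) / (sdivA * sdivB))%:E * \int[mu]_x (sdiv_cross g f x)%:E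
     + (sdivB^-1)%:E * \int[mu]_x (g x `^ (1 + gam))%:E)%E.

End s_divergence.

Section density_power_divergence.
Context d (T : measurableType d) (R : realType).
Variables (mu : {measure set T -> \bar R}) (f : R -> T -> R) (beta : R).

(* The theta-dependent part of the DPD between a distribution [Q] and
   [f theta]. [lne] is the extended logarithm (lne 0 = -oo), so that for
   beta = 0 the objective is +oo if [Q] charges a set where [f theta] = 0. *)
Definition dpd_objective (Q : {measure set T -> \bar R}) (theta : R) : \bar R :=
  if beta == 0 then (- \int[Q]_x lne (f theta x)%:E)%E
  else (\int[mu]_x (f theta x `^ (1 + beta))%:E
        - ((1 + beta) / beta)%:E * \int[Q]_x (f theta x `^ beta)%:E)%E.

(* [theta0] is a value of the minimum DPD functional T_beta at [Q].
   The bound on the integral of f_theta^(1 + beta) only discards parameters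
   at which the objective is +oo or has the undefined form oo - oo. *)
Definition is_min_dpd (Theta : set R) (Q : {measure set T -> \bar R})
    (theta0 : R) : Prop :=
  [/\ Theta theta0, dpd_objective Q theta0 \is a fin_num &
      forall theta, Theta theta ->
        (\int[mu]_x (f theta x `^ (1 + beta))%:E < +oo)%E ->
        (dpd_objective Q theta0 <= dpd_objective Q theta)%E].

(* The theta-dependent part of d_beta(delta_x, f_theta). *)
Definition dpd_point (x : T) (theta : R) : R :=
  if beta == 0 then - ln (f theta x)
  else \int[mu]_y (f theta y `^ (1 + beta))
       - (1 + beta) / beta * f theta x `^ beta.

(* J_beta(theta) computed under the model. *)
Definition J_model (theta : R) : R :=
  \int[mu]_x (score f theta x ^+ 2 * f theta x `^ (1 + beta)).

(* A_gam(theta), with the exponent [beta] of the section in the role of gam. *)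
Definition A_model (theta : R) : R := (1 + beta) * J_model theta.

Definition J_integrand (g : T -> R) (theta : R) (x : T) : R :=
  (info f theta x - beta * score f theta x ^+ 2)
  * (g x - f theta x) * f theta x `^ beta.

(* J_beta(g) *)
Definition J_true (g : T -> R) (theta : R) : R :=
  J_model theta + \int[mu]_x J_integrand g theta x.

(* V_beta(g) *)
Definition V_true (g : T -> R) (theta : R) : R :=
  \int[mu]_x (score f theta x ^+ 2 * f theta x `^ (2 * beta) * g x)
  - (\int[mu]_x (score f theta x * f theta x `^ beta * g x)) ^+ 2.

End density_power_divergence.

(* Finiteness of the integrals defining J_beta(g) and V_beta(g), and
   J_beta(g) <> 0, without which J_beta(g)^-2 would be meaningless. *)
Definition constants_well_defined d (T : measurableType d) (R : realType)
    (mu : {measure set T -> \bar R}) (f : R -> T -> R) (beta : R)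
    (g : T -> R) (theta : R) : Prop :=
  [/\ mu.-integrable [set: T] (fun x => (J_integrand f beta g theta x)%:E),
      mu.-integrable [set: T]
        (fun x => (score f theta x ^+ 2 * f theta x `^ (2 * beta) * g x)%:E),
      mu.-integrable [set: T]
        (fun x => (score f theta x * f theta x `^ beta * g x)%:E) &
      J_true mu f beta g theta != 0].

Section regularity.
Context d (T : measurableType d) (R : realType).
Variables (mu : {measure set T -> \bar R}) (f : R -> T -> R) (theta0 : R).
Variables (G : {measure set T -> \bar R}) (Theta omega : set R).

(* The sample space {x : f_theta(x) > 0}; it does not depend on theta under
   [basu_support]. *)
Definition model_support : set T := [set x | 0 < f theta0 x].

Definition three_times_diff : Prop :=
  {ae mu, forall x, model_support x -> forall theta, omega theta ->
     forall k, (k < 3)%N -> derivable (derive1n k (f ^~ x)) theta 1}.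

Definition fisher (theta : R) : \bar R :=
  (\int[mu]_x (score f theta x ^+ 2 * f theta x)%:E)%E.

(* The letters are those of Lehmann's conditions. *)
Record lehmann_conditions : Prop := LehmannConditions {
  lehmann_A : three_times_diff ;
  lehmann_B_score : forall theta, omega theta ->
    (\int[mu]_x (score f theta x * f theta x)%:E = 0)%E ;
  lehmann_B_info : forall theta, omega theta ->
    fisher theta = (\int[mu]_x (info f theta x * f theta x)%:E)%E ;
  lehmann_C : forall theta, omega theta -> (0 < fisher theta < +oo)%E ;
  lehmann_D : exists M : T -> R,
    G.-integrable [set: T] (fun x => (M x)%:E) /\
    {ae mu, forall x, model_support x -> forall theta, omega theta ->
       `|derive1n 3 (fun t => ln (f t x)) theta| <= M x} }.

(* Conditions (D1)-(D5) of Basu, Harris, Hjort and Jones. *)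
Record basu_conditions (beta : R) : Prop := BasuConditions {
  basu_support : forall theta, Theta theta ->
    [set x | 0 < f theta x] = model_support ;
  basu_smooth : three_times_diff /\
    {ae mu, forall x, model_support x -> forall theta, omega theta ->
       {for theta, continuous (derive1n 3 (f ^~ x))}} ;
  basu_diff_integral :
    diff_under_integral mu 3 omega (fun theta x => f theta x `^ (1 + beta)) ;
  basu_J_pos : forall theta, omega theta ->
    mu.-integrable [set: T]
      (fun x => (score f theta x ^+ 2 * f theta x `^ (1 + beta))%:E) /\
    0 < J_model mu f beta theta ;
  basu_third_bound : exists M : T -> R,
    G.-integrable [set: T] (fun x => (M x)%:E) /\
    {ae mu, forall x, model_support x -> forall theta, omega theta ->
       `|derive1n 3 (dpd_point mu f beta x) theta| <= M x} }.

(* The analogue of [basu_diff_integral] for the integrals occurring in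
   S(f_theta, f_theta0): it is what the second-order Taylor expansion of the
   divergence at theta0 presupposes. *)
Definition sdiv_regular (gam lam : R) : Prop :=
  diff_under_integral mu 2 omega (fun theta x => f theta x `^ (1 + gam)) /\
  diff_under_integral mu 2 omega
    (fun theta => sdiv_cross gam lam (f theta) (f theta0)).

End regularity.

Section sampling.
Context dO d (Omega : measurableType dO) (T : measurableType d) (R : realType).
Variable P : probability Omega R.

Definition mutually_independent (X : nat -> {RV P >-> T}) : Prop :=
  forall (J : seq nat) (B : nat -> set T), uniq J ->
    (forall i, measurable (B i)) ->
    fine (P (\bigcap_(i in [set` J]) (X i @^-1` B i))) =
    \prod_(i <- J) fine (P (X i @^-1` B i)).

Definition iid_from (G : probability T R) (X : nat -> {RV P >-> T}) : Prop :=
  mutually_independent X /\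
  forall i (B : set T), measurable B -> distribution P (X i) B = G B.

(* G_n, based on X_0, ..., X_(n-1); only meaningful for 0 < n. *)
Definition empirical (X : nat -> {RV P >-> T}) (n : nat) (w : Omega) :
    {measure set T -> \bar R} :=
  mscale (n%:R^-1)%:nng (msum (fun i => \d_(X i w)) n).

Definition cvg_in_probability (Y : nat -> {RV P >-> R}) (a : R) : Prop :=
  forall e : R, 0 < e ->
    (fun n => P [set w | e < `|Y n w - a|]) @ \oo --> 0%E.

(* Convergence in distribution to the law [L] on the real line: convergence of
   the distribution functions at every continuity point of that of [L]. *)
Definition cvg_in_law (Y : nat -> Omega -> \bar R) (L : set R -> \bar R) :
    Prop :=
  forall t : R, {for t, continuous (fun s : R => L `]-oo, s]%classic)} ->
    (fun n => P [set w | (Y n w <= t%:E)%E]) @ \oo --> L `]-oo, t]%classic.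

(* The test statistic xi_n = 2 n S(f_thetahat, f_theta0). *)
Definition sdiv_statistic (mu : {measure set T -> \bar R}) (f : R -> T -> R)
    (gam lam theta0 : R) (thetahat : nat -> {RV P >-> R}) (n : nat)
    (w : Omega) : \bar R :=
  ((2 * n%:R)%:E * sdiv mu gam lam (f (thetahat n w)) (f theta0))%E.

End sampling.

(* chi^2_1: the law of the square of a standard normal variable. *)
Definition chi_square1 (R : realType) : set R -> \bar R :=
  pushforward (normal_prob 0 1) (fun z : R => z ^+ 2).

Definition scaled_chi_square1 (R : realType) (c : R) : set R -> \bar R :=
  pushforward (@chi_square1 R) (fun y : R => c * y).

(* Main.v *)
(* Let h1 and h2 be the first two theta-derivatives at theta0 of the pointwise
   objective D(x, theta), Z_n = n^(-1/2) sum_i h1(X_i) and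
   delta = thetahat - theta0. Minimality of theta0 under G gives E h1 = 0;
   moreover E h1^2 = (1 + beta)^2 V and E h2 = (1 + beta) J. Minimality of
   thetahat under the empirical distribution gives sum_i D'(X_i, thetahat) = 0,
   and the third-derivative bound turns this, by the law of large numbers for
   h2, into sqrt n delta ~ - Z_n / ((1 + beta) J). The divergence
   S(f_theta, f_theta0) vanishes to first order at theta0 and has second
   derivative A_gamma there, so for every rho > 1 the statistic is within a
   factor rho of A_gamma Z_n^2 / ((1 + beta) J)^2 with probability tending to 1.
   The central limit theorem for Z_n and the continuity of the limiting
   distribution function at the given point conclude.

   Both limit theorems come from Trotter's form of the Lindeberg argument: the
   law of h(X_i) / sqrt n acts on bounded functions by averaging translates, its
   action on a C^2 test function differs from that of a normal law with the same
   variance by o(1/n), and n such errors add up. *)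

Require Import Defs.
From HB Require Import structures.
From mathcomp Require Import all_boot all_order all_algebra.
From mathcomp Require Import all_classical all_reals all_analysis.
From mathcomp Require Import measurable_realfun ring lra.
Import Order.TTheory GRing.Theory Num.Theory.
Import numFieldNormedType.Exports.

Set Implicit Arguments.
Unset Strict Implicit.
Unset Printing Implicit Defensive.

Local Open Scope classical_set_scope.
Local Open Scope ring_scope.

(** * Averaging operators and smooth test functions *)

(** Three obstacles shape the proof. (i) The score is a pointwise derivative that exists off a null
    set and may fail to be measurable, so h1 and h2 are rebuilt from functions that are integrable
    by (D3) and (D4), namely the theta-derivatives of f^(1+beta) and u^2 f^(1+beta), divided by f.
    (ii) For beta > 0, G may charge the complement of the model support, where the third-derivative
    bound says nothing; there f^beta vanishes and the objective reduces to its x-free part, which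
    (D3) makes differentiable. For beta = 0, finiteness of the objective at theta0 puts G on the
    support. (iii) The events on which the expansions hold are not known to be measurable, so high
    probability means containing a measurable set of high probability. The limit is a law of Z^2, so
    only the probabilities of the balls |Z| <= b matter, and one family of even bump functions
    replaces general weak convergence. E h1 = 0 is obtained by comparing objective values on both
    sides of theta0, not by differentiating under the integral in G. *)

Section real_integrable.
Context d (T : measurableType d) (R : realType).
Variable mu : {measure set T -> \bar R}.
Implicit Types f g : T -> R.

Lemma integrableD_EFin f g : mu.-integrable [set: T] (EFin \o f) ->
  mu.-integrable [set: T] (EFin \o g) ->
  mu.-integrable [set: T] (EFin \o (fun x => f x + g x)).
Proof. by move=> mf mg; exact: (integrableD measurableT mf mg). Qed.

Lemma integrableB_EFin f g : mu.-integrable [set: T] (EFin \o f) ->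
  mu.-integrable [set: T] (EFin \o g) ->
  mu.-integrable [set: T] (EFin \o (fun x => f x - g x)).
Proof. by move=> mf mg; exact: (integrableB measurableT mf mg). Qed.

Lemma integrableZl_EFin f (k : R) : mu.-integrable [set: T] (EFin \o f) ->
  mu.-integrable [set: T] (EFin \o (fun x => k * f x)).
Proof. by move=> mf; exact: (integrableZl measurableT k mf). Qed.

Lemma integrableZr_EFin f (k : R) : mu.-integrable [set: T] (EFin \o f) ->
  mu.-integrable [set: T] (EFin \o (fun x => f x * k)).
Proof. by move=> mf; exact: (integrableZr measurableT k mf). Qed.

End real_integrable.

Section averaging.
Context {R : realType}.
Implicit Types (Q : probability R R) (phi a b : R -> R).

Definition bounded_mfun phi : Prop :=
  measurable_fun [set: R] phi /\ exists C : R, forall x, `|phi x| <= C.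

(** The operator of the random walk with step law [Q]: its iterates at 0 are the expectations of phi
    at the partial sums. *)
Definition average Q phi x : R := \int[Q]_y phi (x + y).

Lemma bounded_integrable d (T : measurableType d) (Q : probability T R)
    (f : T -> R) (C : R) :
  measurable_fun [set: T] f -> (forall x, `|f x| <= C) ->
  Q.-integrable [set: T] (EFin \o f).
Proof.
move=> mf fC; apply: measurable_bounded_integrable => //.
  by rewrite -ge0_fin_numE// fin_num_measure.
exists C; split; first exact: num_real.
by move=> M CM x _; apply: (le_trans (fC x)); exact: ltW.
Qed.

Lemma normr_Rintegral_le d (T : measurableType d) (Q : probability T R)
    (f : T -> R) (C : R) :
  measurable_fun [set: T] f -> (forall x, `|f x| <= C) ->
  `|\int[Q]_x f x| <= C.
Proof.
move=> mf fC.
apply: (le_trans (le_normr_Rintegral measurableT (bounded_integrable Q mf fC))).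
have C_cst : \int[Q]_x C = C :> R.
  by rewrite Rintegral_cst//= probability_setT mulr1.
rewrite -[leRHS]C_cst; apply: le_Rintegral => //.
- exact/integrable_norm/(bounded_integrable Q mf fC).
- by apply: (@bounded_integrable _ _ _ _ `|C|).
Qed.

Lemma bounded_mfun_translate phi x :
  bounded_mfun phi -> bounded_mfun (fun y => phi (x + y)).
Proof.
move=> [mphi [C phiC]]; split; last by exists C => y.
by apply: measurableT_comp => //; exact: measurable_funD.
Qed.

Lemma translate_integrable Q phi x : bounded_mfun phi ->
  Q.-integrable [set: R] (EFin \o (fun y => phi (x + y))).
Proof.
move=> /(@bounded_mfun_translate _ x)[mphi [C phiC]].
exact: (bounded_integrable Q mphi phiC).
Qed.

Lemma average_bound Q phi (C : R) : measurable_fun [set: R] phi ->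
  (forall x, `|phi x| <= C) -> forall x, `|average Q phi x| <= C.
Proof.
move=> mphi phiC x; apply: normr_Rintegral_le => //.
by apply: measurableT_comp => //; exact: measurable_funD.
Qed.

Lemma measurable_add_pair phi : measurable_fun [set: R] phi ->
  measurable_fun [set: R * R] (fun z => phi (z.1 + z.2)).
Proof.
move=> mphi; apply: measurableT_comp => //.
by apply: measurable_funD; [exact: measurable_fst|exact: measurable_snd].
Qed.

Lemma bounded_mfun_average Q phi : bounded_mfun phi ->
  bounded_mfun (average Q phi).
Proof.
move=> [mphi [C phiC]]; split; last by exists C; exact: average_bound.
have mf := measurable_add_pair mphi.
have intf : (Q \x Q)%E.-integrable setT
    (fun z : R * R => (phi (z.1 + z.2))%:E).
  exact: (@bounded_integrable _ _ (Q \x Q)%E _ C mf).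
by apply: measurableT_comp => //; exact: (measurable_fubini_F intf).
Qed.

Lemma averageB Q phi psi x : bounded_mfun phi -> bounded_mfun psi ->
  average Q (fun y => phi y - psi y) x = average Q phi x - average Q psi x.
Proof.
by move=> bphi bpsi; rewrite /average RintegralB//; exact: translate_integrable.
Qed.

Lemma bounded_mfunB phi psi : bounded_mfun phi -> bounded_mfun psi ->
  bounded_mfun (fun y => phi y - psi y).
Proof.
move=> [mp [C pC]] [mq [D qD]]; split; first exact: measurable_funB.
exists (C + D) => x; apply: le_trans (ler_normB _ _) _.
exact: lerD.
Qed.

Lemma bounded_mfun_iter Q n phi : bounded_mfun phi ->
  bounded_mfun (iter n (average Q) phi).
Proof. by elim: n => //= n IH /IH; exact: bounded_mfun_average. Qed.

(* Trotter's telescoping argument: averages against Q and Q' are contractions,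
   so one-step errors add up. *)
Lemma iter_average_le (S : (R -> R) -> Prop) Q Q' (e : R) :
  (forall phi, S phi -> bounded_mfun phi) ->
  (forall phi, S phi -> S (average Q' phi)) ->
  (forall phi, S phi -> forall x, `|average Q phi x - average Q' phi x| <= e) ->
  forall n phi, S phi -> forall x,
  `|iter n (average Q) phi x - iter n (average Q') phi x| <= e *+ n.
Proof.
move=> Sb Savg Se; elim=> [|n IH] phi Sphi x; first by rewrite subrr normr0.
(* The one-step bound is available on [S] only, and it will be applied to this iterate. *)
have Siter : S (iter n (average Q') phi) by elim: n {IH} => //= n; exact: Savg.
have b1 := bounded_mfun_iter Q n (Sb _ Sphi).
have b2 := bounded_mfun_iter Q' n (Sb _ Sphi).
rewrite !iterS mulrSr.
rewrite -(subrKA (average Q (iter n (average Q') phi) x)).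
apply: le_trans (ler_normD _ _) _; apply: lerD; last exact: Se.
rewrite -averageB//; apply: average_bound; last exact: IH.
by case: (bounded_mfunB b1 b2).
Qed.

End averaging.

(** * Test functions with uniform Taylor remainders *)

Section taylor_classes.
Context {R : realType}.
Implicit Types (Q : probability R R) (phi a b w : R -> R).

(** Here and in [taylor2], [a] and [b] stand for phi' and phi''/2, but no derivative is ever taken.
    The remainder depends on the increment alone, which is what lets averaging preserve such a
    class. *)
Definition taylor1 w phi : Prop :=
  bounded_mfun phi /\ exists2 a, bounded_mfun a &
    forall x h, `|phi (x + h) - phi x - a x * h| <= w h.

Definition taylor2 w phi : Prop :=
  bounded_mfun phi /\ exists a b, [/\ bounded_mfun a, bounded_mfun b &
    forall x h, `|phi (x + h) - phi x - a x * h - b x * h ^+ 2| <= w h].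

(** Integrating the expansions at the points [x + y] gives one at [x] with averaged coefficients;
    the remainder bound is the same at all these points. *)
Lemma taylor2_average Q w phi : taylor2 w phi -> taylor2 w (average Q phi).
Proof.
move=> [bphi [a [b [ba bb abw]]]]; split; first exact: bounded_mfun_average.
exists (average Q a), (average Q b); split; try exact: bounded_mfun_average.
move=> x h; rewrite /average.
have iphi z := translate_integrable Q z bphi.
have ia := translate_integrable Q x ba.
have ib := translate_integrable Q x bb.
have iB := integrableB_EFin (iphi (x + h)) (iphi x).
have iBZ := integrableB_EFin iB (integrableZr_EFin h ia).
rewrite -RintegralB// -RintegralZr// -RintegralZr// -RintegralB//; last first.
  exact: integrableZr_EFin.
rewrite -RintegralB//; last exact: integrableZr_EFin.
apply: normr_Rintegral_le; last first.
  by move=> y; have := abw (x + y) h; rewrite (addrAC x y h).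
have mt psi (z : R) : bounded_mfun psi ->
    measurable_fun [set: R] (fun y : R => psi (z + y)).
  by move=> /(bounded_mfun_translate z)[].
apply: measurable_funB; first apply: measurable_funB.
- by apply: measurable_funB; exact: mt.
- by apply: measurable_funM => //; exact: mt.
- by apply: measurable_funM => //; exact: mt.
Qed.

Lemma average_taylor Q phi p w x : bounded_mfun phi ->
  Q.-integrable [set: R] (EFin \o p) -> Q.-integrable [set: R] (EFin \o w) ->
  (forall h, `|phi (x + h) - phi x - p h| <= w h) ->
  `|average Q phi x - phi x - \int[Q]_y p y| <= \int[Q]_y w y.
Proof.
move=> bphi ip iw pw.
have iphi := translate_integrable Q x bphi.
have ic : Q.-integrable [set: R] (EFin \o (cst (phi x))).
  by apply: (@bounded_integrable _ _ _ Q _ `|phi x|).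
have c_cst : \int[Q]_y phi x = phi x :> R.
  by rewrite Rintegral_cst//= probability_setT mulr1.
rewrite -[X in _ - X - _]c_cst /average -RintegralB// -RintegralB//; last first.
  exact: integrableB_EFin.
have irem := integrableB_EFin (integrableB_EFin iphi ic) ip.
apply: (le_trans (le_normr_Rintegral measurableT irem)).
by apply: le_Rintegral => //; exact: integrable_norm irem.
Qed.

End taylor_classes.

(** * A smooth bump built from cubic splines *)

Section bump.
Context {R : realType}.
Implicit Types (phi a b : R -> R).

(** The expansion of a bounded C^2 function with Lipschitz second derivative, put without
    derivatives. *)
Definition cubic_taylor phi : Prop :=
  bounded_mfun phi /\ exists a b (K : R),
    [/\ bounded_mfun a, bounded_mfun b, 0 <= K &
      forall x h, `|phi (x + h) - phi x - a x * h - b x * h ^+ 2|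
                  <= K * `|h| ^+ 3].

Let pos (x : R) := Num.max x 0.

(** The remainder is 0 or h^3 when [x] and [x + h] lie on the same side of 0, and lies between 0 and
    h^3 otherwise. *)
Let pos_cubic (x h : R) :
  `|pos (x + h) ^+ 3 - pos x ^+ 3 - 3 * pos x ^+ 2 * h - 3 * pos x * h ^+ 2|
  <= `|h| ^+ 3.
Proof.
rewrite -normrX /pos; case: (ltP x 0) => x0; case: (ltP (x + h) 0) => xh0.
- by rewrite !expr0n/= !(mulr0, mul0r, subrr) normr0.
- have h0 : 0 <= h ^+ 3 by apply: exprn_ge0; lra.
  rewrite !expr0n/= !(mulr0, mul0r, subr0) ger0_norm ?exprn_ge0// ger0_norm//.
  by rewrite lerXn2r ?nnegrE//; lra.
- have hN : h ^+ 3 <= 0.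
    by rewrite !exprS expr0 mulr1 mulr_le0_ge0//; [lra|apply: mulr_le0; lra].
  rewrite (ler0_norm hN) expr0n/=.
  have -> : 0 - x ^+ 3 - 3 * x ^+ 2 * h - 3 * x * h ^+ 2 = h ^+ 3 - (x + h) ^+ 3
    by ring.
  have yN : (x + h) ^+ 3 <= 0.
    by rewrite !exprS expr0 mulr1 mulr_le0_ge0//; [lra|apply: mulr_le0; lra].
  have : h ^+ 3 <= (x + h) ^+ 3.
    rewrite -subr_ge0.
    have -> : (x + h) ^+ 3 - h ^+ 3 =
        x * ((x + h) ^+ 2 + (x + h) * h + h ^+ 2) by ring.
    by rewrite mulr_ge0//; nra.
  by move=> ?; rewrite ler0_norm; lra.
- by rewrite le_eqVlt; apply/orP; left; apply/eqP; congr `|_|; ring.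
Qed.

(** A third difference with unit step, divided by 3!. For the cube it is the integral of the
    quadratic B-spline, a step rising from 0 to 1 on [0, 3]; for the square and the identity it
    gives the first two derivatives of that step up to constant factors. *)
Let spline (f : R -> R) (x : R) :=
  (f (pos x) - 3 * f (pos (x - 1)) + 3 * f (pos (x - 2)) - f (pos (x - 3))) / 6.

Let measurable_spline (f : R -> R) : measurable_fun [set: R] f ->
  measurable_fun [set: R] (spline f).
Proof.
move=> mf.
have mp (c : R) : measurable_fun [set: R] (fun x => f (pos (x - c))).
  apply: measurableT_comp => //; apply: measurable_maxr => //.
  exact: measurable_funB.
apply: measurable_funM => //; apply: measurable_funB => //.
apply: measurable_funD; last by apply: measurable_funM.
apply: measurable_funB; last by apply: measurable_funM.
apply: measurableT_comp => //; exact: measurable_maxr.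
Qed.

Let step := spline (fun x => x ^+ 3).

Let posE (x : R) : (0 <= x -> pos x = x) /\ (x <= 0 -> pos x = 0).
Proof. by rewrite /pos; split=> x0; case: ltP => //; lra. Qed.

(** Replacing the four positive parts simultaneously reduces each bound to polynomial inequalities
    between consecutive knots. *)
Let spline_cases (P : R -> R -> R -> R -> Prop) (x : R) :
  (x <= 0 -> P 0 0 0 0) -> (0 <= x <= 1 -> P x 0 0 0) ->
  (1 <= x <= 2 -> P x (x - 1) 0 0) ->
  (2 <= x <= 3 -> P x (x - 1) (x - 2) 0) ->
  (3 <= x -> P x (x - 1) (x - 2) (x - 3)) ->
  P (pos x) (pos (x - 1)) (pos (x - 2)) (pos (x - 3)).
Proof.
move=> P0 P1 P2 P3 P4.
have [x0|x0] := leP x 0.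
  by rewrite !(posE _).2; [apply: P0; lra|lra..].
have [x1|x1] := leP x 1.
  by rewrite (posE x).1 ?(posE (_ - _)).2; [apply: P1; lra|lra..].
have [x2|x2] := leP x 2.
  rewrite (posE x).1 ?(posE (x - 1)).1 ?(posE (_ - 2)).2 ?(posE (_ - 3)).2;
    [apply: P2; lra|lra..].
have [x3|x3] := leP x 3.
  rewrite (posE x).1 ?(posE (x - 1)).1 ?(posE (_ - 2)).1 ?(posE (_ - 3)).2;
    [apply: P3; lra|lra..].
by rewrite !(posE _).1; [apply: P4; lra|lra..].
Qed.

Let step_le0 x : x <= 0 -> step x = 0.
Proof.
by move=> x0; rewrite /step /spline !(posE _).2; [ring|lra..].
Qed.

Let step_ge3 x : 3 <= x -> step x = 1.
Proof.
by move=> x0; rewrite /step /spline !(posE _).1; [field|lra..].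
Qed.

Let step_01 x : 0 <= step x <= 1.
Proof.
have cube_01 (t : R) : 0 <= t <= 1 -> [&& 0 <= t ^+ 3, t ^+ 3 <= t ^+ 2, t ^+ 2 <= t & t <= 1].
  move=> /andP[t0 t1]; rewrite exprn_ge0// t1 andbT/=.
  by rewrite [t ^+ 3]exprS ler_piMl ?exprn_ge0//= expr2 ler_piMl.
rewrite /step /spline; pattern (pos x), (pos (x - 1)), (pos (x - 2)), (pos (x - 3)).
apply: spline_cases => x0.
- by lra.
- by have /and4P[] := cube_01 x x0; lra.
(* In the local variable t = x - 1 the bounds follow from the ordering of the powers of t on
   [0, 1]. *)
- have -> : (x ^+ 3 - 3 * (x - 1) ^+ 3 + 3 * 0 ^+ 3 - 0 ^+ 3) / 6 =
      (1 + 3 * (x - 1) + 3 * (x - 1) ^+ 2 - 2 * (x - 1) ^+ 3) / 6 by field.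
  have : 0 <= (1 - (x - 1)) ^+ 2 * (1 + 2 * (x - 1)).
    by rewrite mulr_ge0 ?sqr_ge0//; lra.
  by have /and4P[] := cube_01 (x - 1) ltac:(lra); lra.
- have -> : (x ^+ 3 - 3 * (x - 1) ^+ 3 + 3 * (x - 2) ^+ 3 - 0 ^+ 3) / 6 =
      1 - (3 - x) ^+ 3 / 6 by field.
  by have /and4P[] := cube_01 (3 - x) ltac:(lra); lra.
- have -> : (x ^+ 3 - 3 * (x - 1) ^+ 3 + 3 * (x - 2) ^+ 3 - (x - 3) ^+ 3) / 6 = 1
    by field.
  by lra.
Qed.

Let step1_le x : `|3 * spline (fun x => x ^+ 2) x| <= 1.
Proof.
rewrite /spline ler_norml.
pattern (pos x), (pos (x - 1)), (pos (x - 2)), (pos (x - 3)).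
by apply: spline_cases => x0; nra.
Qed.

Let step2_le x : `|3 * spline id x| <= 1.
Proof.
rewrite /spline ler_norml.
pattern (pos x), (pos (x - 1)), (pos (x - 2)), (pos (x - 3)).
by apply: spline_cases => x0; nra.
Qed.

Let cubic_taylor_step : cubic_taylor step.
Proof.
split.
  split; first by apply: measurable_spline; exact: exprn_measurable.
  by exists 1 => x; have := step_01 x; rewrite ler_norml; lra.
(* The weights 1, 3, 3, 1 over 6 add up to 8/6, whence the constant 2. *)
exists (fun x => 3 * spline (fun x => x ^+ 2) x), (fun x => 3 * spline id x), 2.
split => //.
- split; last by exists 1; exact: step1_le.
  by apply: measurable_funM => //; apply: measurable_spline; exact: exprn_measurable.
- split; last by exists 1; exact: step2_le.
  by apply: measurable_funM => //; exact: measurable_spline.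
- move=> x h; rewrite /step /spline.
  have := pos_cubic (x - 3) h; have := pos_cubic (x - 2) h.
  have := pos_cubic (x - 1) h; have := pos_cubic x h.
  rewrite !(addrAC x _ h); move: (`|h| ^+ 3) => H.
  by rewrite !ler_norml; lra.
Qed.

Let cubic_taylor_affine phi (k c : R) : cubic_taylor phi ->
  cubic_taylor (fun x => phi (k * x + c)).
Proof.
have bcomp (psi : R -> R) : bounded_mfun psi -> bounded_mfun (fun x => psi (k * x + c)).
  move=> [mpsi [C psiC]]; split; last by exists C.
  by apply: measurableT_comp => //; exact: measurable_funD.
have bscale (psi : R -> R) (r : R) : bounded_mfun psi -> bounded_mfun (fun x => r * psi x).
  move=> [mpsi [C psiC]]; split; first exact: measurable_funM.
  by exists (`|r| * C) => x; rewrite normrM ler_wpM2l.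
move=> [bphi [a [b [K [ba bb K0 abK]]]]]; split; first exact: bcomp.
exists (fun x => k * a (k * x + c)), (fun x => k ^+ 2 * b (k * x + c)),
  (K * `|k| ^+ 3); split.
- by apply: (bscale (fun x => a (k * x + c))); exact: bcomp.
- by apply: (bscale (fun x => b (k * x + c))); exact: bcomp.
- by rewrite mulr_ge0.
- move=> x h; have := abK (k * x + c) (k * h).
  have -> : k * x + c + k * h = k * (x + h) + c by ring.
  rewrite (normrM k h) !exprMn (mulrA K) (mulrA (a _) k h) (mulrC (a _) k).
  by rewrite (mulrA (b _)) (mulrC (b _)).
Qed.

Let cubic_taylorB phi psi : cubic_taylor phi -> cubic_taylor psi ->
  cubic_taylor (fun x => phi x - psi x).
Proof.
move=> [b1 [a [b [K [ba bb K0 abK]]]]] [b2 [a' [b' [K' [ba' bb' K0' abK']]]]].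
split; first exact: bounded_mfunB.
exists (fun x => a x - a' x), (fun x => b x - b' x), (K + K'); split.
- exact: bounded_mfunB.
- exact: bounded_mfunB.
- exact: addr_ge0.
- move=> x h; have := abK x h; have := abK' x h; rewrite mulrDl.
  by rewrite !ler_norml; lra.
Qed.

Let cubic_taylor_cst (c : R) : cubic_taylor (fun=> c).
Proof.
have bc (r : R) : bounded_mfun (fun=> r) by split => //; exists `|r|.
split => //; exists (fun=> 0), (fun=> 0), 0; split => // x h.
by rewrite !mul0r subrr !subr0 normr0.
Qed.

(** For increments up to 1 the Taylor remainder is the better bound; beyond 1, boundedness of phi
    and of the coefficients bounds the left-hand side by a multiple of h^2, respectively |h|. The
    minimum is thus integrable with two moments, respectively one, and keeps the extra power of h
    from which the decay will come. *)
Let cubic_taylor_min phi : cubic_taylor phi -> exists K : R,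
  [/\ 0 <= K, taylor2 (fun h => K * Num.min (h ^+ 2) (`|h| ^+ 3)) phi &
      taylor1 (fun h => K * Num.min `|h| (h ^+ 2)) phi].
Proof.
move=> [bphi [a [b [K [ba bb K0 abK]]]]].
have [_ [C0 phiC]] := bphi; have [_ [C1 aC]] := ba; have [_ [C2 bC]] := bb.
have C0_ge0 : 0 <= C0 by exact: le_trans (phiC 0).
have C1_ge0 : 0 <= C1 by exact: le_trans (aC 0).
have C2_ge0 : 0 <= C2 by exact: le_trans (bC 0).
pose K' := K + 2 * C0 + C1 + 2 * C2.
have bd x h : [/\ `|phi (x + h)| <= C0, `|phi x| <= C0,
    `|a x * h| <= C1 * `|h| & `|b x * h ^+ 2| <= C2 * `|h| ^+ 2].
  by split => //; rewrite normrM ?normrX ler_wpM2r.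
exists K'; split; first by rewrite /K'; lra.
- split => //; exists a, b; split => // x h.
  have [p1 p2 p3 p4] := bd x h; have p5 := abK x h.
  rewrite -[h ^+ 2 in leRHS]real_normK ?num_real//.
  move: p1 p2 p3 p4 p5 (normr_ge0 h); rewrite !ler_norml; move: `|h| => r.
  move=> /andP[? ?] /andP[? ?] /andP[? ?] /andP[? ?] /andP[? ?] r0.
  have [r1|r1] := leP r 1.
    rewrite min_r; last by nra.
    have r3 : 0 <= r ^+ 3 by rewrite exprn_ge0.
    by rewrite /K'; apply/andP; split; nra.
  rewrite min_l; last by nra.
  have r2 : 1 <= r ^+ 2 by nra.
  have r12 : r <= r ^+ 2 by nra.
  rewrite /K'.
  have : C0 * 1 <= C0 * r ^+ 2 by exact: ler_wpM2l.
  have : C1 * r <= C1 * r ^+ 2 by exact: ler_wpM2l.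
  have : 0 <= K * r ^+ 2 by apply: mulr_ge0; lra.
  have : 0 <= C2 * r ^+ 2 by apply: mulr_ge0; lra.
  by move=> *; apply/andP; split; lra.
- split => //; exists a => // x h.
  have [p1 p2 p3 p4] := bd x h; have p5 := abK x h.
  rewrite -[h ^+ 2 in leRHS]real_normK ?num_real//.
  move: p1 p2 p3 p4 p5 (normr_ge0 h); rewrite !ler_norml; move: `|h| => r.
  move=> /andP[? ?] /andP[? ?] /andP[? ?] /andP[? ?] /andP[? ?] r0.
  have [r1|r1] := leP r 1.
    rewrite min_r; last by nra.
    have r2 : 0 <= r ^+ 2 by rewrite exprn_ge0.
    have r32 : r ^+ 3 <= r ^+ 2.
      by rewrite [r ^+ 3]exprS ler_piMl.
    have : K * r ^+ 3 <= K * r ^+ 2 by exact: ler_wpM2l.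
    have : 0 <= C0 * r ^+ 2 by exact: mulr_ge0.
    have : 0 <= C1 * r ^+ 2 by exact: mulr_ge0.
    have : 0 <= C2 * r ^+ 2 by exact: mulr_ge0.
    by rewrite /K' => *; apply/andP; split; lra.
  rewrite min_l; last by nra.
  have : C0 * 1 <= C0 * r by apply: ler_wpM2l => //; lra.
  have : 0 <= K * r by exact: mulr_ge0.
  have : 0 <= C2 * r by exact: mulr_ge0.
  have : 0 <= C1 * r by exact: mulr_ge0.
  by rewrite /K' => *; apply/andP; split; lra.
Qed.

(** One minus two mirrored steps, whose transitions do not overlap because c >= 0. *)
Lemma bump_exists (c delta : R) : 0 <= c -> 0 < delta ->
  exists phi, [/\ forall x, 0 <= phi x <= 1,
    forall x, `|x| <= c -> phi x = 1, forall x, c + delta <= `|x| -> phi x = 0 &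
    exists K : R,
    [/\ 0 <= K, taylor2 (fun h => K * Num.min (h ^+ 2) (`|h| ^+ 3)) phi &
      taylor1 (fun h => K * Num.min `|h| (h ^+ 2)) phi]].
Proof.
move=> c0 d0.
(* The step climbs over a length 3, here squeezed into the margin delta. *)
have [k [k0 kd]] : exists k : R, 0 < k /\ k * delta = 3.
  by exists (3 / delta); rewrite divr_gt0// divfK ?gt_eqF.
have km (y z : R) : y <= z -> k * y <= k * z by move=> yz; rewrite ler_pM2l.
pose phi x := 1 - step (k * x + - (k * c)) - step (- k * x + - (k * c)).
exists phi; split.
- move=> x; rewrite /phi.
  have := step_01 (k * x + - (k * c)); have := step_01 (- k * x + - (k * c)).
  have [x0|x0] := leP 0 x.
    by rewrite (@step_le0 (- k * x + - (k * c))); [lra|nra].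
  by rewrite (@step_le0 (k * x + - (k * c))); [lra|nra].
- move=> x; rewrite ler_norml => /andP[/km h1 /km h2]; rewrite /phi.
  by rewrite !step_le0 ?subr0//; lra.
- move=> x; rewrite /phi; have [x0|x0] := leP 0 x.
    rewrite ger0_norm// => /km xc.
    have kx := km _ _ x0; have kc := km _ _ c0.
    rewrite (@step_le0 (- k * x + - (k * c))); last by lra.
    by rewrite step_ge3; [lra|rewrite -kd; lra].
  rewrite ltr0_norm// => /km xc.
  have kx := km _ _ (ltW x0); have kc := km _ _ c0.
  rewrite (@step_le0 (k * x + - (k * c))); last by lra.
  by rewrite step_ge3; [lra|rewrite -kd; lra].
- apply: cubic_taylor_min; apply: cubic_taylorB; first apply: cubic_taylorB.
  + exact: cubic_taylor_cst.
  + exact: cubic_taylor_affine.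
  + exact: cubic_taylor_affine.
Qed.

End bump.

(** * Expectations of functions of independent sums *)

Section independent_sums.
Context dO (Omega : measurableType dO) (R : realType).
Variable P : probability Omega R.

Section joint.
Context d (T : measurableType d).
Variable X : nat -> {RV P >-> T}.
Hypothesis indepX : mutually_independent X.

(** A pi-system generating the past of the first [k] variables. *)
Let cylinder (k : nat) : set (set Omega) :=
  [set A | exists2 B : nat -> set T, forall i, measurable (B i) &
    A = \bigcap_(i in [set` iota 0 k]) (X i @^-1` B i)].

Let mpre i (B : set T) : measurable B -> measurable (X i @^-1` B).
Proof. by move=> mB; rewrite -[X in measurable X]setTI; exact: measurable_funP. Qed.

Let mem_upto i k : [set` iota 0 k] i = (i < k)%N.
Proof. by rewrite /= mem_iota. Qed.

Let measurable_cylinder k : cylinder k `<=` measurable.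
Proof.
move=> _ [B mB ->]; apply: fin_bigcap_measurable; last by move=> i _; exact: mpre.
exact: finite_seq.
Qed.

Let cylinder_setI k : setI_closed (cylinder k).
Proof.
move=> _ _ [B mB ->] [C mC ->]; exists (fun i => B i `&` C i).
  by move=> i; exact: measurableI.
rewrite eqEsubset; split=> [x [Bx Cx] i ik|x BCx]; first by split; [exact: Bx|exact: Cx].
by split=> i ik; have [] := BCx i ik.
Qed.

Let cylinder_setT k : cylinder k setT.
Proof.
exists (fun=> setT) => //.
by rewrite eqEsubset; split=> // x _ i _.
Qed.

Let cylinder_indep k A B : cylinder k A -> measurable B ->
  P (A `&` X k @^-1` B) = (P A * P (X k @^-1` B))%E.
Proof.
move=> [C mC ->] mB.
(* One sequence carries the past constraints and the new one, so that the product formula applies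
   over both [iota 0 k] and [iota 0 k.+1]. *)
pose C' i := if i == k then B else C i.
have mC' i : measurable (C' i) by rewrite /C'; case: ifP.
have Ck : {in iota 0 k, forall i, C' i = C i}.
  by move=> i; rewrite mem_iota add0n /C' => /andP[_ ik]; rewrite ltn_eqF.
have E k' : measurable (\bigcap_(i in [set` iota 0 k']) (X i @^-1` C' i)).
  by apply: (@measurable_cylinder k'); exists C'.
have -> : \bigcap_(i in [set` iota 0 k]) (X i @^-1` C i) =
    \bigcap_(i in [set` iota 0 k]) (X i @^-1` C' i).
  by apply: eq_bigcapr => i ik; rewrite Ck.
have -> : B = C' k by rewrite /C' eqxx.
have -> : \bigcap_(i in [set` iota 0 k]) (X i @^-1` C' i) `&` X k @^-1` C' k =
    \bigcap_(i in [set` iota 0 k.+1]) (X i @^-1` C' i).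
  rewrite eqEsubset; split=> x.
    move=> [h1 h2] i; rewrite mem_upto ltnS leq_eqVlt.
    by move=> /orP[/eqP->//|ik]; apply: h1; rewrite mem_upto.
  move=> h; split; last by apply: h; rewrite mem_upto.
  by move=> i; rewrite mem_upto => ik; apply: h; rewrite mem_upto leqW.
rewrite -[LHS]fineK ?fin_num_measure//.
rewrite -[X in (X * _)%E]fineK ?fin_num_measure//.
rewrite -[X in (_ * X)%E]fineK ?fin_num_measure//; last exact: mpre.
rewrite !indepX ?iota_uniq// -EFinM; congr EFin.
by rewrite -(addn1 k) iotaD big_cat/= big_seq1 add0n.
Qed.

(** The hypothesis on [S] says that it is a function of X_0, ..., X_(k-1): it is measurable for
    every generated sigma-algebra containing their events. Restricting P to the event on X_k, and
    scaling P by the probability of that event, give two measures that agree on the cylinders, hence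
    on the sigma-algebra they generate. *)
Lemma indep_next k (S : Omega -> R) (A : set R) (B : set T) :
  (forall G : set (set Omega), (forall i C, (i < k)%N -> measurable C ->
     <<s G >> (X i @^-1` C)) -> measurable_fun [set: g_sigma_algebraType G] S) ->
  measurable A -> measurable B ->
  P (S @^-1` A `&` X k @^-1` B) = (P (S @^-1` A) * P (X k @^-1` B))%E.
Proof.
move=> mS mA mB.
have SA : <<s cylinder k >> (S @^-1` A).
  have h : measurable_fun [set: g_sigma_algebraType (cylinder k)] S.
    apply: mS => i C ik mC; apply: sub_sigma_algebra.
    exists (fun j => if j == i then C else setT); first by move=> j; case: ifP.
    rewrite eqEsubset; split=> x; first by move=> Cx j /= jk; case: eqP => // ->.
    by move=> /(_ i); rewrite mem_upto /= eqxx; exact.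
  by have := h measurableT A mA; rewrite setTI.
have mXB := mpre k mB.
pose r : {nonneg R} := NngNum (fine_ge0 (measure_ge0 P (X k @^-1` B))).
have rE : (r%:num%:E = P (X k @^-1` B))%E by rewrite /= fineK ?fin_num_measure.
transitivity (mscale r P (S @^-1` A)); last by rewrite /mscale rE muleC.
apply: (@g_sigma_algebra_measure_unique _ _ _ (cylinder k) _ (fun=> setT) _ _
  (mrestr P mXB) (mscale r P)) => //.
- by rewrite bigcup_const.
- by move=> C cC; apply: etrans (cylinder_indep cC mB) _; rewrite muleC -rE.
- by move=> n; rewrite /mrestr -ge0_fin_numE// fin_num_measure// setTI.
Qed.

End joint.

Variable Y : nat -> {RV P >-> R}.
Hypothesis indepY : mutually_independent Y.
Variable Q : probability R R.
Hypothesis lawY : forall i (B : set R), measurable B ->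
  distribution P (Y i) B = Q B.

Let S k (w : Omega) : R := \sum_(i < k) Y i w.

Let measurable_S k : measurable_fun [set: Omega] (S k).
Proof. by apply: measurable_sum => i. Qed.

(** The law of (S_k, Y_k) is a product, so Fubini integrates the last step out and leaves k terms
    with [average Q phi] in place of phi. *)
Lemma expectation_sum_iter k phi : bounded_mfun phi ->
  \int[P]_w phi (S k w) = iter k (average Q) phi 0.
Proof.
elim: k phi => [|k IH] phi bphi.
  rewrite /S; under eq_Rintegral do rewrite big_ord0.
  by rewrite Rintegral_cst//= probability_setT mulr1.
rewrite iterSr -(IH _ (bounded_mfun_average Q bphi)).
have [mphi [C phiC]] := bphi.
pose Sk : {mfun Omega >-> R} := HB.pack (S k) (isMeasurableFun.Build _ _ _ _ _ (measurable_S k)).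
pose LS := distribution P Sk.
have mpair : measurable_fun [set: Omega] (fun w => (S k w, Y k w)).
  exact: measurable_fun_pair.
pose Jp : {mfun Omega >-> (R * R)%type} :=
  HB.pack (fun w => (S k w, Y k w)) (isMeasurableFun.Build _ _ _ _ _ mpair).
pose J := distribution P Jp.
have mf := measurable_add_pair mphi.
have JE U : measurable U -> (LS \x Q)%E U = J U.
  apply: product_measure_unique => A B mA mB.
  transitivity (LS A * distribution P (Y k) B)%E; last first.
    by congr (_ * _)%E; exact: lawY.
  apply: (@indep_next _ _ Y) => // G mG.
  apply: measurable_sum => i _ B' mB'; rewrite setTI.
  exact: mG.
have iJ : J.-integrable setT (fun z : R * R => (phi (z.1 + z.2))%:E).
  exact: (bounded_integrable J mf (C := C)).
transitivity (\int[J]_z phi (z.1 + z.2)).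
  rewrite /Rintegral /J integral_distribution//; last first.
  - apply: (bounded_integrable P (C := C)) => //.
    exact: (measurableT_comp mf mpair).
  - by apply/measurable_EFinP.
  by congr fine; apply: eq_integral => w _; rewrite /= /S big_ord_recr.
have -> : \int[J]_z phi (z.1 + z.2) = \int[(LS \x Q)%E]_z phi (z.1 + z.2).
  by congr fine; apply: eq_measure_integral => U mU _; exact/esym/JE.
have iLQ : (LS \x Q)%E.-integrable setT (fun z : R * R => (phi (z.1 + z.2))%:E).
  exact: (bounded_integrable (LS \x Q)%E mf (C := C)).
have [mavg [C' avgC]] := bounded_mfun_average Q bphi.
rewrite /Rintegral -(integral12_prod_meas1 iLQ).
transitivity (fine (\int[LS]_x (average Q phi x)%:E)).
  congr fine; apply: eq_integral => x _.
  rewrite /fubini_F/= /average /Rintegral fineK//.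
  by apply: integrable_fin_num => //; exact: translate_integrable.
rewrite /LS integral_distribution//; first exact/measurable_EFinP.
by apply: (bounded_integrable P (C := C')) => //; exact: measurableT_comp.
Qed.

End independent_sums.

(** * Densities and normal laws *)

Section density.
Context d (T : measurableType d) (R : realType).
Variables (mu : {sigma_finite_measure set T -> \bar R}) (G : probability T R).
Variable g : T -> R.
Hypothesis mg : measurable_fun [set: T] g.
Hypothesis g0 : forall x, 0 <= g x.
Hypothesis Gg : forall B : set T, measurable B ->
  G B = (\int[mu]_(x in B) (g x)%:E)%E.

Lemma density_dominates : G `<< mu.
Proof.
apply/null_content_dominatesP => A mA muA0; rewrite Gg//.
by apply: null_set_integral => //; apply/measurable_EFinP; exact: measurable_funTS.
Qed.

(** The Radon-Nikodym derivative of G and [g] have the same integral over every measurable set, so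
    they agree almost everywhere. *)
Lemma ge0_integral_density (h : T -> \bar R) :
  measurable_fun [set: T] h -> (forall x, (0 <= h x)%E) ->
  (\int[G]_x h x = \int[mu]_x (h x * (g x)%:E))%E.
Proof.
move=> mh h0; have Gmu := density_dominates.
rewrite -(Radon_Nikodym_SigmaFinite.change_of_variables Gmu)//.
have intRN := Radon_Nikodym_SigmaFinite.f_integrable Gmu.
have mEg : measurable_fun [set: T] (EFin \o g) by apply/measurable_EFinP.
have aeE : ae_eq mu setT (Radon_Nikodym_SigmaFinite.f G mu) (EFin \o g).
  apply: integral_ae_eq => // E _ mE.
  by rewrite -Radon_Nikodym_SigmaFinite.f_integral//; exact: Gg.
apply: ae_eq_integral => //.
- by apply: emeasurable_funM => //; exact: measurable_int intRN.
- exact: emeasurable_funM.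
- exact: ae_eqe_mul2l.
Qed.

Lemma integrable_density (h : T -> R) : measurable_fun [set: T] h ->
  G.-integrable [set: T] (EFin \o h) <->
  mu.-integrable [set: T] (EFin \o (fun x => h x * g x)).
Proof.
move=> mh.
have mEh : measurable_fun [set: T] (EFin \o h) by apply/measurable_EFinP.
have mhg : measurable_fun [set: T] (EFin \o (fun x => h x * g x)).
  by apply/measurable_EFinP; exact: measurable_funM.
have E : (\int[G]_x `|(h x)%:E| = \int[mu]_x `|(h x * g x)%:E|)%E.
  rewrite ge0_integral_density//; last exact: measurableT_comp.
  by apply: eq_integral => x _; rewrite EFinM abseM (@gee0_abs _ (g x)%:E)// lee_fin.
by split=> /integrableP[_ hoo]; apply/integrableP; split=> //; move: hoo; rewrite E.
Qed.

Lemma integral_density (h : T -> R) : measurable_fun [set: T] h ->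
  (\int[G]_x (h x)%:E = \int[mu]_x (h x * g x)%:E)%E.
Proof.
move=> mh.
have mEh : measurable_fun [set: T] (EFin \o h) by apply/measurable_EFinP.
rewrite [LHS]integralE [RHS]integralE !ge0_integral_density//; last 2 first.
- exact: measurable_funeneg.
- exact: measurable_funepos.
congr (_ - _)%E; apply: eq_integral => x _ /=.
- by rewrite !funeposE EFinM maxeMl ?mul0e// lee_fin.
- by rewrite !funenegE EFinM -mulNe maxeMl ?mul0e// lee_fin.
Qed.

End density.

Section lebesgue_affine.
Context {R : realType}.
Notation leb := (@lebesgue_measure R).

(** The image of Lebesgue measure under the affine map, multiplied by c, gives half-open intervals
    their length, which characterises Lebesgue measure. *)
Lemma lebesgue_affine (c b : R) (c0 : 0 < c) (f : R -> \bar R) :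
  measurable_fun [set: R] f -> (forall x, (0 <= f x)%E) ->
  (\int[leb]_x f x = c%:E * \int[leb]_x f (c * x + b)%R)%E.
Proof.
move=> mf f0.
have maff : measurable_fun [set: measurableTypeR R]
   (fun x : R => c * x + b : measurableTypeR R).
  by apply: measurable_funD => //; exact: measurable_funM.
pose aff x : measurableTypeR R := c * x + b.
pose pm : {measure set measurableTypeR R -> \bar R} :=
  measure_function_pushforward__canonical__measure_function_Measure leb maff.
pose r : {nonneg R} := NngNum (ltW c0).
pose m := mscale r pm.
have pre a1 b1 : aff @^-1` `]a1, b1]%classic = `](a1 - b) / c, (b1 - b) / c]%classic.
  rewrite eqEsubset; split=> x; rewrite /aff /= !in_itv/=.
    by rewrite ltr_pdivrMr// ler_pdivlMr// ltrBlDr lerBrDr mulrC.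
  by rewrite ltr_pdivrMr// ler_pdivlMr// ltrBlDr lerBrDr mulrC.
have mE A : measurable A -> leb A = m A.
  apply: lebesgue_measure_unique => _ [[a1 b1] _ <-].
  transitivity (c%:E * leb `]((a1 - b) / c)%R, ((b1 - b) / c)%R]%classic)%E; last first.
    by rewrite -pre.
  rewrite !lebesgue_measure_itv/= !lte_fin.
  rewrite ltr_pM2r ?invr_gt0// ltrD2r; case: ifP => _; last by rewrite mule0.
  rewrite -!EFinB -EFinM -mulrBl mulrC divfK ?gt_eqF//.
  by rewrite opprB addrA subrK.
transitivity (\int[m]_x f x)%E; first by apply: eq_measure_integral => A mA _; exact: mE.
rewrite /m ge0_integral_mscale//; congr (_ * _)%E.
by rewrite ge0_integral_pushforward.
Qed.

End lebesgue_affine.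

Section normal_convolution.
Context {R : realType}.
Notation leb := (@lebesgue_measure R).
Implicit Types (s t r c x : R) (Q : probability R R) (phi : R -> R).

Lemma eq_average Q Q' phi x : (forall B : set R, measurable B -> Q B = Q' B) ->
  average Q phi x = average Q' phi x.
Proof.
by move=> QQ'; congr fine; apply: eq_measure_integral => B mB _; exact: QQ'.
Qed.

Let normal_density s (h : R -> \bar R) : measurable_fun [set: R] h ->
  (forall x, (0 <= h x)%E) ->
  (\int[normal_prob 0 s]_x h x = \int[leb]_x (h x * (normal_pdf 0 s x)%:E))%E.
Proof.
move=> mh h0.
apply: (@ge0_integral_density _ _ R leb (normal_prob 0 s) (normal_pdf 0 s)) => //.
exact: measurable_normal_pdf.
Qed.

Lemma normal_prob_scale c s (B : set R) : 0 < c -> 0 < s -> measurable B ->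
  normal_prob 0 (c * s) B = normal_prob 0 s ((fun x => c * x) @^-1` B).
Proof.
move=> c0 s0 mB.
have mc : measurable_fun [set: R] (fun x : R => c * x) by exact: measurable_funM.
have mcB : measurable ((fun x : R => c * x) @^-1` B).
  by rewrite -[X in measurable X]setTI; exact: mc.
transitivity (\int[normal_prob 0 (c * s)]_x (\1_B x)%:E)%E.
  by rewrite integral_indic// setIT.
transitivity (\int[normal_prob 0 s]_x
    (\1_((fun x => c * x)%R @^-1` B) x)%:E)%E; last first.
  by rewrite integral_indic// setIT.
have mI (C : set R) : measurable C ->
    measurable_fun [set: R] (fun x => (\1_C x)%:E : \bar R).
  by move=> mC; apply/measurable_EFinP; exact: measurable_indic.
have I0 (C : set R) (x : R) : (0 <= (\1_C x)%:E :> \bar R)%E by rewrite lee_fin.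
rewrite (normal_density _ (mI _ mB) (I0 B)) (normal_density _ (mI _ mcB) (I0 _)).
have pI0 u (C : set R) (x : R) : (0 <= (\1_C x)%:E * (normal_pdf 0 u x)%:E :> \bar R)%E.
  by rewrite -EFinM lee_fin mulr_ge0// normal_pdf_ge0.
have mpI u (C : set R) : measurable C ->
    measurable_fun [set: R] (fun x => (\1_C x)%:E * (normal_pdf 0 u x)%:E : \bar R)%E.
  move=> mC; apply: emeasurable_funM; first exact: mI.
  by apply/measurable_EFinP; exact: measurable_normal_pdf.
rewrite (lebesgue_affine 0 c0 (mpI _ _ mB) (pI0 _ B)).
rewrite -ge0_integralZl//; first last.
- by rewrite lee_fin ltW.
- apply: (measurableT_comp (mpI _ _ mB)) => //.
  exact: measurable_funD.
apply: eq_integral => x _; rewrite -!EFinM; congr EFin.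
rewrite addr0 mulrCA; congr (_ * _).
have cs0 : c * s != 0 by rewrite mulf_neq0 ?gt_eqF.
have sn0 : s != 0 by rewrite gt_eqF.
rewrite !normal_pdfE//= /normal_peak /normal_fun !subr0.
have -> : (c * s) ^+ 2 * pi *+ 2 = c ^+ 2 * (s ^+ 2 * pi *+ 2).
  by rewrite ?mulr2n; ring.
rewrite sqrtrM ?sqr_ge0// sqrtr_sqr gtr0_norm// invfM mulrA mulrA divff ?gt_eqF//.
rewrite mul1r; congr (_ * expR _).
have e2 (z : R) : z ^+ 2 *+ 2 = 2 * z ^+ 2 by ring.
by rewrite !e2; field; rewrite ?gt_eqF.
Qed.

(** Completing the square in y. Read probabilistically, the joint density of a sum x and one summand
    y is the density of the sum times the conditional density of y; integrating over y leaves the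
    first factor. *)
Lemma normal_pdfM s t x y : 0 < s -> 0 < t -> let r := Num.sqrt (s ^+ 2 + t ^+ 2) in
  normal_pdf 0 s (x - y) * normal_pdf 0 t y =
  normal_pdf 0 r x * normal_pdf (x * t ^+ 2 / r ^+ 2) (s * t / r) y.
Proof.
move=> s0 t0 r.
have st0 : 0 < s ^+ 2 + t ^+ 2 by rewrite addr_gt0 ?exprn_gt0.
have r0 : 0 < r by rewrite sqrtr_gt0.
have r2 : r ^+ 2 = s ^+ 2 + t ^+ 2 by rewrite sqr_sqrtr// ltW.
have v0 : s * t / r != 0 by rewrite !mulf_neq0 ?invr_eq0 ?gt_eqF.
have [sn0 tn0 rn0] : [/\ s != 0, t != 0 & r != 0] by rewrite !gt_eqF.
rewrite !normal_pdfE//= /normal_peak /normal_fun !subr0.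
rewrite mulrACA [RHS]mulrACA -!expRD -!invfM -!sqrtrM; last 2 first.
- by rewrite mulrn_wge0// mulr_ge0 ?pi_ge0// sqr_ge0.
- by rewrite mulrn_wge0// mulr_ge0 ?pi_ge0// sqr_ge0.
congr ((Num.sqrt _)^-1 * expR _).
  by rewrite !mulr2n !exprMn !exprVn r2; field; rewrite ?gt_eqF.
rewrite !exprMn !exprVn r2.
have e2 (z : R) : z ^+ 2 *+ 2 = 2 * z ^+ 2 by ring.
by rewrite !e2; field; rewrite ?gt_eqF.
Qed.

Let normal_convolution_ge0 s t (psi : R -> R) : 0 < s -> 0 < t ->
  measurable_fun [set: R] psi -> (forall x, 0 <= psi x) ->
  (\int[normal_prob 0 t]_y \int[normal_prob 0 s]_z (psi (y + z))%:E =
   \int[normal_prob 0 (Num.sqrt (s ^+ 2 + t ^+ 2))]_w (psi w)%:E)%E.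
Proof.
move=> s0 t0 mpsi psi0; pose r := Num.sqrt (s ^+ 2 + t ^+ 2).
have mtr (y : R) : measurable_fun [set: R] (fun z : R => psi (y + z)).
  by apply: measurableT_comp => //; exact: measurable_funD.
have mpdf u m : measurable_fun [set: R] (normal_pdf m u).
  exact: measurable_normal_pdf.
have mEtr (y : R) : measurable_fun [set: R] (fun z : R => (psi (y + z))%:E).
  by apply/measurable_EFinP; exact: mtr.
have Etr0 (y z : R) : (0 <= (psi (y + z))%:E)%E by rewrite lee_fin.
have pp0 u v (y z : R) : (0 <= (psi z * normal_pdf u v y)%:E)%E.
  by rewrite lee_fin mulr_ge0// normal_pdf_ge0.
have inner y : (\int[normal_prob 0 s]_z (psi (y + z))%:E =
    \int[leb]_z (psi z * normal_pdf 0 s (z - y))%:E)%E.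
  rewrite (normal_density _ (mEtr y) (Etr0 y)).
  rewrite (lebesgue_affine (- y) ltr01); first last.
  - by move=> z; rewrite -EFinM lee_fin; apply: mulr_ge0 (psi0 _) (normal_pdf_ge0 _ _ _).
  - by apply/measurable_EFinP; apply: measurable_funM; [exact: mtr|exact: mpdf].
  rewrite mul1e; apply: eq_integral => z _.
  by rewrite mul1r -EFinM addrC subrK.
under eq_integral do rewrite inner.
pose f (yz : R * R) := (psi yz.2 * normal_pdf 0 s (yz.2 - yz.1) *
  normal_pdf 0 t yz.1)%:E.
have mf1 : measurable_fun [set: R * R]
    (fun yz : R * R => psi yz.2 * normal_pdf 0 s (yz.2 - yz.1)).
  apply: measurable_funM; first by apply: measurableT_comp.
  by apply: measurableT_comp => //; exact: measurable_funB.
have mf : measurable_fun [set: R * R] f.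
  apply/measurable_EFinP; apply: measurable_funM => //.
  by apply: measurableT_comp.
have f0 z : (0 <= f z)%E by rewrite lee_fin !mulr_ge0// normal_pdf_ge0.
have mH : measurable_fun [set: R]
    (fun y => \int[leb]_z (psi z * normal_pdf 0 s (z - y))%:E)%E.
  apply: (@measurable_fun_fubini_tonelli_F _ _ _ _ _ leb
    (fun yz : R * R => (psi yz.2 * normal_pdf 0 s (yz.2 - yz.1))%:E)).
    exact/measurable_EFinP.
  by move=> z; exact: pp0.
have H0 y : (0 <= \int[leb]_z (psi z * normal_pdf 0 s (z - y))%:E)%E.
  by apply: integral_ge0 => z _; exact: pp0.
rewrite (normal_density _ mH H0).
transitivity (\int[leb]_y \int[leb]_z f (y, z))%E.
  apply: eq_integral => y _; rewrite -ge0_integralZr//.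
  - apply/measurable_EFinP; apply: measurable_funM => //.
    by apply: measurableT_comp => //; exact: measurable_funB.
  - by rewrite lee_fin normal_pdf_ge0.
have mpsiE : measurable_fun [set: R] (EFin \o psi) by exact/measurable_EFinP.
have psiE0 y : (0 <= (EFin \o psi) y)%E by rewrite lee_fin.
(* After the exchange the inner integral runs over the summand [y], where [normal_pdfM] isolates a
   probability density. *)
transitivity (\int[leb]_z \int[leb]_y f (y, z))%E.
  exact: (@fubini_tonelli _ _ _ _ _ leb leb f mf f0).
rewrite (normal_density _ mpsiE psiE0).
apply: eq_integral => z _.
transitivity (\int[leb]_y ((psi z * normal_pdf 0 r z)%:E *
    (normal_pdf (z * t ^+ 2 / r ^+ 2) (s * t / r) y)%:E))%E.
  apply: eq_integral => y _; rewrite /f/= -EFinM; congr EFin.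
  by rewrite -[LHS]mulrA -[RHS]mulrA normal_pdfM.
have mEpdf u m : measurable_fun [set: R] (fun y => (normal_pdf m u y)%:E).
  exact/measurable_EFinP.
have pdfE0 u m (y : R) : setT y -> (0 <= (normal_pdf m u y)%:E)%E.
  by rewrite lee_fin normal_pdf_ge0.
rewrite (@ge0_integralZl _ _ _ leb _ measurableT _ (mEpdf _ _) _ (pdfE0 _ _))//.
by rewrite integral_normal_pdf mule1.
Qed.

Lemma measurable_scale c : measurable_fun [set: R] (fun x : R => c * x).
Proof. exact: measurable_funM. Qed.

Definition scale_mfun c : {mfun R >-> R} :=
  HB.pack (fun x : R => c * x) (isMeasurableFun.Build _ _ _ _ _ (measurable_scale c)).

Definition scale_law c Q : probability R R := distribution Q (scale_mfun c).

Let measurable_canonical :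
  measurable_fun [set: measurableTypeR R] (fun x : measurableTypeR R => x : R).
Proof. exact: (@measurable_id _ (measurableTypeR R)). Qed.

Let canonical_mfun : {mfun measurableTypeR R >-> R} :=
  HB.pack (fun x : measurableTypeR R => x : R)
    (isMeasurableFun.Build _ _ _ _ _ measurable_canonical).

(* [normal_prob] lives on [measurableTypeR R], whose display differs from that
   of the canonical measurable structure of [R]. *)
Definition centered_normal s : probability R R :=
  distribution (normal_prob 0 s) canonical_mfun.

Lemma centered_normalE s (B : set R) : centered_normal s B = normal_prob 0 s B.
Proof. by []. Qed.

Lemma ge0_integral_centered_normal s (h : R -> \bar R) :
  measurable_fun [set: R] h -> (forall x, (0 <= h x)%E) ->
  (\int[centered_normal s]_x h x = \int[normal_prob 0 s]_x h x)%E.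
Proof. by move=> mh h0; rewrite ge0_integral_distribution. Qed.

Lemma centered_normal_scale c s (B : set R) : 0 < c -> 0 < s -> measurable B ->
  centered_normal (c * s) B = scale_law c (centered_normal s) B.
Proof. exact: normal_prob_scale. Qed.

(** Convolution identities come from Tonelli, hence for non-negative functions. Adding its bound to
    phi makes it non-negative and shifts every average by the same constant. *)
Lemma average_average Q1 Q2 Q3 phi x :
  (forall psi : R -> R, measurable_fun [set: R] psi -> (forall y, 0 <= psi y) ->
    (\int[Q1]_y \int[Q2]_z (psi (y + z))%:E = \int[Q3]_y (psi y)%:E)%E) ->
  bounded_mfun phi -> average Q1 (average Q2 phi) x = average Q3 phi x.
Proof.
move=> Q123 bphi; have [mphi [C phiC]] := bphi.
have bC : bounded_mfun (fun=> - C) by split => //; exists `|- C|.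
have avC Q y : average Q (fun=> - C) y = - C.
  by rewrite /average Rintegral_cst//= probability_setT mulr1.
have avB Q y (h : R -> R) : bounded_mfun h ->
    average Q (fun y => h y - (- C)) y = average Q h y - - C.
  by move=> bh; rewrite averageB// avC.
pose psi y := phi y - (- C).
have bpsi : bounded_mfun psi by exact: bounded_mfunB.
have avpsi : average Q2 psi = fun y => average Q2 phi y - (- C).
  by apply/funext => y; exact: avB.
suff : average Q1 (average Q2 psi) x = average Q3 psi x.
  rewrite avpsi avB; last exact: bounded_mfun_average.
  by rewrite avB// => /addIr.
have psi0 y : 0 <= psi y.
  by rewrite /psi opprK -lerBlDr sub0r; have := phiC y; rewrite ler_norml => /andP[].
have [mtr _] := bounded_mfun_translate x bpsi.
rewrite /average /Rintegral -(Q123 _ mtr (fun y => psi0 (x + y))).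
congr fine; apply: eq_integral => y _; rewrite fineK.
  by apply: eq_integral => z _; rewrite addrA.
by apply: integrable_fin_num => //; exact: translate_integrable.
Qed.

Lemma normal_convolution s t phi x : 0 < s -> 0 < t -> bounded_mfun phi ->
  average (centered_normal t) (average (centered_normal s) phi) x =
  average (centered_normal (Num.sqrt (s ^+ 2 + t ^+ 2))) phi x.
Proof.
move=> s0 t0; apply: average_average => psi mpsi psi0.
have mtr (y : R) : measurable_fun [set: R] (fun z : R => (psi (y + z))%:E).
  apply/measurable_EFinP; apply: measurableT_comp => //.
  exact: measurable_funD.
have tr0 (y z : R) : (0 <= (psi (y + z))%:E)%E by rewrite lee_fin.
have mpair : measurable_fun [set: R * R]
    (fun z : R * R => (psi (z.1 + z.2))%:E).
  by apply/measurable_EFinP; exact: measurable_add_pair.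
have mavg : measurable_fun [set: R]
    (fun y => \int[centered_normal s]_z (psi (y + z))%:E)%E.
  apply: (measurable_fun_fubini_tonelli_F
    (fun z : R * R => (psi (z.1 + z.2))%:E)); first exact: mpair.
  by move=> z; exact: (tr0 z.1 z.2).
have avg0 y : (0 <= \int[centered_normal s]_z (psi (y + z))%:E)%E.
  by apply: integral_ge0 => z _; exact: tr0.
have mpsiE : measurable_fun [set: R] (EFin \o psi) by exact/measurable_EFinP.
have psiE0 y : (0 <= (EFin \o psi) y)%E by rewrite lee_fin.
apply: etrans (ge0_integral_centered_normal t mavg avg0) _.
apply: etrans (esym (ge0_integral_centered_normal _ mpsiE psiE0)).
apply: etrans (normal_convolution_ge0 s0 t0 mpsi psi0).
by apply: eq_integral => y _; exact: ge0_integral_centered_normal (mtr y) (tr0 y).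
Qed.

(** Variances add. Counting from one iteration keeps the standard deviation positive. *)
Lemma normal_iter s n phi x : 0 < s -> bounded_mfun phi ->
  iter n.+1 (average (centered_normal s)) phi x =
  average (centered_normal (Num.sqrt n.+1%:R * s)) phi x.
Proof.
move=> s0; elim: n phi => [|n IH] phi bphi; first by rewrite sqrtr1 mul1r.
have q0 : 0 < Num.sqrt n.+1%:R * s by rewrite mulr_gt0 ?sqrtr_gt0.
apply: etrans (_ : _ = iter n.+1 (average (centered_normal s)) _ x) _.
  by rewrite iterSr.
apply: etrans (IH _ (bounded_mfun_average _ bphi)) _.
apply: etrans (normal_convolution x s0 q0 bphi) _.
have -> // : Num.sqrt (s ^+ 2 + (Num.sqrt n.+1%:R * s) ^+ 2) = Num.sqrt n.+2%:R * s.
have -> : s ^+ 2 + (Num.sqrt n.+1%:R * s) ^+ 2 = n.+2%:R * s ^+ 2.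
  by rewrite exprMn sqr_sqrtr// -[n.+2%:R]natr1 mulrDl mul1r addrC.
by rewrite sqrtrM// sqrtr_sqr gtr0_norm.
Qed.

End normal_convolution.

(** * First two moments of the standard normal law *)

Section normal_moments.
Context {R : realType}.
Notation leb := (@lebesgue_measure R).

(** Write y^2 as the integral of y over 0 <= x <= y and exchange the integrals: the inner one
    becomes the tail. This stands in for an integration by parts on a half-line. *)
Let integral_tail_moment (w : R -> R) :
  measurable_fun [set: R] w -> (forall x, 0 <= w x) ->
  (forall x, 0 <= x ->
     (\int[leb]_(y in `[x, +oo[) (y * w y)%:E = (w x)%:E)%E) ->
  (\int[leb]_(y in `[0%R, +oo[) (y ^+ 2 * w y)%:E =
   \int[leb]_(x in `[0%R, +oo[) (w x)%:E)%E.
Proof.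
move=> mw w_ge0 tail.
(* The absolute value makes [f] non-negative on the whole plane, as Tonelli requires; where both
   indicators are 1 it changes nothing. *)
pose f (z : R * R) : \bar R :=
  (((0 <= z.1)%R : nat)%:R * ((z.1 <= z.2)%R : nat)%:R * (`|z.2| * w z.2))%:E.
have mnat (b : R * R -> bool) : measurable_fun [set: R * R] b ->
    measurable_fun [set: R * R] (fun z => (b z : nat)%:R : R).
  move=> mb; rewrite (_ : (fun _ => _) = \1_(b @^-1` [set true])).
    apply: measurable_indic; rewrite -[X in measurable X]setTI.
    exact: mb.
  apply/funext => z; rewrite indicE; congr ((nat_of_bool _)%:R).
  by apply/idP/idP; rewrite inE.
have mf : measurable_fun [set: R * R] f.
  apply/measurable_EFinP; apply: measurable_funM; first apply: measurable_funM.
  - by apply: mnat; apply: measurable_fun_ler.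
  - by apply: mnat; apply: measurable_fun_ler.
  - apply: (measurableT_comp (f := fun y : R => `|y| * w y)) => //.
    by apply: measurable_funM => //; exact: measurableT_comp.
have f0 z : (0 <= f z)%E by rewrite lee_fin !mulr_ge0.
have fub : (\int[leb]_x \int[leb]_y f (x, y) = \int[leb]_y \int[leb]_x f (x, y))%E
  := @fubini_tonelli _ _ _ _ _ leb leb f mf f0.
have int_x : ((\int[leb]_x \int[leb]_y f (x, y) =
    \int[leb]_(x in `[0%R, +oo[) (w x)%:E)%E).
  rewrite [RHS]integral_mkcond; apply: eq_integral => x _; rewrite patchE.
  case: ifPn => [|x0].
    rewrite inE/= in_itv/= andbT => x0; apply: etrans _ (tail x x0).
    rewrite [RHS]integral_mkcond; apply: eq_integral => y _; rewrite patchE.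
    case: ifPn => [|xy].
      rewrite inE/= in_itv/= andbT => xy; rewrite /f/= x0 xy !mul1r ger0_norm//.
      exact: le_trans xy.
    suff /negbTE xy' : ~~ (x <= y) by rewrite /f/= xy' mulr0 mul0r.
    by apply: contra xy => xy; rewrite inE/= in_itv/= andbT.
  suff /negbTE x0' : ~~ (0 <= x).
    by under eq_integral do rewrite /f/= x0' !mul0r; rewrite integral0.
  by apply: contra x0 => x0; rewrite inE/= in_itv/= andbT.
apply: etrans _ int_x; apply: etrans _ (esym fub).
rewrite [LHS]integral_mkcond; apply: eq_integral => y _; rewrite patchE.
have mI : measurable `[0%R, y]%classic by [].
transitivity (\int[leb]_x ((`|y| * w y)%:E * (\1_`[0%R, y]%classic x)%:E))%E; last first.
  apply: eq_integral => x _; rewrite /f/= -EFinM; congr EFin; rewrite mulrC -natrM mulnb.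
  congr (_ %:R * _); congr nat_of_bool.
  by apply/idP/idP; rewrite inE/= in_itv.
have int_I : (\int[leb]_x (\1_`[0%R, y]%classic x)%:E = if (0 < y)%R then y%:E else 0)%E.
  rewrite integral_indic// setIT; apply: etrans (lebesgue_measure_itv `[0%R, y]) _.
  by rewrite /= lte_fin oppr0 adde0.
have mI1 : measurable_fun [set: R] (fun x => (\1_`[0%R, y]%classic x)%:E : \bar R).
  by apply/measurable_EFinP; exact: measurable_indic.
have I1_ge0 (x : R) : setT x -> (0 <= (\1_`[0%R, y]%classic x)%:E :> \bar R)%E.
  by rewrite lee_fin.
have yw_ge0 : (0 <= (`|y| * w y)%:E)%E by rewrite lee_fin mulr_ge0.
apply: etrans _ (esym (@ge0_integralZl _ _ _ leb _ measurableT _ mI1 _ I1_ge0 yw_ge0)).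
rewrite int_I.
case: ifPn => [|y0].
  rewrite inE/= in_itv/= andbT le_eqVlt => /orP[/eqP <-|y0].
    by rewrite ltxx mule0 expr0n mul0r.
  by rewrite y0 gtr0_norm// -EFinM; congr EFin; ring.
suff /negbTE y0' : ~~ (0 < y) by rewrite y0' mule0.
by apply: contra y0 => y0; rewrite inE/= in_itv/= andbT ltW.
Qed.

Let w : R -> R := normal_pdf 0 1.

Let wE : w = fun x => normal_peak 1 * expR (2^-1 * - x ^+ 2).
Proof.
rewrite /w normal_pdfE ?oner_eq0//; apply/funext => x.
rewrite /normal_fun subr0 expr1n; congr (_ * expR _).
by rewrite mulrC; congr (_ * _); rewrite mulr2n.
Qed.

Let w_ge0 x : 0 <= w x. Proof. exact: normal_pdf_ge0. Qed.

Let w_cont : continuous w.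
Proof. by apply: continuous_normal_pdf; rewrite oner_eq0. Qed.

Let mw : measurable_fun [set: R] w. Proof. exact: measurable_normal_pdf. Qed.

Let w_even x : w (- x) = w x.
Proof. by rewrite wE sqrrN. Qed.

Let is_derive_w (x : R) : is_derive x (1 : R) w (- (x * w x)).
Proof.
rewrite wE; apply: is_derive_eq; rewrite /GRing.scale/=.
by field.
Qed.

Let w_cvg : w x @[x --> +oo] --> (0 : R).
Proof.
rewrite wE -[X in _ --> X](mulr0 (normal_peak 1)); apply: cvgMr.
(* For x >= 1 the exponent -x^2/2 is at most -x/2. *)
apply: (@squeeze_cvgr _ _ _ _ (fun=> 0) (fun x => expR (- (2^-1 * x)))).
- near=> x; have x1 : 1 <= x by near: x; exact: nbhs_pinfty_ge.
  by rewrite expR_ge0/= ler_expR; nra.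
- exact: cvg_cst.
- apply: (cvg_comp (fun x => 2^-1 * x) (fun x => expR (- x))); last exact: cvgr_expR.
  by apply: gt0_cvgMry => //; rewrite ?invr_gt0.
Unshelve. all: by end_near. Qed.

(** Since w' = -y w, the function -w is an antiderivative of the integrand and vanishes at
    infinity. *)
Let tail (x : R) : 0 <= x ->
  (\int[leb]_(y in `[x, +oo[) (y * w y)%:E = (w x)%:E)%E.
Proof.
move=> x0.
have dN y : is_derive y (1 : R) (fun z => - w z) (y * w y).
  by have := is_deriveN (is_derive_w y); rewrite opprK.
rewrite (@ge0_continuous_FTC2y _ (fun y => y * w y) (fun y => - w y) x 0).
- by rewrite -EFinB sub0r opprK.
- by move=> y xy; rewrite mulr_ge0// (le_trans x0).
- apply: continuous_subspaceT => y; apply: cvgM; [exact: cvg_id|exact: w_cont].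
- by rewrite -[X in _ --> X]oppr0; exact: cvgN.
- by move=> y _; have [] := dN y.
- by apply: cvg_at_right_filter; apply: cvgN; exact: w_cont.
- by move=> y _; rewrite derive1E; have [_ ->] := dN y.
Qed.

Let half_second_moment :
  (\int[leb]_(y in `[0%R, +oo[) (y ^+ 2 * w y)%:E =
   \int[leb]_(x in `[0%R, +oo[) (w x)%:E)%E.
Proof. exact: integral_tail_moment mw w_ge0 tail. Qed.

Lemma normal_second_moment : (\int[normal_prob 0 1]_y (y ^+ 2)%:E = 1 :> \bar R)%E.
Proof.
have set_ge0 : [set x : R | 0 <= x] = `[0%R, +oo[%classic.
  by apply/seteqP; split => x/=; rewrite in_itv/= andbT.
rewrite (@ge0_integral_density _ _ R leb (normal_prob 0 1) w)//; last 2 first.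
- by apply/measurable_EFinP; exact: exprn_measurable.
- by move=> x; rewrite lee_fin sqr_ge0.
transitivity (\int[leb]_y (y ^+ 2 * w y)%:E)%E; first exact: eq_integral.
rewrite ge0_symfun_integralT//; first last.
- by move=> x /=; rewrite sqrrN w_even.
- move=> x; apply: cvgM; [exact: sqr_continuous|exact: w_cont].
- by move=> x; rewrite mulr_ge0 ?sqr_ge0.
rewrite set_ge0 half_second_moment -set_ge0 -ge0_symfun_integralT//.
- exact: integral_normal_pdf.
- by move=> x /=; rewrite w_even.
Qed.

Lemma std_normal_second_moment :
  (\int[@centered_normal R 1]_y (y ^+ 2)%:E = 1)%E.
Proof.
rewrite ge0_integral_centered_normal; first exact: normal_second_moment.
- by apply/measurable_EFinP; exact: exprn_measurable.
- by move=> x; rewrite lee_fin sqr_ge0.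
Qed.

Lemma square_integrable_id (Q : probability R R) :
  Q.-integrable [set: R] (EFin \o (fun y => y ^+ 2)) ->
  Q.-integrable [set: R] (EFin \o idfun).
Proof.
move=> Q2.
have Q1 : Q.-integrable [set: R] (EFin \o cst (1 : R)).
  by apply: (@bounded_integrable _ _ _ Q _ 1) => // x; rewrite normr1.
apply: le_integrable (integrableD_EFin Q1 Q2) => //.
  by apply/measurable_EFinP; exact: measurable_id.
move=> x _ /=; rewrite lee_fin [leRHS]ger0_norm ?addr_ge0 ?sqr_ge0//.
by rewrite ler_norml; apply/andP; split; nra.
Qed.

Lemma std_normal_square_integrable :
  (@centered_normal R 1).-integrable [set: R] (EFin \o (fun y => y ^+ 2)).
Proof.
apply/integrableP; split.
  by apply/measurable_EFinP; exact: exprn_measurable.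
under eq_integral do rewrite /= ger0_norm ?sqr_ge0//.
by rewrite std_normal_second_moment ltry.
Qed.

Let lebesgue_opp (f : R -> \bar R) :
  measurable_fun [set: R] f -> (forall x, (0 <= f x)%E) ->
  (\int[leb]_x f x = \int[leb]_x f (- x)%R)%E.
Proof.
move=> mf f0.
have mopp : measurable_fun [set: measurableTypeR R]
    (-%R : measurableTypeR R -> measurableTypeR R) by exact: oppr_measurable.
pose pm : {measure set measurableTypeR R -> \bar R} :=
  measure_function_pushforward__canonical__measure_function_Measure leb mopp.
transitivity (\int[pm]_x f x)%E.
  by apply: eq_measure_integral => A mA _; exact/esym/lebesgue_measureN.
by rewrite ge0_integral_pushforward.
Qed.

(** The density is even, so the positive and negative parts have the same integral, and
    integrability makes it finite. *)
Lemma std_normal_mean : \int[@centered_normal R 1]_y y = 0.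
Proof.
have i1 := square_integrable_id std_normal_square_integrable.
have mpos : measurable_fun [set: R] (fun y => (Num.max y 0)%:E : \bar R).
  by apply/measurable_EFinP; exact: measurable_maxr.
have mneg : measurable_fun [set: R] (fun y => (Num.max (- y) 0)%:E : \bar R).
  by apply/measurable_EFinP; apply: measurable_maxr => //; exact: oppr_measurable.
have pos0 (y : R) : (0 <= (Num.max y 0)%:E :> \bar R)%E by rewrite lee_fin le_max lexx orbT.
have neg0 (y : R) : (0 <= (Num.max (- y) 0)%:E :> \bar R)%E.
  by rewrite lee_fin le_max lexx orbT.
have E : (\int[@centered_normal R 1]_y (Num.max y 0)%:E =
    \int[@centered_normal R 1]_y (Num.max (- y) 0)%:E)%E.
  apply: etrans (ge0_integral_centered_normal 1 mpos pos0) _.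
  apply: etrans _ (esym (ge0_integral_centered_normal 1 mneg neg0)).
  have dens (h : R -> \bar R) : measurable_fun [set: R] h ->
      (forall y, (0 <= h y)%E) ->
      (\int[normal_prob 0 1]_y h y = \int[leb]_y (h y * (w y)%:E))%E.
    by move=> mh h0; exact: (@ge0_integral_density _ _ R leb (normal_prob 0 1) w).
  apply: etrans (dens _ mpos pos0) _.
  apply: etrans _ (esym (dens _ mneg neg0)).
  have mposw : measurable_fun [set: R] (fun y => ((Num.max y 0)%:E * (w y)%:E)%E : \bar R).
    by apply: emeasurable_funM => //; apply/measurable_EFinP.
  have posw0 (y : R) : (0 <= (Num.max y 0)%:E * (w y)%:E :> \bar R)%E.
    by apply: mule_ge0 => //; rewrite lee_fin.
  apply: etrans (lebesgue_opp mposw posw0) _.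
  by apply: eq_integral => y _; rewrite w_even.
rewrite /Rintegral integralE.
under eq_integral do rewrite funeposE -EFin_max.
under [X in (_ - X)%E]eq_integral do rewrite funenegE -EFinN -EFin_max.
rewrite E subee//.
have := integral_funeneg_lt_pinfty measurableT i1.
under eq_integral do rewrite funenegE /= -EFin_max.
move=> h; rewrite ge0_fin_numE//.
by apply: integral_ge0 => y _; exact: neg0.
Qed.

End normal_moments.

(** * Limit theorems for independent samples *)

Section lindeberg.
Context {R : realType}.
Implicit Types (Q : probability R R) (phi h k : R -> R).

(** Lets limits be proved at [n.+1], where n^(-1) and n^(-1/2) are genuine inverses. *)
Lemma near_succ (A : nat -> Prop) :
  (\forall n \near \oo, A n.+1) -> \forall n \near \oo, A n.
Proof. by move=> [N _ hN]; exists N.+1 => // -[|n] //=; rewrite ltnS => /hN. Qed.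

(** Dominated convergence with h as dominating function. For h = y^2 and k = |y|^3 it plays the role
    of Lindeberg's condition, at the cost of two moments only. *)
Lemma truncated_cvg0 Q h k (c : nat -> R) :
  measurable_fun [set: R] k -> (forall y, 0 <= h y) -> (forall y, 0 <= k y) ->
  Q.-integrable [set: R] (EFin \o h) -> (forall n, 0 <= c n) -> c @ \oo --> 0 ->
  (fun n => \int[Q]_y Num.min (h y) (c n * k y)) @ \oo --> 0.
Proof.
move=> mk h0 k0 ih c0 cvgc.
have mh : measurable_fun [set: R] h by apply/measurable_EFinP; exact: measurable_int ih.
pose f_ n y : \bar R := (Num.min (h y) (c n * k y))%:E.
have mf n : measurable_fun [set: R] (f_ n).
  apply/measurable_EFinP; apply: measurable_minr => //.
  exact: measurable_funM.
have lim0 : {ae Q, forall x, setT x -> f_ ^~ x @ \oo --> cst 0%E x}.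
  apply: aeW => y _; apply/fine_cvgP; split; first exact: nearW.
  apply: (@squeeze_cvgr _ _ _ _ (fun=> 0) (fun n => c n * k y)).
  - by apply: nearW => n /=; rewrite le_min h0 mulr_ge0//= ge_min lexx orbT.
  - exact: cvg_cst.
  - by rewrite -[X in _ --> X](mul0r (k y)); apply: cvgMl.
have dom : {ae Q, forall x n, setT x -> (`|f_ n x| <= (EFin \o h) x)%E}.
  apply: aeW => y n _; rewrite /f_ /= lee_fin ger0_norm ?ge_min ?lexx//.
  by rewrite le_min h0 mulr_ge0.
have cvgE : (\int[Q]_y f_ n y @[n --> \oo] --> (0 : \bar R))%E.
  have [_ _] := dominated_convergence measurableT mf (measurable_cst _) lim0 ih dom.
  by rewrite integral0.
by move/fine_cvgP : cvgE => [_].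
Qed.

Lemma integral_scale_law Q (c : R) h : measurable_fun [set: R] h ->
  Q.-integrable [set: R] (EFin \o (fun y => h (c * y))) ->
  (scale_law c Q).-integrable [set: R] (EFin \o h) /\
  \int[scale_law c Q]_y h y = \int[Q]_y h (c * y).
Proof.
move=> mh ih; split.
  by apply: integrable_pushforward => //; exact/measurable_EFinP.
by rewrite /Rintegral /scale_law integral_distribution//; exact/measurable_EFinP.
Qed.

Definition centered_square_integrable Q : Prop :=
  Q.-integrable [set: R] (EFin \o (fun y => y ^+ 2)) /\ \int[Q]_y y = 0.

Let w2 (K : R) (y : R) := K * Num.min (y ^+ 2) (`|y| ^+ 3).

Let mw2 K : measurable_fun [set: R] (w2 K).
Proof.
apply: measurable_funM => //; apply: measurable_minr => //.
by apply: measurable_funX; exact: normr_measurable.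
Qed.

Let w2_scale K (r y : R) : 0 <= r ->
  w2 K (r * y) = K * r ^+ 2 * Num.min (y ^+ 2) (r * `|y| ^+ 3).
Proof.
move=> r0; rewrite /w2 normrM (ger0_norm r0) !exprMn -mulrA; congr (_ * _).
by rewrite minr_pMr ?sqr_ge0//; congr Num.min; ring.
Qed.

Let integrable_min Q h k : Q.-integrable [set: R] (EFin \o h) ->
  measurable_fun [set: R] k -> (forall y, 0 <= h y) -> (forall y, 0 <= k y) ->
  Q.-integrable [set: R] (EFin \o (fun y => Num.min (h y) (k y))).
Proof.
move=> ih mk h0 k0.
have mh : measurable_fun [set: R] h by apply/measurable_EFinP; exact: measurable_int ih.
apply: le_integrable ih => //.
  by apply/measurable_EFinP; exact: measurable_minr.
move=> y _ /=; rewrite lee_fin !ger0_norm ?ge_min ?lexx//.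
by rewrite le_min h0 k0.
Qed.

Let mcube (r : R) : measurable_fun [set: R] (fun y => r * `|y| ^+ 3).
Proof.
apply: measurable_funM => //; apply: measurable_funX.
exact: normr_measurable.
Qed.

(** Up to the truncated remainder, a step changes phi by an amount that depends on [Q] only through
    its mean 0 and its second moment. Laws with equal variances therefore agree to order r^2. *)
Let one_step Q (K : R) phi (a b : R -> R) (r x : R) : bounded_mfun phi ->
  centered_square_integrable Q -> 0 <= r ->
  (forall x h : R, `|phi (x + h) - phi x - a x * h - b x * h ^+ 2| <= w2 K h) ->
  `|average (scale_law r Q) phi x - phi x
    - b x * r ^+ 2 * \int[Q]_y (y ^+ 2)| <=
  K * r ^+ 2 * \int[Q]_y Num.min (y ^+ 2) (r * `|y| ^+ 3).
Proof.
move=> bphi [iQ2 Q0] r0 abw.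
have iQ := square_integrable_id iQ2.
have imin : Q.-integrable [set: R]
    (EFin \o (fun y => Num.min (y ^+ 2) (r * `|y| ^+ 3))).
  by apply: integrable_min => // y; rewrite ?sqr_ge0// mulr_ge0.
pose p y := a x * y + b x * y ^+ 2.
have mp : measurable_fun [set: R] p.
  by apply: measurable_funD; apply: measurable_funM.
have ipr : Q.-integrable [set: R] (EFin \o (fun y => p (r * y))).
  have -> : (fun y => p (r * y)) = (fun y => a x * r * y + b x * r ^+ 2 * y ^+ 2).
    by apply/funext => y; rewrite /p; ring.
  by apply: integrableD_EFin; exact: integrableZl_EFin.
have iwr : Q.-integrable [set: R] (EFin \o (fun y => w2 K (r * y))).
  have -> : (fun y => w2 K (r * y)) =
      (fun y => K * r ^+ 2 * Num.min (y ^+ 2) (r * `|y| ^+ 3)).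
    by apply/funext => y; rewrite w2_scale.
  exact: integrableZl_EFin.
have [ip pE] := integral_scale_law mp ipr.
have [iw wE] := integral_scale_law (@mw2 K) iwr.
have := average_taylor bphi ip iw _; rewrite pE wE.
have -> : \int[Q]_y w2 K (r * y) =
    K * r ^+ 2 * \int[Q]_y Num.min (y ^+ 2) (r * `|y| ^+ 3).
  by rewrite -RintegralZl//; apply: eq_Rintegral => y _; rewrite w2_scale.
have -> : \int[Q]_y p (r * y) = b x * r ^+ 2 * \int[Q]_y (y ^+ 2).
  under eq_Rintegral do rewrite /p mulrA exprMn mulrA.
  rewrite RintegralD//; [|exact: integrableZl_EFin|exact: integrableZl_EFin].
  by rewrite !RintegralZl// Q0 mulr0 add0r.
apply => y; rewrite /p opprD addrA; exact: abw.
Qed.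

(** Each of the n + 1 replacements costs r^2 = 1/(n + 1) times a quantity tending to 0. The class
    [taylor2] is stable under averaging, so the same [K] serves at every step. *)
Lemma lindeberg Q Q' (K : R) phi : 0 <= K ->
  centered_square_integrable Q -> centered_square_integrable Q' ->
  \int[Q]_y (y ^+ 2) = \int[Q']_y (y ^+ 2) ->
  taylor2 (fun y => K * Num.min (y ^+ 2) (`|y| ^+ 3)) phi ->
  forall e : R, 0 < e -> \forall n \near \oo, forall x,
    `|iter n.+1 (average (scale_law (Num.sqrt n.+1%:R)^-1 Q)) phi x -
      iter n.+1 (average (scale_law (Num.sqrt n.+1%:R)^-1 Q')) phi x| <= e.
Proof.
move=> K0 cQ cQ' QQ' tphi e e0.
pose r n : R := (Num.sqrt n.+1%:R)^-1.
have r0 n : 0 <= r n by rewrite invr_ge0 sqrtr_ge0.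
have cvgr : r @ \oo --> 0.
  apply/cvgrPdist_le => d d0; near=> n.
  rewrite sub0r normrN ger0_norm// -[leRHS]invrK lef_pV2 ?posrE ?sqrtr_gt0 ?invr_gt0//.
  rewrite -[leLHS]gtr0_norm ?invr_gt0// -sqrtr_sqr ler_sqrt//.
  apply: (@le_trans _ _ n%:R); last by rewrite ler_nat.
  by near: n; exact: nbhs_infty_ger.
have step n psi : taylor2 (w2 K) psi -> forall x,
    `|average (scale_law (r n) Q) psi x - average (scale_law (r n) Q') psi x| <=
    K * r n ^+ 2 * (\int[Q]_y Num.min (y ^+ 2) (r n * `|y| ^+ 3) +
                    \int[Q']_y Num.min (y ^+ 2) (r n * `|y| ^+ 3)).
  move=> [bpsi [a [b [_ _ abw]]]] x.
  have := one_step x bpsi cQ (r0 n) abw; have := one_step x bpsi cQ' (r0 n) abw.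
  by rewrite QQ' mulrDr !ler_norml; lra.
have sum_le n x : `|iter n.+1 (average (scale_law (r n) Q)) phi x -
      iter n.+1 (average (scale_law (r n) Q')) phi x| <=
    K * (\int[Q]_y Num.min (y ^+ 2) (r n * `|y| ^+ 3) +
                    \int[Q']_y Num.min (y ^+ 2) (r n * `|y| ^+ 3)).
  have tb psi : taylor2 (w2 K) psi -> bounded_mfun psi by case.
  have tavg psi : taylor2 (w2 K) psi ->
    taylor2 (w2 K) (average (scale_law (r n) Q') psi) by exact: taylor2_average.
  have := iter_average_le tb tavg (step n) n.+1 tphi x.
  have rn : r n ^+ 2 * n.+1%:R = 1.
    by rewrite exprVn sqr_sqrtr// mulVf ?pnatr_eq0.
  move/le_trans; apply; rewrite -[leLHS]mulr_natr.
  by rewrite -[leLHS]mulrA (mulrC (_ + _)) mulrA -(mulrA K) rn mulr1.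
have cvgsum : (fun n => K * (\int[Q]_y Num.min (y ^+ 2) (r n * `|y| ^+ 3) +
                    \int[Q']_y Num.min (y ^+ 2) (r n * `|y| ^+ 3))) @ \oo --> 0.
  rewrite -[X in _ --> X](mulr0 K); apply: cvgMr.
  rewrite -[X in _ --> X](addr0 0); apply: cvgD; apply: truncated_cvg0 => //.
  - by apply: measurable_funX; exact: normr_measurable.
  - by move=> y; rewrite sqr_ge0.
  - by case: cQ.
  - by apply: measurable_funX; exact: normr_measurable.
  - by move=> y; rewrite sqr_ge0.
  - by case: cQ'.
near=> n => x; apply: le_trans (sum_le n x) _.
near: n; exact: (cvgr_le 0).
Unshelve. all: by end_near. Qed.

End lindeberg.

Section limit_theorems.
Context {R : realType}.
Implicit Types (Q : probability R R) (phi h k : R -> R).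

(** The law scaled by 0 is the point mass at 0, and its operator is the identity. *)
Lemma average_scale0 Q phi : bounded_mfun phi -> average (scale_law 0 Q) phi = phi.
Proof.
move=> bphi; apply/funext => x; have [mphi [C phiC]] := bphi.
have [mt _] := bounded_mfun_translate x bphi.
have i0 : Q.-integrable [set: R] (EFin \o (fun y => phi (x + 0 * y))).
  apply: (bounded_integrable Q (C := C)) => //.
  by apply: measurableT_comp => //; exact: measurable_funD.
rewrite /average (integral_scale_law mt i0).2.
under eq_Rintegral do rewrite mul0r addr0.
by rewrite Rintegral_cst//= probability_setT mulr1.
Qed.

(** The comparison law is the point mass at 0, which fixes phi, so the class of the telescoping
    argument is the singleton of phi. A step costs 1/(n + 1) times a truncated first moment. *)
Lemma lln_average Q (K : R) phi x : 0 <= K ->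
  Q.-integrable [set: R] (EFin \o idfun) -> \int[Q]_y y = 0 ->
  taylor1 (fun y => K * Num.min `|y| (y ^+ 2)) phi ->
  forall e : R, 0 < e -> \forall n \near \oo,
    `|iter n.+1 (average (scale_law n.+1%:R^-1 Q)) phi x - phi x| <= e.
Proof.
move=> K0 iQ Q0 [bphi [a ba aw]] e e0.
pose r n : R := n.+1%:R^-1.
have r0 n : 0 <= r n by rewrite invr_ge0.
pose w (y : R) := K * Num.min `|y| (y ^+ 2).
have mw : measurable_fun [set: R] w.
  by apply: measurable_funM => //; apply: measurable_minr => //; exact: normr_measurable.
have w_scale n y : w (r n * y) = K * r n * Num.min `|y| (r n * y ^+ 2).
  rewrite /w normrM (ger0_norm (r0 n)) exprMn -mulrA; congr (_ * _).
  by rewrite minr_pMr//; congr Num.min; ring.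
have imin n : Q.-integrable [set: R] (EFin \o (fun y => Num.min `|y| (r n * y ^+ 2))).
  have iQn := integrable_norm iQ.
  apply: le_integrable iQn => //.
    apply/measurable_EFinP; apply: measurable_minr; first exact: normr_measurable.
    by apply: measurable_funM.
  move=> y _ /=; rewrite lee_fin normr_id ger0_norm ?ge_min ?lexx//.
  by rewrite le_min normr_ge0/= mulr_ge0// sqr_ge0.
have iwr n : Q.-integrable [set: R] (EFin \o (fun y => w (r n * y))).
  have -> : (fun y => w (r n * y)) =
      (fun y => K * r n * Num.min `|y| (r n * y ^+ 2)).
    by apply/funext => y; rewrite w_scale.
  exact: integrableZl_EFin.
have step n psi : psi = phi -> forall z,
    `|average (scale_law (r n) Q) psi z - average (scale_law 0 Q) psi z| <=
    K * r n * \int[Q]_y Num.min `|y| (r n * y ^+ 2).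
  move=> -> z; rewrite average_scale0//.
  have [iw wE] := integral_scale_law mw (iwr n).
  have iar : Q.-integrable [set: R] (EFin \o (fun y => a z * (r n * y))).
    have -> : (fun y => a z * (r n * y)) = (fun y => a z * r n * y).
      by apply/funext => y; rewrite mulrA.
    exact: integrableZl_EFin.
  have maz : measurable_fun [set: R] (fun y => a z * y) by exact: measurable_funM.
  have [ia aE] := integral_scale_law maz iar.
  have := average_taylor bphi ia iw (aw z); rewrite aE wE.
  have -> : \int[Q]_y (a z * (r n * y)) = 0.
    under eq_Rintegral do rewrite mulrA.
    by rewrite RintegralZl// Q0 mulr0.
  rewrite subr0; move/le_trans; apply.
  by rewrite -RintegralZl// le_eqVlt; apply/orP; left; apply/eqP/eq_Rintegral => y _; rewrite w_scale.
have iter0 n psi : psi = phi -> iter n (average (scale_law 0 Q)) psi = phi.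
  by move=> ->; elim: n => //= n ->; exact: average_scale0.
have sum_le n : `|iter n.+1 (average (scale_law (r n) Q)) phi x - phi x| <=
    K * \int[Q]_y Num.min `|y| (r n * y ^+ 2).
  have tb psi : psi = phi -> bounded_mfun psi by move=> ->.
  have tavg psi : psi = phi -> average (scale_law 0 Q) psi = phi.
    by move=> ->; exact: average_scale0.
  have := iter_average_le tb tavg (step n) n.+1 (erefl phi) x.
  rewrite (iter0 n.+1 phi erefl).
  have rn : r n * n.+1%:R = 1 by rewrite mulVf ?pnatr_eq0.
  move/le_trans; apply; rewrite -[leLHS]mulr_natr.
  by rewrite -[leLHS]mulrA (mulrC (\int[Q]_y _)) mulrA -(mulrA K) rn mulr1.
have cvgm : (fun n => K * \int[Q]_y Num.min `|y| (r n * y ^+ 2)) @ \oo --> 0.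
  rewrite -[X in _ --> X](mulr0 K); apply: cvgMr.
  apply: (@truncated_cvg0 _ Q (fun y => `|y|) (fun y => y ^+ 2)) => //.
  - by move=> y; rewrite sqr_ge0.
  - exact: integrable_norm iQ.
  - exact: cvg_harmonic.
near=> n; apply: le_trans (sum_le n) _.
near: n; exact: (cvgr_le 0).
Unshelve. all: by end_near. Qed.

(** Stability of the normal law under sums rescaled by the square root of their length. For s = 0,
    the case of a vanishing variance, all laws are point masses and all operators the identity. *)
Lemma average_normal_iter (s : R) n phi x : 0 <= s -> bounded_mfun phi ->
  iter n.+1 (average (scale_law (Num.sqrt n.+1%:R)^-1 (scale_law s (centered_normal 1)))) phi x =
  average (scale_law s (centered_normal 1)) phi x.
Proof.
move=> s0 bphi; set r := (Num.sqrt n.+1%:R)^-1.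
have r0 : 0 < r by rewrite invr_gt0 sqrtr_gt0.
move: s0; rewrite le_eqVlt => /orP[/eqP <-|s0].
  have E0 : average (scale_law r (scale_law 0 (centered_normal 1))) phi = phi.
    apply/funext => y; apply: etrans (_ : _ = average (scale_law 0 (centered_normal 1)) phi y) _.
      apply: eq_average => B mB; rewrite /scale_law /distribution /pushforward/=.
      by congr (centered_normal 1 _); apply/seteqP; split => z /=; rewrite !mul0r mulr0.
    by rewrite average_scale0.
  rewrite average_scale0//.
  have iterE m : iter m (average (scale_law r (scale_law 0 (centered_normal 1)))) phi = phi.
    by elim: m => //= m ->; exact: E0.
  by rewrite iterE.
have E1 : average (scale_law r (scale_law s (centered_normal 1))) =
    average (centered_normal (r * s)).
  apply/funext => psi; apply/funext => y; apply: eq_average => B mB.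
  have := centered_normal_scale (mulr_gt0 r0 s0) ltr01 mB; rewrite mulr1.
  move/esym; apply: etrans.
  rewrite /scale_law /distribution /pushforward/=; congr (centered_normal 1 _).
  by apply/seteqP; split => z /=; rewrite mulrA.
have E2 : average (scale_law s (centered_normal 1)) phi x =
    average (centered_normal s) phi x.
  apply: eq_average => B mB.
  by have := centered_normal_scale s0 ltr01 mB; rewrite mulr1 => /esym.
have rsE : Num.sqrt n.+1%:R * (r * s) = s.
  by rewrite mulrA divff ?mul1r// gt_eqF// sqrtr_gt0.
rewrite E1 E2; apply: etrans (normal_iter n x (mulr_gt0 r0 s0) bphi) _.
exact: (congr1 (fun u : R => average (centered_normal u) phi x) rsE).
Qed.

(** The limit is written as a scaled standard normal law instead of [centered_normal s], so as to
    include variance 0. *)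
Lemma clt_average Q (K : R) phi x : 0 <= K -> centered_square_integrable Q ->
  taylor2 (fun y => K * Num.min (y ^+ 2) (`|y| ^+ 3)) phi ->
  forall e : R, 0 < e -> \forall n \near \oo,
    `|iter n.+1 (average (scale_law (Num.sqrt n.+1%:R)^-1 Q)) phi x -
      average (scale_law (Num.sqrt (\int[Q]_y (y ^+ 2))) (centered_normal 1)) phi x| <= e.
Proof.
move=> K0 cQ tphi e e0; set s := Num.sqrt _.
have s0 : 0 <= s by exact: sqrtr_ge0.
have v0 : 0 <= \int[Q]_y (y ^+ 2) by apply: Rintegral_ge0 => y _; exact: sqr_ge0.
have iN2 := @std_normal_square_integrable R.
have iN1 := square_integrable_id iN2.
have is1 : (centered_normal 1).-integrable [set: R] (EFin \o (fun y : R => s * y)).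
  exact: integrableZl_EFin.
have is2 : (centered_normal 1).-integrable [set: R] (EFin \o (fun y : R => (s * y) ^+ 2)).
  have -> : (fun y : R => (s * y) ^+ 2) = (fun y => s ^+ 2 * y ^+ 2).
    by apply/funext => y; rewrite exprMn.
  exact: integrableZl_EFin.
have [j1 E1] := integral_scale_law (@measurable_id _ R setT) is1.
have msq : measurable_fun [set: R] (fun y : R => y ^+ 2) by exact: exprn_measurable.
have [j2 E2] := integral_scale_law msq is2.
have N2 : \int[centered_normal 1]_y (y ^+ 2) = 1 :> R.
  by rewrite /Rintegral std_normal_second_moment.
have cN : centered_square_integrable (scale_law s (centered_normal 1)).
  split; first exact: j2.
  by rewrite E1 RintegralZl// std_normal_mean mulr0.
have vE : \int[Q]_y (y ^+ 2) = \int[scale_law s (centered_normal 1)]_y (y ^+ 2).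
  have sE : \int[centered_normal 1]_y (s * y) ^+ 2 =
      s ^+ 2 * \int[centered_normal 1]_y (y ^+ 2).
    by rewrite -RintegralZl//; apply: eq_Rintegral => y _; rewrite exprMn.
  by rewrite E2 sE N2 mulr1 sqr_sqrtr.
have bphi : bounded_mfun phi by case: tphi.
near=> n; rewrite -(average_normal_iter n x s0 bphi).
by move: x; near: n; exact: (lindeberg K0 cQ cN vE tphi).
Unshelve. all: by end_near. Qed.

End limit_theorems.

(** * Weak law and central limit theorem for probabilities of balls *)

Section iid_limits.
Context d dO (T : measurableType d) (Omega : measurableType dO) (R : realType).
Variables (P : probability Omega R) (G : probability T R).
Variable X : nat -> {RV P >-> T}.
Hypothesis hX : iid_from G X.

Section scaled.
Variable h : T -> R.
Hypothesis mh : measurable_fun [set: T] h.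

Let hm : {mfun T >-> R} := HB.pack h (isMeasurableFun.Build _ _ _ _ _ mh).

Let Q : probability R R := distribution G hm.

Let mY (r : R) i : measurable_fun [set: Omega] (fun w => r * h (X i w)).
Proof. by apply: measurable_funM => //; exact: measurableT_comp. Qed.

Let Y (r : R) i : {RV P >-> R} :=
  HB.pack (fun w => r * h (X i w)) (isMeasurableFun.Build _ _ _ _ _ (mY r i)).

Let mpre (r : R) (B : set R) : measurable B ->
  measurable ((fun x => r * h x) @^-1` B).
Proof.
move=> mB; have mrh : measurable_fun [set: T] (fun x => r * h x).
  exact: measurable_funM.
by rewrite -[X in measurable X]setTI; exact: mrh.
Qed.

Let lawY r i (B : set R) : measurable B ->
  distribution P (Y r i) B = scale_law r Q B.
Proof. by move=> mB; exact: (hX.2 i _ (mpre r mB)). Qed.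

Let indepY r : mutually_independent (Y r).
Proof.
move=> J B uJ mB.
by have := hX.1 J (fun i => (fun x => r * h x) @^-1` B i) uJ (fun i => mpre r (mB i)).
Qed.

Lemma integral_image_law (k : R -> R) : measurable_fun [set: R] k ->
  G.-integrable [set: T] (EFin \o (fun x => k (h x))) ->
  Q.-integrable [set: R] (EFin \o k) /\ \int[Q]_y k y = \int[G]_x k (h x).
Proof.
move=> mk ik; split.
  by apply: integrable_pushforward => //; exact/measurable_EFinP.
by rewrite /Rintegral integral_distribution//; exact/measurable_EFinP.
Qed.

Lemma iid_expectation (r : R) n phi : bounded_mfun phi ->
  \int[P]_w phi (r * \sum_(i < n) h (X i w)) =
  iter n (average (scale_law r Q)) phi 0.
Proof.
move=> bphi; rewrite -(expectation_sum_iter (indepY r) (lawY r) n bphi).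
by apply: eq_Rintegral => w _; rewrite mulr_sumr.
Qed.

Lemma measurable_iid_sum (r : R) n :
  measurable_fun [set: Omega] (fun w => r * \sum_(i < n) h (X i w)).
Proof.
apply: measurable_funM => //; apply: measurable_sum => i.
exact: measurableT_comp.
Qed.

End scaled.

Lemma measurable_ball_preimage d' (W : measurableType d') (Z : W -> R) (a : R) :
  measurable_fun [set: W] Z -> measurable [set w | `|Z w| <= a].
Proof.
move=> mZ; have mnZ : measurable_fun [set: W] (fun w => `|Z w|).
  exact: measurableT_comp.
rewrite [X in measurable X](_ : _ = [set: W] `&` (fun w => `|Z w|) @^-1` `]-oo, a]%classic).
  by apply: mnZ.
by rewrite setTI; apply/seteqP; split => w /=; rewrite in_itv.
Qed.

(** phi lies between the indicators of the two balls. *)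
Lemma bump_expectation d' (W : measurableType d') (Pr : probability W R)
    (Z : W -> R) phi (a b : R) :
  measurable_fun [set: W] Z -> bounded_mfun phi -> (forall x, 0 <= phi x <= 1) ->
  (forall x, `|x| <= a -> phi x = 1) -> (forall x, b <= `|x| -> phi x = 0) ->
  fine (Pr [set w | `|Z w| <= a]) <= \int[Pr]_w phi (Z w)
  <= fine (Pr [set w | `|Z w| <= b]).
Proof.
move=> mZ [mphi [C phiC]] phi01 phi1 phi0.
have iphi : Pr.-integrable [set: W] (EFin \o (fun w => phi (Z w))).
  by apply: (bounded_integrable Pr (C := C)) => //; exact: measurableT_comp.
have ind c : Pr.-integrable [set: W] (EFin \o \1_[set w | `|Z w| <= c]) /\
    \int[Pr]_w (\1_[set w | `|Z w| <= c] w) = fine (Pr [set w | `|Z w| <= c]).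
  have mc := measurable_ball_preimage c mZ; split.
    apply: (bounded_integrable Pr (C := 1)); first exact: measurable_indic.
    by move=> w; rewrite indicE; case: (_ \in _); rewrite ?normr1 ?normr0.
  by rewrite /Rintegral integral_indic// setIT.
rewrite -(ind a).2 -(ind b).2; apply/andP; split; apply: le_Rintegral => //.
- exact: (ind a).1.
- move=> w _; rewrite indicE; have [wa|_] := boolP (w \in _).
    by rewrite phi1//; move: wa; rewrite inE.
  by have /andP[] := phi01 (Z w).
- exact: (ind b).1.
- move=> w _; rewrite indicE; have [_|wb] := boolP (w \in _).
    by have /andP[] := phi01 (Z w).
  rewrite phi0// ltW// ltNge; apply: contra wb.
  by rewrite inE.
Qed.

Lemma weak_law (h : T -> R) : measurable_fun [set: T] h ->
  G.-integrable [set: T] (EFin \o h) ->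
  forall e eta : R, 0 < e -> 0 < eta -> \forall n \near \oo,
  fine (P [set w | `|n%:R^-1 * (\sum_(i < n) h (X i w)) - \int[G]_x h x| <= e])
  >= 1 - eta.
Proof.
move=> mh ih e eta e0 eta0; set m := \int[G]_x h x.
have mk : measurable_fun [set: T] (fun x => h x - m) by exact: measurable_funB.
have im : G.-integrable [set: T] (EFin \o (fun=> m)).
  by apply: (bounded_integrable G (C := `|m|)).
have ik := integrableB_EFin ih im.
have [iQ EQ] := integral_image_law mk (@measurable_id _ R setT) ik.
(* With inner radius 0 the bump is 1 at the limit point and vanishes outside the ball of radius
   e. *)
have [phi [phi01 phi1 phi0 [K [K0 _ tphi]]]] := bump_exists (lexx 0) e0.
have bphi := tphi.1.
have Q0 : \int[G]_x (h x - m) = 0.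
  rewrite RintegralB// -/m Rintegral_cst//= probability_setT mulr1.
  exact: subrr.
rewrite Q0 in EQ.
apply: near_succ; have := lln_average 0 K0 iQ EQ tphi eta0; apply: filterS => n.
rewrite -(iid_expectation mk _ _ bphi) (phi1 0) ?normr0// => near1.
have := bump_expectation P (measurable_iid_sum mk n.+1%:R^-1 n.+1) bphi phi01 phi1 phi0.
move=> /andP[_]; rewrite add0r => le_pr.
have setE : [set w | `|n.+1%:R^-1 * (\sum_(i < n.+1) h (X i w)) - m| <= e] =
    [set w | `|n.+1%:R^-1 * (\sum_(i < n.+1) (h (X i w) - m))| <= e].
  apply/funext => w /=; congr (is_true (`|_| <= _)).
  have -> : \sum_(i < n.+1) (h (X i w) - m) = \sum_(i < n.+1) h (X i w) - n.+1%:R * m.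
    by rewrite sumrB sumr_const card_ord mulr_natl.
  by rewrite mulrBr mulrA mulVf ?mul1r// pnatr_eq0.
rewrite setE; apply: le_trans le_pr.
by move: near1; rewrite ler_norml => /andP[]; lra.
Qed.

(** The gap between [a] and [b] absorbs the width of the bump; in this form the statement also holds
    for variance 0, where the limit law has an atom at 0. *)
Lemma central_limit (h : T -> R) : measurable_fun [set: T] h ->
  G.-integrable [set: T] (EFin \o (fun x => h x ^+ 2)) -> \int[G]_x h x = 0 ->
  forall a b e : R, 0 <= a -> a < b -> 0 < e -> \forall n \near \oo,
  let Zn := fun w => (Num.sqrt n%:R)^-1 * \sum_(i < n) h (X i w) in
  let Z := fun z => Num.sqrt (\int[G]_x h x ^+ 2) * z in
  fine (P [set w | `|Zn w| <= a]) <=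
    fine (centered_normal 1 [set z | `|Z z| <= b]) + e /\
  fine (centered_normal 1 [set z | `|Z z| <= a]) <=
    fine (P [set w | `|Zn w| <= b]) + e.
Proof.
move=> mh ih2 h0 a b e a0 ab e0.
have ih : G.-integrable [set: T] (EFin \o h).
  have i1 : G.-integrable [set: T] (EFin \o cst (1 : R)).
    by apply: (bounded_integrable G (C := 1)) => // x; rewrite normr1.
  apply: le_integrable (integrableD_EFin i1 ih2) => //.
    exact/measurable_EFinP.
  move=> x _ /=; rewrite lee_fin [leRHS]ger0_norm ?addr_ge0 ?sqr_ge0//.
  by rewrite ler_norml; apply/andP; split; nra.
have msq : measurable_fun [set: R] (fun y : R => y ^+ 2) by exact: exprn_measurable.
have [iQ EQ] := integral_image_law mh (@measurable_id _ R setT) ih.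
have [iQ2 EQ2] := integral_image_law mh msq ih2.
have ba0 : 0 < b - a by rewrite subr_gt0.
have [phi [phi01 phi1 phi0 [K [K0 tphi _]]]] := bump_exists a0 ba0.
have bphi := tphi.1.
rewrite addrC subrK in phi0.
rewrite h0 in EQ.
apply: near_succ; have := clt_average 0 K0 (conj iQ2 EQ) tphi e0; apply: filterS => n.
rewrite EQ2 -(iid_expectation mh _ _ bphi) => near1.
pose Z (z : R) := Num.sqrt (\int[G]_x h x ^+ 2) * z.
have /andP[l1 l2] := bump_expectation P
  (measurable_iid_sum mh (Num.sqrt n.+1%:R)^-1 n.+1) bphi phi01 phi1 phi0.
have mZ : measurable_fun [set: R] Z by exact: measurable_funM.
have /andP[l3 l4] := bump_expectation (centered_normal 1) mZ bphi phi01 phi1 phi0.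
have iZ : (centered_normal 1).-integrable [set: R] (EFin \o (fun z => phi (0 + Z z))).
  have [mphi [C phiC]] := bphi.
  apply: (bounded_integrable (centered_normal 1) (C := C)) => //.
  by apply: measurableT_comp => //; exact: measurable_funD.
have [mt _] := bounded_mfun_translate 0 bphi.
move: near1; rewrite /average (integral_scale_law mt iZ).2.
have -> : \int[centered_normal 1]_y phi (0 + Num.sqrt (\int[G]_x h x ^+ 2) * y) =
    \int[centered_normal 1]_w phi (Z w).
  by apply: eq_Rintegral => z _; rewrite add0r.
by rewrite ler_norml => /andP[? ?]; split; lra.
Qed.

End iid_limits.

(** * Calculus of the model at the target parameter *)

Section pointwise_calculus.
Context {R : realType}.
Implicit Types (phi psi F : R -> R) (om : set R).

Lemma is_derive_open_eq om phi psi (t l : R) : open om -> om t ->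
  (forall s, om s -> phi s = psi s) -> is_derive t (1 : R) psi l ->
  is_derive t (1 : R) phi l.
Proof.
move=> oom omt E; apply: near_eq_is_derive.
by apply: filterS (open_nbhs_nbhs (conj oom omt)) => s /E.
Qed.

Lemma is_derive1E phi (t l : R) : is_derive t (1 : R) phi l -> derive1 phi t = l.
Proof. by move=> [_ E]; rewrite derive1E. Qed.

Lemma derivable_is_derive1 phi (t : R) : derivable phi t 1 ->
  is_derive t (1 : R) phi (derive1 phi t).
Proof. by move=> /derivableP; rewrite derive1E. Qed.

Lemma is_derive_derivable phi (t l : R) : is_derive t (1 : R) phi l ->
  derivable phi t 1.
Proof. by case. Qed.

Lemma derivable_open_eq om phi psi (t : R) : open om -> om t ->
  (forall s, om s -> phi s = psi s) -> derivable psi t 1 -> derivable phi t 1.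
Proof.
move=> oom omt E /derivable_is_derive1 d.
exact: is_derive_derivable (is_derive_open_eq oom omt E d).
Qed.

Section positive_family.
Variables (om : set R) (F : R -> R).
Hypothesis oom : open om.
Hypothesis F0 : forall t, om t -> 0 < F t.
Hypothesis dF : forall t, om t -> forall k, (k < 3)%N -> derivable (derive1n k F) t 1.

(** The score along the path F t = f t x at a fixed point x of the support. *)
Let u : R -> R := derive1 (fun t => ln (F t)).

Let F1 : R -> R := derive1n 1 F.
Let F2 : R -> R := derive1n 2 F.

Let dF0 t : om t -> is_derive t (1 : R) F (F1 t).
Proof. by move=> omt; apply: derivable_is_derive1; exact: (dF omt (ltn0Sn 2)). Qed.

Let dF1 t : om t -> is_derive t (1 : R) F1 (F2 t).
Proof. by move=> omt; apply: derivable_is_derive1; exact: (@dF t omt 1). Qed.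

Let dF2 t : om t -> derivable F2 t 1.
Proof. by move=> omt; exact: (@dF t omt 2). Qed.

Lemma is_derive_ln_pos t : om t -> is_derive t (1 : R) (fun s => ln (F s)) (u t).
Proof.
move=> omt; have dln := is_derive1_ln (F0 omt).
have := is_derive1_comp dln (dF0 omt) => d.
by rewrite /u (is_derive1E d).
Qed.

Let uE t : om t -> u t = F1 t / F t.
Proof.
move=> omt; have d := is_derive1_comp (is_derive1_ln (F0 omt)) (dF0 omt).
by rewrite /u (is_derive1E d) mulrC.
Qed.

Let du_quot t : om t ->
  is_derive t (1 : R) u (F2 t / F t - (F1 t / F t) ^+ 2).
Proof.
move=> omt; apply: (is_derive_open_eq oom omt uE).
have Fn0 : F t != 0 by rewrite gt_eqF// F0.
have dV := is_deriveV Fn0 (dF0 omt).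
apply: (is_derive_eq (is_deriveM (dF1 omt) dV)); rewrite /GRing.scale/=.
by field.
Qed.

Lemma is_derive_score t : om t -> is_derive t (1 : R) u (derive1 u t).
Proof. by move=> omt; rewrite (is_derive1E (du_quot omt)); exact: du_quot. Qed.

(** u' = F''/F - (F'/F)^2 on the whole open set, so the third derivative of F enters here. *)
Lemma derivable_derive1_score t : om t -> derivable (derive1 u) t 1.
Proof.
move=> omt; apply: (derivable_open_eq oom omt (psi := fun s => F2 s / F s - (F1 s / F s) * (F1 s / F s))).
  by move=> s oms; rewrite (is_derive1E (du_quot oms)) expr2.
have Fn0 : F t != 0 by rewrite gt_eqF// F0.
have dF2' := derivable_is_derive1 (dF2 omt).
have dV := is_deriveV Fn0 (dF0 omt).
have dq := is_deriveM (dF1 omt) dV.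
exact: is_derive_derivable (is_deriveB (is_deriveM dF2' dV) (is_deriveM dq dq)).
Qed.

Section power.
Variable p : R.

Lemma is_derive_power t : om t ->
  is_derive t (1 : R) (fun s => F s `^ p) (p * u t * F t `^ p).
Proof.
move=> omt.
have E s : om s -> F s `^ p = expR (p * ln (F s)).
  by move=> oms; rewrite /powR gt_eqF// F0.
apply: (is_derive_open_eq oom omt E); rewrite E//.
have dl : is_derive t (1 : R) (fun s => ln (F s)) (u t : R) := is_derive_ln_pos omt.
have dpl : is_derive t (1 : R) (fun s => p * ln (F s)) (p * u t).
  exact: (is_deriveZ p dl).
have de := @is_derive1_comp _ expR (fun s => p * ln (F s)) t _ _ (is_derive_expR _) dpl.
by apply: (is_derive_eq de); rewrite mulrC.
Qed.

Lemma is_derive_score_power t : om t ->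
  is_derive t (1 : R) (fun s => u s * F s `^ p)
    ((derive1 u t + p * u t ^+ 2) * F t `^ p).
Proof.
move=> omt; have d1 := is_derive_score omt; have d2 := is_derive_power omt.
apply: (is_derive_eq (is_deriveM d1 d2)); rewrite /GRing.scale/=; ring.
Qed.

Lemma derivable_info_power t : om t ->
  derivable (fun s => (derive1 u s + p * (u s * u s)) * F s `^ p) t 1.
Proof.
move=> omt; have d1 := is_derive_score omt; have d2 := is_derive_power omt.
have d3 := derivable_is_derive1 (derivable_derive1_score omt).
apply: is_derive_derivable (is_deriveM (is_deriveD d3 (is_deriveZ p (is_deriveM d1 d1))) d2).
Qed.

Lemma derive1n1_power t : om t ->
  derive1n 1 (fun s => F s `^ p) t = p * (u t * F t `^ p).
Proof. by move=> omt; rewrite derive1n1 (is_derive1E (is_derive_power omt)) mulrA. Qed.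

Lemma derive1n2_power t : om t ->
  derive1n 2 (fun s => F s `^ p) t =
  p * ((derive1 u t + p * u t ^+ 2) * F t `^ p).
Proof.
move=> omt; rewrite derive1nS; apply: is_derive1E.
apply: (is_derive_open_eq oom omt derive1n1_power).
exact: (is_deriveZ p (is_derive_score_power omt)).
Qed.

End power.

End positive_family.

Lemma mean_value_le phi dphi (a b C : R) :
  (forall s, Num.min a b <= s <= Num.max a b -> is_derive s (1 : R) phi (dphi s)) ->
  (forall s, Num.min a b <= s <= Num.max a b -> `|dphi s| <= C) ->
  `|phi b - phi a| <= C * `|b - a|.
Proof.
wlog ab : a b / a <= b.
  move=> W; have /orP[ab|ba] := le_total a b; first exact: W.
  rewrite minC maxC => d c; rewrite distrC (distrC b a).
  exact: (W _ _ ba).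
rewrite min_l// max_r// => d c.
have cphi : {within `[a, b], continuous phi}.
  apply: derivable_within_continuous => x; rewrite in_itv/= => xab.
  exact: is_derive_derivable (d _ xab).
have doo x : x \in `]a, b[%R -> is_derive x (1 : R) phi (dphi x).
  by rewrite in_itv/= => /andP[ax xb]; apply: d; rewrite !ltW.
have [x xab ->] := MVT_segment ab doo cphi.
by rewrite normrM ler_wpM2r// c//; move: xab; rewrite in_itv.
Qed.

(** The bound on D3 is integrated by repeated mean value inequalities, without sharp constants. It
    will be applied observation by observation, with M = M(x). *)
Lemma taylor_bounds (D0 D1 D2 D3 : R -> R) (t0 t r M : R) :
  (forall s, `|s - t0| < r -> [/\ is_derive s (1 : R) D0 (D1 s),
     is_derive s (1 : R) D1 (D2 s), is_derive s (1 : R) D2 (D3 s) & `|D3 s| <= M]) ->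
  `|t - t0| < r ->
  `|D1 t - D1 t0 - D2 t0 * (t - t0)| <= M * (t - t0) ^+ 2 /\
  `|D0 t - D0 t0 - D1 t0 * (t - t0)| <= (`|D2 t0| + M * `|t - t0|) * (t - t0) ^+ 2.
Proof.
move=> dD tr.
have seg s : Num.min t0 t <= s <= Num.max t0 t -> `|s - t0| <= `|t - t0|.
  by case: (leP t0 t) => h /andP[? ?]; [rewrite !ger0_norm; lra|rewrite !ler0_norm; lra].
have segr s : Num.min t0 t <= s <= Num.max t0 t -> `|s - t0| < r.
  by move=> /seg /le_lt_trans; exact.
have M0 : 0 <= M by apply: le_trans (normr_ge0 (D3 t)) _; have [] := dD _ tr.
have seg_le s : Num.min t0 t <= s <= Num.max t0 t ->
    forall s', Num.min t0 s <= s' <= Num.max t0 s -> `|s' - t0| < r.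
  move=> hs s' hs'; apply: le_lt_trans (segr _ hs).
  by move: hs'; case: (leP t0 s) => h /andP[? ?]; [rewrite !ger0_norm; lra|rewrite !ler0_norm; lra].
have sq : `|t - t0| * `|t - t0| = (t - t0) ^+ 2 by rewrite -expr2 real_normK ?num_real.
have D2_le s : Num.min t0 t <= s <= Num.max t0 t -> `|D2 s - D2 t0| <= M * `|t - t0|.
  move=> hs; apply: le_trans (mean_value_le (dphi := D3) (C := M) _ _) _.
  - by move=> s' /(seg_le _ hs) /dD[].
  - by move=> s' /(seg_le _ hs) /dD[].
  - by rewrite ler_wpM2l// seg.
have dlin (c s : R) : is_derive s (1 : R) (fun s => c * (s - t0)) c.
  by apply: is_derive_eq; rewrite /GRing.scale/=; ring.
have D1_le s : Num.min t0 t <= s <= Num.max t0 t ->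
    `|D1 s - D1 t0 - D2 t0 * (s - t0)| <= M * `|t - t0| * `|s - t0|.
  move=> hs; have := @mean_value_le (fun s => D1 s - D2 t0 * (s - t0))
    (fun s => D2 s - D2 t0) t0 s (M * `|t - t0|) _ _.
  rewrite subrr mulr0 subr0 addrAC; apply.
  - by move=> s' /(seg_le _ hs) /dD[_ d _ _]; exact: (is_deriveB d (dlin _ _)).
  - move=> s' hs'; apply: D2_le; move: hs hs'.
    by case: (leP t0 t) => h; case: (leP t0 s) => h' /andP[? ?] /andP[? ?]; lra.
have ht : Num.min t0 t <= t <= Num.max t0 t by rewrite ge_min le_max !lexx !orbT.
split; first by rewrite -sq mulrA; exact: D1_le.
have := @mean_value_le (fun s => D0 s - D1 t0 * (s - t0))
    (fun s => D1 s - D1 t0) t0 t ((`|D2 t0| + M * `|t - t0|) * `|t - t0|) _ _.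
rewrite subrr mulr0 subr0 addrAC -sq mulrA; apply.
- by move=> s /segr /dD[d _ _ _]; exact: (is_deriveB d (dlin _ _)).
- move=> s hs; have := D1_le _ hs => D1s.
  rewrite -(subrK (D2 t0 * (s - t0)) (D1 s - D1 t0)).
  apply: le_trans (ler_normD _ _) _; rewrite normrM mulrDl addrC lerD//.
    by rewrite ler_wpM2l// seg.
  by apply: le_trans D1s _; rewrite ler_wpM2l ?mulr_ge0// seg.
Qed.

Lemma peano1 phi (t0 l : R) : is_derive t0 (1 : R) phi l -> forall e : R, 0 < e ->
  exists2 r : R, 0 < r & forall t, `|t - t0| < r ->
    `|phi t - phi t0 - l * (t - t0)| <= e * `|t - t0|.
Proof.
move=> dphi e e0; have [/cvg_ex[/= l' dl'] lE] := dphi.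
have ll' : l' = l by rewrite -lE; apply/esym/cvg_lim.
rewrite ll' in dl'.
move/cvgrPdist_le : dl' => /(_ e e0) [r /= r0 hr]; exists r => // t tr.
have [->|tt0] := eqVneq t t0; first by rewrite !subrr mulr0 subr0 normr0 mulr0.
have h0 : t - t0 != 0 by rewrite subr_eq0.
have := hr (t - t0); rewrite /ball_/= sub0r normrN => /(_ tr h0).
rewrite /GRing.scale/= mulr1 subrK => H.
have -> : phi t - phi t0 - l * (t - t0) =
    - ((l - (t - t0)^-1 * (phi t - phi t0)) * (t - t0)).
  by field.
by rewrite normrN normrM ler_wpM2r.
Qed.

(** The second derivative is given at t0 alone. Subtracting the quadratic leaves a function whose
    derivative is o(|s - t0|) by [peano1], and the mean value inequality integrates this. *)
Lemma peano2 phi dphi (t0 l r : R) : 0 < r ->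
  (forall s, `|s - t0| < r -> is_derive s (1 : R) phi (dphi s)) ->
  dphi t0 = 0 -> is_derive t0 (1 : R) dphi l -> forall e : R, 0 < e ->
  exists2 r' : R, 0 < r' & forall t, `|t - t0| < r' ->
    `|phi t - phi t0 - l / 2 * (t - t0) ^+ 2| <= e * (t - t0) ^+ 2.
Proof.
move=> r0 d1 dphi0 d2 e e0; have [r1 r10 h1] := peano1 d2 e0.
exists (Num.min r r1); first by rewrite lt_min r0.
move=> t; rewrite lt_min => /andP[tr tr1].
have seg s : Num.min t0 t <= s <= Num.max t0 t -> `|s - t0| <= `|t - t0|.
  by case: (leP t0 t) => h /andP[? ?]; [rewrite !ger0_norm; lra|rewrite !ler0_norm; lra].
have sq : `|t - t0| * `|t - t0| = (t - t0) ^+ 2 by rewrite -expr2 real_normK ?num_real.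
have dquad (s : R) : is_derive s (1 : R) (fun s => l / 2 * (s - t0) ^+ 2) (l * (s - t0)).
  by apply: is_derive_eq; rewrite /GRing.scale/=; field.
have -> : phi t - phi t0 - l / 2 * (t - t0) ^+ 2 =
    (phi t - l / 2 * (t - t0) ^+ 2) - (phi t0 - l / 2 * (t0 - t0) ^+ 2) by ring.
have -> : e * (t - t0) ^+ 2 = e * `|t - t0| * `|t - t0| by rewrite -mulrA sq.
apply: (@mean_value_le (fun s => phi s - l / 2 * (s - t0) ^+ 2)
    (fun s => dphi s - l * (s - t0)) t0 t (e * `|t - t0|)).
- by move=> s hs; exact: (is_deriveB (d1 _ (le_lt_trans (seg _ hs) tr)) (dquad _)).
- move=> s hs; have := h1 s (le_lt_trans (seg _ hs) tr1); rewrite dphi0 subr0.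
  by move/le_trans; apply; rewrite ler_wpM2l// ?seg// ltW.
Qed.

End pointwise_calculus.

(** * Derivatives of powers of the density and of the divergence integrand *)

Section model.
Context d (T : measurableType d) (R : realType).
Variables (mu : {measure set T -> \bar R}) (f : R -> T -> R) (theta0 : R).
Variables (Theta omega : set R).
Hypothesis hf : forall theta, Theta theta -> is_density mu (f theta).
Hypotheses (omega_open : open omega) (omega_theta0 : omega theta0).
Hypothesis omega_sub : omega `<=` Theta.
Hypothesis hsupp : forall theta, Theta theta ->
  [set x | 0 < f theta x] = model_support f theta0.

Definition smooth_at (x : T) : Prop :=
  model_support f theta0 x -> forall theta, omega theta ->
  forall k, (k < 3)%N -> derivable (derive1n k (f ^~ x)) theta 1.

Lemma density_pos x t : model_support f theta0 x -> omega t -> 0 < f t x.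
Proof. by move=> Sx omt; have := hsupp (omega_sub omt) => /seteqP[_ /(_ x Sx)]. Qed.

Lemma density_eq0 x t : ~ model_support f theta0 x -> omega t -> f t x = 0.
Proof.
move=> Sx /omega_sub Tt; have [_ f0 _] := hf Tt.
apply/eqP; rewrite eq_le f0 andbT leNgt; apply/negP => fx.
by apply: Sx; rewrite -(hsupp Tt).
Qed.

(** Off the support the path is 0 throughout omega; p != 0 excludes the convention that 0 to the
    power 0 is 1. *)
Lemma derive1n_power_off p x j t : p != 0 -> ~ model_support f theta0 x ->
  omega t -> derive1n j (fun s => f s x `^ p) t = 0.
Proof.
move=> p0 Sx; elim: j t => [|j IH] t omt; first by rewrite derive1n0 density_eq0// powR0.
rewrite derive1nS; apply: is_derive1E.
exact: (is_derive_open_eq omega_open omt IH (is_derive_cst 0 t (1 : R))).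
Qed.

Lemma power_derive1 p x t : smooth_at x -> p != 0 -> omega t ->
  derive1n 1 (fun s => f s x `^ p) t = p * (score f t x * f t x `^ p).
Proof.
move=> sx p0 omt; have [Sx|Sx] := pselect (model_support f theta0 x).
  exact: (@derive1n1_power _ omega (f ^~ x) omega_open (fun t => @density_pos x t Sx) (sx Sx) p t omt).
by rewrite derive1n_power_off// density_eq0// powR0// !mulr0.
Qed.

Lemma power_derive2 p x t : smooth_at x -> p != 0 -> omega t ->
  derive1n 2 (fun s => f s x `^ p) t =
  p * ((p * score f t x ^+ 2 - info f t x) * f t x `^ p).
Proof.
move=> sx p0 omt; have [Sx|Sx] := pselect (model_support f theta0 x).
  rewrite (@derive1n2_power _ omega (f ^~ x) omega_open (fun t => @density_pos x t Sx) (sx Sx) p t omt).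
  by rewrite /info opprK addrC.
by rewrite derive1n_power_off// density_eq0// powR0// !mulr0.
Qed.

Section cross.
Variables gam lam : R.
Hypothesis gam0 : 0 <= gam.
Let A := sdivA gam lam.
Let B := sdivB gam lam.
Let p := 1 + gam.

Let pn0 : p != 0. Proof. by rewrite gt_eqF// ltr_wpDr. Qed.

Let AB : A + B = p. Proof. by rewrite /A /B /p /sdivA /sdivB; ring. Qed.

Let cross t x := sdiv_cross gam lam (f t) (f theta0) x.

Let crossE x t : model_support f theta0 x -> omega t ->
  cross t x = if A == 0 then f theta0 x `^ p * (ln (f theta0 x) - ln (f t x))
              else if B == 0 then f t x `^ p * (ln (f t x) - ln (f theta0 x))
              else f theta0 x `^ B * f t x `^ A.
Proof.
move=> Sx omt; have ft := density_pos Sx omt; have ft0 := density_pos Sx omega_theta0.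
rewrite /cross /sdiv_cross -/A -/B; case: (A == 0); first by rewrite ln_div ?posrE.
by case: (B == 0); rewrite ?ln_div ?posrE.
Qed.

Let cross_off x t : ~ model_support f theta0 x -> omega t -> cross t x = 0.
Proof.
move=> Sx omt; rewrite /cross /sdiv_cross !density_eq0//.
case: ifP => [_|/negbT A0]; first by rewrite powR0// mul0r.
by case: ifP => _; [rewrite powR0// mul0r|rewrite (powR0 A0) mulr0].
Qed.

Let derive1n_cross_off x j t : ~ model_support f theta0 x -> omega t ->
  derive1n j (cross ^~ x) t = 0.
Proof.
move=> Sx; elim: j t => [|j IH] t omt; first by rewrite derive1n0 cross_off.
rewrite derive1nS; apply: is_derive1E.
exact: (is_derive_open_eq omega_open omt IH (is_derive_cst 0 t (1 : R))).
Qed.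

(* The coefficients with which the integrals of the cross term and of
   f_theta^(1+gam) enter S(f_theta, f_theta0). *)
Definition sdiv_coef_cross : R :=
  if A == 0 then 1 else if B == 0 then 1 else - (p / (A * B)).

Definition sdiv_coef_power : R :=
  if A == 0 then p^-1 else if B == 0 then - p^-1 else B^-1.

(** At theta0 the logarithm of the ratio is 0 and f^B f^A = f^(1+gam), so the derivatives reduce to
    u, i and f^(1+gam). *)
Let cross_derive12 x : smooth_at x -> model_support f theta0 x ->
  let u := score f theta0 x in let i := info f theta0 x in
  let fp := f theta0 x `^ p in
  derive1n 1 (cross ^~ x) theta0 =
    (if A == 0 then - u else if B == 0 then u else A * u) * fp /\
  derive1n 2 (cross ^~ x) theta0 =
    (if A == 0 then i else if B == 0 then 2 * p * u ^+ 2 - i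
     else A * (A * u ^+ 2 - i)) * fp.
Proof.
move=> sx Sx u i fp.
have fpos t (omt : omega t) : 0 < (f ^~ x) t := density_pos Sx omt.
have dF := sx Sx.
have dln t (omt : omega t) : is_derive t (1 : R) (fun s => ln (f s x)) (score f t x : R)
  := is_derive_ln_pos fpos dF omt.
have dsc t (omt : omega t) : is_derive t (1 : R) (fun s => score f s x) (- info f t x : R).
  by rewrite /info opprK; exact: is_derive_score omega_open fpos dF t omt.
have dpow q t (omt : omega t) : is_derive t (1 : R) (fun s => f s x `^ q)
    (q * score f t x * f t x `^ q : R) := is_derive_power omega_open fpos dF q omt.
have dscpow q t (omt : omega t) : is_derive t (1 : R) (fun s => score f s x * f s x `^ q)
    ((- info f t x + q * score f t x ^+ 2) * f t x `^ q : R).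
  by rewrite /info opprK; exact: is_derive_score_power omega_open fpos dF q t omt.
have om0 := omega_theta0.
(* The second derivative at theta0 requires the first one on a neighbourhood, hence an explicit [c1]
   on omega. *)
suff [c1 [E1 [<- d2]]] : exists c1 : R -> R,
    (forall t, omega t -> is_derive t (1 : R) (cross ^~ x) (c1 t)) /\
    (c1 theta0 = (if A == 0 then - u else if B == 0 then u else A * u) * fp /\
     is_derive theta0 (1 : R) c1 ((if A == 0 then i else if B == 0 then
      2 * p * u ^+ 2 - i else A * (A * u ^+ 2 - i)) * fp)).
  have E t : omega t -> derive1n 1 (cross ^~ x) t = c1 t.
    by move=> omt; exact: is_derive1E (E1 _ omt).
  split; first exact: E.
  rewrite derive1nS; apply: is_derive1E.
  exact: is_derive_open_eq omega_open om0 E d2.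
have [A0|A0] := eqVneq A 0; last have [B0|B0] := eqVneq B 0.
- exists (fun t => f theta0 x `^ p * - score f t x); split; [|split].
  + move=> t omt; apply: (is_derive_open_eq omega_open omt
      (psi := fun t => f theta0 x `^ p * (ln (f theta0 x) - ln (f t x)))).
      by move=> s oms; rewrite crossE// A0 eqxx.
    have dq := is_deriveB (is_derive_cst (ln (f theta0 x)) t (1 : R)) (dln t omt).
    by apply: (is_derive_eq (is_deriveZ (f theta0 x `^ p) dq)); rewrite sub0r.
  + by rewrite mulrC.
  + have dq := is_deriveZ (f theta0 x `^ p) (is_deriveN (dsc _ om0)).
    by apply: (is_derive_eq dq); rewrite opprK /GRing.scale/= mulrC.
- have dlnB t (omt : omega t) : is_derive t (1 : R)
      (fun s => ln (f s x) - ln (f theta0 x)) (score f t x : R).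
    have dq := is_deriveB (dln t omt) (is_derive_cst (ln (f theta0 x)) t (1 : R)).
    by apply: (is_derive_eq dq); rewrite subr0.
  exists (fun t => (p * (score f t x * f t x `^ p)) * (ln (f t x) - ln (f theta0 x))
           + score f t x * f t x `^ p); split; [|split].
  + move=> t omt; apply: (is_derive_open_eq omega_open omt
      (psi := fun t => f t x `^ p * (ln (f t x) - ln (f theta0 x)))).
      by move=> s oms; rewrite crossE// (negbTE A0) B0 eqxx.
    have dq := dlnB t omt.
    by apply: (is_derive_eq (is_deriveM (dpow p t omt) dq)); rewrite /GRing.scale/=; ring.
  + by rewrite subrr mulr0 add0r.
  + have dz : is_derive theta0 (1 : R) (fun s => p * (score f s x * f s x `^ p))
        (p * ((- info f theta0 x + p * score f theta0 x ^+ 2) * f theta0 x `^ p)).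
      exact: (is_deriveZ p (dscpow p _ om0)).
    have dq' := is_deriveM dz (dlnB _ om0).
    apply: (is_derive_eq (is_deriveD dq' (dscpow p _ om0))).
    by rewrite /GRing.scale/= -/u -/i -/fp; ring.
- have fpE : f theta0 x `^ B * f theta0 x `^ A = fp.
    rewrite /fp -AB (addrC A B) (@powRD _ (f theta0 x) B A)//.
    by rewrite (gt_eqF (density_pos Sx om0)) implybT.
  exists (fun t => f theta0 x `^ B * (A * (score f t x * f t x `^ A))); split; [|split].
  + move=> t omt; apply: (is_derive_open_eq omega_open omt
      (psi := fun t => f theta0 x `^ B * f t x `^ A)).
      by move=> s oms; rewrite crossE// (negbTE A0) (negbTE B0).
    apply: (is_derive_eq (is_deriveZ (f theta0 x `^ B) (dpow A t omt))).
    by rewrite /GRing.scale/= !mulrA.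
  + by rewrite -fpE -/u; ring.
  + apply: (is_derive_eq (is_deriveZ (f theta0 x `^ B) (is_deriveZ A (dscpow A _ om0)))).
    by rewrite /GRing.scale/= -fpE -/u -/i; ring.
Qed.

(** Already before integration the first-order terms cancel and i drops out at second order, whether
    or not A or B vanishes. This is why the limit does not depend on lambda. *)
Lemma sdiv_cross_derive x : smooth_at x ->
  sdiv_coef_cross * derive1n 1 (cross ^~ x) theta0 +
  sdiv_coef_power * derive1n 1 (fun s => f s x `^ p) theta0 = 0 /\
  sdiv_coef_cross * derive1n 2 (cross ^~ x) theta0 +
  sdiv_coef_power * derive1n 2 (fun s => f s x `^ p) theta0 =
  p * (score f theta0 x ^+ 2 * f theta0 x `^ p).
Proof.
move=> sx; have om0 := omega_theta0.
have [Sx|Sx] := pselect (model_support f theta0 x); last first.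
  by rewrite !derive1n_cross_off// !derive1n_power_off// density_eq0// powR0// !mulr0 addr0.
have [-> ->] := cross_derive12 sx Sx.
rewrite power_derive1// power_derive2// /sdiv_coef_cross /sdiv_coef_power.
have [A0|A0] := eqVneq A 0; last have [B0|B0] := eqVneq B 0.
- by split; field.
- by split; field.
- by rewrite -AB; split; field; rewrite ?A0 ?B0.
Qed.

End cross.

End model.

(** Without completeness of mu, measurability does not pass along almost-everywhere equality; hence
    the hypothesis on [h2]. *)
Lemma ae_eq_Rintegral d (T : measurableType d) (R : realType)
    (mu : {measure set T -> \bar R}) (h1 h2 : T -> R) :
  measurable_fun [set: T] h2 -> {ae mu, forall x, h1 x = h2 x} ->
  mu.-integrable [set: T] (EFin \o h1) ->
  mu.-integrable [set: T] (EFin \o h2) /\ \int[mu]_x h1 x = \int[mu]_x h2 x.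
Proof.
move=> mh2 h12 ih1; have mE1 := measurable_int _ ih1.
have mE2 : measurable_fun [set: T] (EFin \o h2) by exact/measurable_EFinP.
split; last first.
  by congr fine; apply: ae_eq_integral => //; apply: filterS h12 => x /= + _ => ->.
apply/integrableP; split=> //.
have <- : (\int[mu]_x `|(h1 x)%:E| = \int[mu]_x `|(h2 x)%:E|)%E.
  apply: ae_eq_integral => //; [exact: measurableT_comp|exact: measurableT_comp|].
  by apply: filterS h12 => x /= + _ => ->.
by case/integrableP : ih1.
Qed.

(** * Measurable versions of the score and information terms *)

Section versions.
Context d (T : measurableType d) (R : realType).
Variables (mu : {sigma_finite_measure set T -> \bar R}).
Variables (f : R -> T -> R) (theta0 : R) (Theta omega : set R) (beta : R).
Hypothesis hf : forall theta, Theta theta -> is_density mu (f theta).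
Hypotheses (omega_open : open omega) (omega_theta0 : omega theta0).
Hypothesis omega_sub : omega `<=` Theta.
Hypothesis hsupp : forall theta, Theta theta ->
  [set x | 0 < f theta x] = model_support f theta0.
Hypothesis hsmooth : {ae mu, forall x, smooth_at f theta0 omega x}.
Hypothesis beta0 : 0 <= beta.
Let p := 1 + beta.
Hypothesis hdiff :
  diff_under_integral mu 3 omega (fun theta x => f theta x `^ (1 + beta)).
Hypothesis hJ : mu.-integrable [set: T]
  (fun x => (score f theta0 x ^+ 2 * f theta0 x `^ (1 + beta))%:E).

Let F0 := f theta0.

Let pn0 : p != 0. Proof. by rewrite gt_eqF// ltr_wpDr. Qed.

Lemma density_ge0 t x : omega t -> 0 <= f t x.
Proof. by move=> /omega_sub /hf[]. Qed.

Lemma measurable_density t : omega t -> measurable_fun [set: T] (f t).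
Proof. by move=> /omega_sub /hf[]. Qed.

Let F0_ge0 x : 0 <= F0 x. Proof. exact: density_ge0. Qed.

Let mF0 : measurable_fun [set: T] F0. Proof. exact: measurable_density. Qed.

Lemma score_off x t : ~ model_support f theta0 x -> omega t -> score f t x = 0.
Proof.
move=> Sx omt; apply: is_derive1E.
have E s : omega s -> ln (f s x) = 0.
  by move=> oms; rewrite (density_eq0 hf omega_sub hsupp Sx oms) ln0.
exact: (is_derive_open_eq omega_open omt E (is_derive_cst 0 t (1 : R))).
Qed.

Lemma info_off x t : ~ model_support f theta0 x -> omega t -> info f t x = 0.
Proof.
move=> Sx omt; rewrite /info; apply/eqP; rewrite oppr_eq0; apply/eqP/is_derive1E.
exact: (is_derive_open_eq omega_open omt (fun s => @score_off x s Sx)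
  (is_derive_cst 0 t (1 : R))).
Qed.

Definition power_deriv k (x : T) : R :=
  derive1n k (fun s => f s x `^ (1 + beta)) theta0.

(* Measurable versions of u f^beta and (i - beta u^2) f^beta at theta0: the
   score itself may fail to be measurable on the null set where f is not smooth. *)
Definition score_power_version (x : T) : R :=
  power_deriv 1 x / ((1 + beta) * f theta0 x).

Definition info_power_version (x : T) : R :=
  (score f theta0 x ^+ 2 * f theta0 x `^ (1 + beta) - power_deriv 2 x / (1 + beta))
  / f theta0 x.

Let v1 := score_power_version.
Let v2 := info_power_version.

Let F0p x : model_support f theta0 x -> F0 x `^ p = F0 x `^ beta * F0 x.
Proof.
move=> Sx; rewrite /p (@powRD _ (F0 x) 1 beta) ?powRr1// 1?mulrC//.
by rewrite (gt_eqF (Sx : 0 < F0 x)) implybT.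
Qed.

Lemma score_power_versionE x : smooth_at f theta0 omega x ->
  v1 x = score f theta0 x * f theta0 x `^ beta.
Proof.
move=> sx; rewrite /v1 /score_power_version /power_deriv -/p -/F0.
have [Sx|Sx] := pselect (model_support f theta0 x).
  have Fn0 : F0 x != 0 by rewrite gt_eqF.
  rewrite (power_derive1 hf omega_open omega_sub hsupp sx pn0 omega_theta0).
  by rewrite -/F0 F0p//; field; apply/andP.
by rewrite /F0 score_off// (density_eq0 hf omega_sub hsupp Sx omega_theta0) mulr0 invr0 mulr0 mul0r.
Qed.

Lemma info_power_versionE x : smooth_at f theta0 omega x ->
  v2 x = (info f theta0 x - beta * score f theta0 x ^+ 2) * f theta0 x `^ beta.
Proof.
move=> sx; rewrite /v2 /info_power_version /power_deriv -/p -/F0.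
have [Sx|Sx] := pselect (model_support f theta0 x).
  have Fn0 : F0 x != 0 by rewrite gt_eqF.
  rewrite (power_derive2 hf omega_open omega_sub hsupp sx pn0 omega_theta0).
  rewrite -/F0 F0p//; rewrite /p; field.
  by rewrite -/p; apply/andP.
rewrite /F0 score_off// info_off//.
by rewrite (density_eq0 hf omega_sub hsupp Sx omega_theta0) invr0 mulr0 expr0n/= mulr0 subrr mul0r.
Qed.

(** Exhibits v2 f as a difference of two functions integrable by hypothesis. Off the support both
    sides are 0. *)
Lemma info_power_version_density x : smooth_at f theta0 omega x ->
  v2 x * f theta0 x = score f theta0 x ^+ 2 * f theta0 x `^ (1 + beta)
                      - power_deriv 2 x / (1 + beta).
Proof.
move=> sx; rewrite /v2 /info_power_version -/p.
have [Sx|Sx] := pselect (model_support f theta0 x).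
  by rewrite divfK// gt_eqF.
rewrite /power_deriv (power_derive2 hf omega_open omega_sub hsupp sx pn0 omega_theta0).
rewrite (density_eq0 hf omega_sub hsupp Sx omega_theta0) powR0//.
by rewrite !mulr0 mul0r subrr.
Qed.

Let ik j : (j <= 3)%N -> mu.-integrable [set: T] (EFin \o power_deriv j).
Proof. by move=> j3; have := hdiff.1 theta0 j omega_theta0 j3. Qed.

Let mk j : (j <= 3)%N -> measurable_fun [set: T] (power_deriv j).
Proof. by move=> j3; apply/measurable_EFinP; exact: measurable_int (ik j3). Qed.

Let mpow q : measurable_fun [set: T] (fun x => F0 x `^ q).
Proof. exact: (measurableT_comp (measurable_powR q) mF0). Qed.

Let mVF0 : measurable_fun [set: T] (fun x => (F0 x)^-1).
Proof.
have -> : (fun x => (F0 x)^-1) = (fun x => F0 x `^ (-1)).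
  by apply/funext => x; rewrite powR_inv1.
exact: mpow.
Qed.

Lemma measurable_score_power_version : measurable_fun [set: T] v1.
Proof.
have -> : v1 = (fun x => power_deriv 1 x * (p^-1 * (F0 x)^-1)).
  by apply/funext => x; rewrite /v1 /score_power_version invfM.
apply: measurable_funM; first exact: mk.
exact: measurable_funM.
Qed.

Let mJ : measurable_fun [set: T]
  (fun x => score f theta0 x ^+ 2 * f theta0 x `^ (1 + beta)).
Proof. by apply/measurable_EFinP; exact: measurable_int hJ. Qed.

Lemma measurable_info_power_version : measurable_fun [set: T] v2.
Proof.
apply: measurable_funM => //; apply: measurable_funB => //.
by apply: measurable_funM => //; exact: mk.
Qed.

(** The score itself may not be measurable, but u^2 f^(1+beta) is; the exponent is changed by
    multiplying with powers of f, and where f = 0 both sides vanish. *)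
Lemma measurable_score_sqr_power gam : 0 <= gam -> measurable_fun [set: T]
  (fun x => score f theta0 x ^+ 2 * f theta0 x `^ (1 + gam)).
Proof.
move=> gam0.
have -> : (fun x => score f theta0 x ^+ 2 * f theta0 x `^ (1 + gam)) =
  (fun x => (score f theta0 x ^+ 2 * f theta0 x `^ (1 + beta)) *
    (f theta0 x `^ (1 + gam) * f theta0 x `^ (- (1 + beta)))).
  apply/funext => x; have := F0_ge0 x; rewrite le_eqVlt => /orP[/eqP F00|Fpos].
    rewrite -/F0 -F00 (powR0 pn0) powR0; first by rewrite mulr0 mul0r.
    by rewrite gt_eqF// ltr_wpDr.
  rewrite powRN -/F0 -/p.
  have Fpn0 : F0 x `^ p != 0 by rewrite gt_eqF// powR_gt0.
  by field.
apply: measurable_funM => //; apply: measurable_funM.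
- exact: mpow.
- exact: mpow.
Qed.

Section true_density.
Variables (g : T -> R) (G : probability T R).
Hypothesis mg : measurable_fun [set: T] g.
Hypothesis g0 : forall x, 0 <= g x.
Hypothesis hG : forall B : set T, measurable B -> G B = (\int[mu]_(x in B) (g x)%:E)%E.
Hypothesis hconst : constants_well_defined mu f beta g theta0.

(** Split v2 g = v2 (g - f) + v2 f. The first part integrates to the second integral of J, the other
    to [J_model] minus the integral of [power_deriv 2] over 1 + beta, which the added x-free term
    compensates. *)
Lemma info_power_version_mean :
  G.-integrable [set: T] (EFin \o v2) /\
  \int[mu]_x power_deriv 2 x + p * \int[G]_x v2 x = p * J_true mu f beta g theta0.
Proof.
have mv2 := measurable_info_power_version.
have [iJ _ _ _] := hconst.
have ae1 : {ae mu, forall x, J_integrand f beta g theta0 x = v2 x * (g x - F0 x)}.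
  apply: filterS hsmooth => x sx; rewrite info_power_versionE// /J_integrand.
  by rewrite mulrAC.
have mv2g : measurable_fun [set: T] (fun x => v2 x * (g x - F0 x)).
  by apply: measurable_funM => //; exact: measurable_funB.
have [i1 E1] := ae_eq_Rintegral mv2g ae1 iJ.
have ae2 : {ae mu, forall x, score f theta0 x ^+ 2 * f theta0 x `^ (1 + beta)
    - p^-1 * power_deriv 2 x = v2 x * F0 x}.
  apply: filterS hsmooth => x sx.
  by rewrite /F0 info_power_version_density// (mulrC p^-1).
have mv2F : measurable_fun [set: T] (fun x => v2 x * F0 x) by exact: measurable_funM.
have ik2 : mu.-integrable [set: T] (EFin \o (fun x => p^-1 * power_deriv 2 x)).
  by apply: integrableZl_EFin; exact: ik.
have [i2 E2] := ae_eq_Rintegral mv2F ae2 (integrableB_EFin hJ ik2).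
have Eg : (fun x => v2 x * g x) = (fun x => v2 x * (g x - F0 x) + v2 x * F0 x).
  by apply/funext => x; rewrite mulrBr subrK.
have i3 : mu.-integrable [set: T] (EFin \o (fun x => v2 x * g x)).
  by rewrite Eg; exact: integrableD_EFin.
split; first exact/(integrable_density mg g0 hG).
have -> : \int[G]_x v2 x = \int[mu]_x (v2 x * g x).
  by rewrite /Rintegral (integral_density mg g0 hG).
rewrite Eg RintegralD// -E2 RintegralB//.
rewrite RintegralZl//; last exact: ik.
rewrite -E1 /J_true /J_model.
by field.
Qed.

Lemma score_power_version_moments :
  [/\ G.-integrable [set: T] (EFin \o v1),
      G.-integrable [set: T] (EFin \o (fun x => v1 x ^+ 2)) &
      \int[G]_x v1 x ^+ 2 - (\int[G]_x v1 x) ^+ 2 = V_true mu f beta g theta0].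
Proof.
have mv1 := measurable_score_power_version.
have [_ iV2 iV1 _] := hconst.
have mv12 : measurable_fun [set: T] (fun x => v1 x ^+ 2) by exact: measurable_funX.
have ae1 : {ae mu, forall x,
    score f theta0 x * f theta0 x `^ beta * g x = v1 x * g x}.
  by apply: filterS hsmooth => x sx; rewrite score_power_versionE.
have ae2 : {ae mu, forall x,
    score f theta0 x ^+ 2 * f theta0 x `^ (2 * beta) * g x = v1 x ^+ 2 * g x}.
  apply: filterS hsmooth => x sx; rewrite score_power_versionE// exprMn.
  by rewrite mulrC (mulrC 2) powRrM (powR_mulrn 2)// ?powR_ge0// [RHS]mulrC.
have [i1 E1] := ae_eq_Rintegral (measurable_funM mv1 mg) ae1 iV1.
have [i2 E2] := ae_eq_Rintegral (measurable_funM mv12 mg) ae2 iV2.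
split; [exact/(integrable_density mg g0 hG)|exact/(integrable_density mg g0 hG)|].
rewrite /V_true E1 E2.
by rewrite /Rintegral !(integral_density mg g0 hG).
Qed.

End true_density.

End versions.

(** * Expansion of the pointwise objective *)

Section objective.
Context d (T : measurableType d) (R : realType).
Variables (mu : {sigma_finite_measure set T -> \bar R}).
Variables (f : R -> T -> R) (theta0 : R) (Theta omega : set R) (beta : R).
Hypothesis hf : forall theta, Theta theta -> is_density mu (f theta).
Hypotheses (omega_open : open omega) (omega_theta0 : omega theta0).
Hypothesis omega_sub : omega `<=` Theta.
Hypothesis hsupp : forall theta, Theta theta ->
  [set x | 0 < f theta x] = model_support f theta0.
Hypothesis beta0 : 0 <= beta.
Let p := 1 + beta.
Hypothesis hdiff :
  diff_under_integral mu 3 omega (fun theta x => f theta x `^ (1 + beta)).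

(* The x-independent part of [dpd_point] and its derivatives; it is absent from
   [dpd_point] when beta = 0. *)
Definition power_mass (k : nat) (theta : R) : R :=
  if beta == 0 then 0
  else \int[mu]_x derive1n k (fun s => f s x `^ (1 + beta)) theta.

(** The factor 1/beta of the objective cancels against the derivative of f^beta, so one formula
    serves beta = 0 and beta > 0. *)
Definition dpd_point1 (x : T) (theta : R) : R :=
  power_mass 1 theta - (1 + beta) * (score f theta x * f theta x `^ beta).

Definition dpd_point2 (x : T) (theta : R) : R :=
  power_mass 2 theta +
  (1 + beta) * ((info f theta x - beta * score f theta x ^+ 2) * f theta x `^ beta).

Lemma is_derive_power_mass k t : (k < 3)%N -> omega t ->
  is_derive t (1 : R) (power_mass k) (power_mass k.+1 t).
Proof.
move=> k3 omt; rewrite /power_mass; case: ifP => [_|_].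
  exact: is_derive_cst.
exact: (hdiff.2 t k omt k3).
Qed.

(** At beta = 0 the value 0 chosen for [power_mass] is the right one: densities have constant mass
    1, whose second derivative is 0. *)
Lemma power_mass2_theta0 :
  power_mass 2 theta0 = \int[mu]_x power_deriv f theta0 beta 2 x.
Proof.
rewrite /power_mass; case: ifP => // /eqP b0; apply/esym.
have mass1 t : omega t -> \int[mu]_x derive1n 0 (fun s => f s x `^ (1 + beta)) t = 1.
  move=> omt; have [_ f0 f1] := hf (omega_sub omt).
  rewrite -[RHS]/(fine 1%:E) -f1; congr fine.
  by apply: eq_integral => x _; rewrite derive1n0 b0 addr0 /= powRr1.
have d0 t : omega t -> \int[mu]_x derive1n 1 (fun s => f s x `^ (1 + beta)) t = 0.
  move=> omt; rewrite -(is_derive1E (hdiff.2 t 0 omt isT)).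
  apply: is_derive1E.
  apply: (is_derive_open_eq (psi := fun=> 1) omega_open omt mass1).
rewrite -(is_derive1E (hdiff.2 theta0 1 omega_theta0 isT)); apply: is_derive1E.
apply: (is_derive_open_eq (psi := fun=> 0) omega_open omega_theta0 d0).
Qed.

Lemma dpd_pointE x t : dpd_point mu f beta x t = power_mass 0 t +
  if beta == 0 then - ln (f t x) else - (p / beta) * f t x `^ beta.
Proof.
rewrite /dpd_point /power_mass; case: ifP => _; first by rewrite add0r.
by rewrite mulNr.
Qed.

Lemma is_derive_dpd_point x t : smooth_at f theta0 omega x ->
  model_support f theta0 x -> omega t ->
  [/\ is_derive t (1 : R) (dpd_point mu f beta x) (dpd_point1 x t),
      is_derive t (1 : R) (dpd_point1 x) (dpd_point2 x t) &
      derivable (dpd_point2 x) t 1].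
Proof.
move=> sx Sx omt.
have fpos s (oms : omega s) : 0 < (f ^~ x) s := density_pos omega_sub hsupp Sx oms.
have dF := sx Sx.
have dln s (oms : omega s) : is_derive s (1 : R) (fun s => ln (f s x)) (score f s x : R)
  := is_derive_ln_pos fpos dF oms.
have dpow q s (oms : omega s) : is_derive s (1 : R) (fun s => f s x `^ q)
    (q * score f s x * f s x `^ q : R) := is_derive_power omega_open fpos dF q oms.
have dscpow q s (oms : omega s) : is_derive s (1 : R) (fun s => score f s x * f s x `^ q)
    ((- info f s x + q * score f s x ^+ 2) * f s x `^ q : R).
  by rewrite /info opprK; exact: is_derive_score_power omega_open fpos dF q s oms.
have dm k : (k < 3)%N -> is_derive t (1 : R) (power_mass k) (power_mass k.+1 t : R).
  by move=> k3; exact: is_derive_power_mass.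
have dq : is_derive t (1 : R)
    (fun s => if beta == 0 then - ln (f s x) else - (p / beta) * f s x `^ beta : R)
    (- (p * (score f t x * f t x `^ beta)) : R).
  have [b0|b0] := eqVneq beta 0.
    apply: (is_derive_eq (is_deriveN (dln t omt))).
    by rewrite /p b0 powRr0 addr0 mul1r mulr1.
  apply: (is_derive_eq (is_deriveZ (- (p / beta)) (dpow beta t omt))).
  by rewrite /GRing.scale/=; field.
split.
- apply: (is_derive_open_eq omega_open omt (fun s _ => dpd_pointE x s)).
  exact: (is_deriveD (dm 0 isT) dq).
- have dz : is_derive t (1 : R) (fun s => p * (score f s x * f s x `^ beta))
      (p * ((- info f t x + beta * score f t x ^+ 2) * f t x `^ beta)).
    exact: (is_deriveZ p (dscpow beta t omt)).
  apply: (is_derive_eq (is_deriveB (dm 1 isT) dz)).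
  by rewrite /dpd_point2 -/p; ring.
- have di : derivable (fun s => (derive1 (score f ^~ x) s +
      beta * (score f s x * score f s x)) * f s x `^ beta) t 1.
    exact: (derivable_info_power omega_open fpos dF).
  have dz : is_derive t (1 : R) (fun s => - p * ((derive1 (score f ^~ x) s +
      beta * (score f s x * score f s x)) * f s x `^ beta)) _ :=
    is_deriveZ (- p) (derivable_is_derive1 di).
  have := is_derive_derivable (is_deriveD (dm 2 isT) dz).
  apply: (derivable_open_eq omega_open omt) => s oms.
  by rewrite /dpd_point2 /info -/p -[RHS]/(_ + _); ring.
Qed.

Lemma derive1n3_dpd_point x t : smooth_at f theta0 omega x ->
  model_support f theta0 x -> omega t ->
  derive1n 3 (dpd_point mu f beta x) t = derive1 (dpd_point2 x) t.
Proof.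
move=> sx Sx omt.
have E1 s : omega s -> derive1n 1 (dpd_point mu f beta x) s = dpd_point1 x s.
  by move=> oms; have [h _ _] := is_derive_dpd_point sx Sx oms; exact: is_derive1E h.
have E2 s : omega s -> derive1n 2 (dpd_point mu f beta x) s = dpd_point2 x s.
  move=> oms; rewrite derive1nS; apply: is_derive1E.
  by apply: (is_derive_open_eq omega_open oms E1); have [] := is_derive_dpd_point sx Sx oms.
rewrite derive1nS; apply: is_derive1E; apply: (is_derive_open_eq omega_open omt E2).
by apply: derivable_is_derive1; have [] := is_derive_dpd_point sx Sx omt.
Qed.

(** With [influence2], the functions h1 and h2 of the overview, equal to [dpd_point1] and
    [dpd_point2] at theta0 wherever f is smooth. *)
Definition influence1 (x : T) : R :=
  power_mass 1 theta0 - (1 + beta) * score_power_version f theta0 beta x.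

Definition influence2 (x : T) : R :=
  power_mass 2 theta0 + (1 + beta) * info_power_version f theta0 beta x.

Variable M : T -> R.

(** The properties required of a single observation. The last clause guards the case beta = 0, in
    which [ln 0 = 0] would hide an infinite objective off the support. *)
Definition dpd_regular (x : T) : Prop :=
  [/\ smooth_at f theta0 omega x,
      model_support f theta0 x -> forall t, omega t ->
        `|derive1n 3 (dpd_point mu f beta x) t| <= M x &
      beta = 0 -> model_support f theta0 x].

Let versions x : smooth_at f theta0 omega x ->
  dpd_point1 x theta0 = influence1 x /\ dpd_point2 x theta0 = influence2 x.
Proof.
move=> sx; rewrite /dpd_point1 /dpd_point2 /influence1 /influence2.
by rewrite (score_power_versionE hf omega_open omega_theta0 omega_sub hsupp beta0)//
  (info_power_versionE hf omega_open omega_theta0 omega_sub hsupp beta0).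
Qed.

Variable r : R.
Hypothesis r_omega : forall t, `|t - theta0| < r -> omega t.

Let remainder k t :=
  `|power_mass k t - power_mass k theta0 - power_mass k.+1 theta0 * (t - theta0)|.

(* Off the support f^beta vanishes, so [dpd_point x] is its x-independent part and
   no bound on its third derivative is available: differentiability of
   [power_mass] must do. *)
Let dpd_off x t : dpd_regular x -> ~ model_support f theta0 x -> omega t ->
  [/\ beta != 0, dpd_point mu f beta x t = power_mass 0 t,
      is_derive t (1 : R) (dpd_point mu f beta x) (dpd_point1 x t) &
      dpd_point1 x t = power_mass 1 t].
Proof.
move=> [sx _ b0S] Sx omt.
have b0 : beta != 0 by apply: contra_notN Sx => /eqP.
have E s : omega s -> dpd_point mu f beta x s = power_mass 0 s.
  move=> oms; rewrite dpd_pointE (negbTE b0) (density_eq0 hf omega_sub hsupp Sx oms).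
  by rewrite powR0// mulr0 addr0.
have E1 s : omega s -> dpd_point1 x s = power_mass 1 s.
  move=> oms; rewrite /dpd_point1 (density_eq0 hf omega_sub hsupp Sx oms).
  by rewrite powR0// !mulr0 subr0.
split; [by []|exact: E| |exact: E1].
rewrite E1//; apply: (is_derive_open_eq omega_open omt E).
exact: is_derive_power_mass.
Qed.

Lemma derivable_dpd_point x t : dpd_regular x -> omega t ->
  is_derive t (1 : R) (dpd_point mu f beta x) (dpd_point1 x t).
Proof.
move=> rx omt; have [Sx|Sx] := pselect (model_support f theta0 x).
  by have [sx _ _] := rx; have [] := is_derive_dpd_point sx Sx omt.
by have [] := dpd_off rx Sx omt.
Qed.

Let taylor_on x t : dpd_regular x -> model_support f theta0 x -> `|t - theta0| < r ->
  `|dpd_point1 x t - influence1 x - influence2 x * (t - theta0)| <= M x * (t - theta0) ^+ 2 /\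
  `|dpd_point mu f beta x t - dpd_point mu f beta x theta0 - influence1 x * (t - theta0)|
    <= (`|influence2 x| + M x * `|t - theta0|) * (t - theta0) ^+ 2.
Proof.
move=> [sx bM _] Sx tr; have [<- <-] := versions sx.
apply: (@taylor_bounds _ _ _ _ (derive1 (dpd_point2 x)) theta0 t r (M x)); last exact: tr.
move=> s sr; have oms := r_omega sr; have [d1 d2 d3] := is_derive_dpd_point sx Sx oms.
split; [exact: d1|exact: d2|exact: derivable_is_derive1|].
by rewrite -(derive1n3_dpd_point sx Sx oms); exact: bM.
Qed.

Let influence_off x : dpd_regular x -> ~ model_support f theta0 x ->
  influence1 x = power_mass 1 theta0 /\ influence2 x = power_mass 2 theta0.
Proof.
move=> rx Sx; have [sx _ _] := rx; have [b0 _ _ _] := dpd_off rx Sx omega_theta0.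
have [<- <-] := versions sx; rewrite /dpd_point1 /dpd_point2.
by rewrite (density_eq0 hf omega_sub hsupp Sx omega_theta0) (powR0 b0) !mulr0 subr0 addr0.
Qed.

(** On the support Taylor's formula gives the first summand; off it the x-free part gives the
    second. The absolute value is taken because nothing bounds [M] from below off the support. *)
Lemma dpd_point1_expansion x t : dpd_regular x -> `|t - theta0| < r ->
  `|dpd_point1 x t - influence1 x - influence2 x * (t - theta0)|
  <= `|M x| * (t - theta0) ^+ 2 + remainder 1 t.
Proof.
move=> rx tr; have [Sx|Sx] := pselect (model_support f theta0 x).
  have [h _] := taylor_on rx Sx tr; apply: le_trans h _.
  apply: ler_wpDr; first exact: normr_ge0.
  by apply: ler_wpM2r; [exact: sqr_ge0|exact: ler_norm].
have [-> ->] := influence_off rx Sx.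
have [_ _ _ ->] := dpd_off rx Sx (r_omega tr).
by apply: ler_wpDl; first by apply: mulr_ge0; [exact: normr_ge0|exact: sqr_ge0].
Qed.

(** One factor |t - theta0| is replaced by r, so that the coefficient of the quadratic term is a
    fixed function of x, integrable under G. *)
Lemma dpd_point_expansion x t : dpd_regular x -> `|t - theta0| < r ->
  `|dpd_point mu f beta x t - dpd_point mu f beta x theta0
    - influence1 x * (t - theta0)|
  <= (`|influence2 x| + `|M x| * r) * (t - theta0) ^+ 2 + remainder 0 t.
Proof.
move=> rx tr; have [Sx|Sx] := pselect (model_support f theta0 x).
  have [_ h] := taylor_on rx Sx tr; apply: le_trans h _.
  apply: ler_wpDr; first exact: normr_ge0.
  apply: ler_wpM2r; first exact: sqr_ge0.
  rewrite lerD2l; apply: (@le_trans _ _ (`|M x| * `|t - theta0|)).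
    by apply: ler_wpM2r; [exact: normr_ge0|exact: ler_norm].
  by apply: ler_wpM2l; [exact: normr_ge0|exact: ltW].
have [-> ->] := influence_off rx Sx.
have [_ -> _ _] := dpd_off rx Sx (r_omega tr).
have [_ -> _ _] := dpd_off rx Sx omega_theta0.
have r0 : 0 <= r by exact: le_trans (normr_ge0 _) (ltW tr).
apply: ler_wpDl; last by [].
by apply: mulr_ge0; [apply: addr_ge0; [|apply: mulr_ge0]|exact: sqr_ge0].
Qed.

Lemma remainder_small k : (k < 3)%N -> forall e : R, 0 < e ->
  exists2 r' : R, 0 < r' & forall t, `|t - theta0| < r' ->
    remainder k t <= e * `|t - theta0|.
Proof. by move=> k3; exact: peano1 (is_derive_power_mass k3 omega_theta0). Qed.

End objective.

(** * First-order conditions *)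

Section auxiliary.
Context d (T : measurableType d) (R : realType).
Variable mu : {measure set T -> \bar R}.

(** The integral is the difference of those of the positive and negative parts, and oo - oo is
    infinite by convention; a finite value forces both to be finite. *)
Lemma fin_num_integrable (k : T -> \bar R) : measurable_fun [set: T] k ->
  (\int[mu]_x k x)%E \is a fin_num -> mu.-integrable [set: T] k.
Proof.
move=> mk fk; apply/integrableP; split=> //.
by apply/abse_integralP => //; rewrite -fin_num_abs.
Qed.

Lemma ae_le_integrable (h k : T -> R) : measurable_fun [set: T] h ->
  mu.-integrable [set: T] (EFin \o k) -> {ae mu, forall x, `|h x| <= k x} ->
  mu.-integrable [set: T] (EFin \o h).
Proof.
move=> mh ik hk; apply/integrableP; split; first exact/measurable_EFinP.
have /integrableP[mk] := ik; apply: le_lt_trans.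
apply: ae_ge0_le_integral => //.
- by apply: measurableT_comp => //; exact/measurable_EFinP.
- exact: measurableT_comp.
- by apply: filterS hk => x hkx _; rewrite /= lee_fin (le_trans hkx)// ler_norm.
Qed.

Lemma ae_le_normr_Rintegral (h k : T -> R) : measurable_fun [set: T] h ->
  mu.-integrable [set: T] (EFin \o k) -> {ae mu, forall x, `|h x| <= k x} ->
  `|\int[mu]_x h x| <= \int[mu]_x k x.
Proof.
move=> mh ik hk; have ih := ae_le_integrable mh ik hk.
have mk : measurable_fun [set: T] k by apply/measurable_EFinP; exact: measurable_int ik.
apply: (le_trans (le_normr_Rintegral measurableT ih)).
(* [le_Rintegral] asks for the bound everywhere; this maximum satisfies it and equals [k] almost
   everywhere. *)
have mh' : measurable_fun [set: T] (fun x => Num.max (k x) `|h x|).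
  by apply: measurable_maxr => //; exact: measurableT_comp.
have E : {ae mu, forall x, k x = Num.max (k x) `|h x|}.
  by apply: filterS hk => x /max_idPl ->.
have [im ->] := ae_eq_Rintegral mh' E ik.
apply: le_Rintegral => //; first exact: integrable_norm ih.
by move=> x _; rewrite le_max lexx orbT.
Qed.

End auxiliary.

(** A slope a != 0 is refuted with e = |a|/2 at distance r/2, on the side where a t < 0. *)
Lemma null_slope (R : realType) (a : R) :
  (forall e : R, 0 < e -> exists2 r : R, 0 < r &
     forall t : R, `|t| < r -> - (e * `|t|) <= a * t) -> a = 0.
Proof.
move=> h; have [a0|a0|//] := ltgtP a 0.
- have [r r0 hr] := h (- a / 2) ltac:(lra).
  have := hr (r / 2); rewrite ger0_norm; last lra.
  have ar : a * r < 0 by rewrite nmulr_rlt0.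
  by move=> /(_ ltac:(lra)); lra.
- have [r r0 hr] := h (a / 2) ltac:(lra).
  have := hr (- (r / 2)); rewrite normrN ger0_norm; last lra.
  have ar : 0 < a * r by rewrite mulr_gt0.
  by move=> /(_ ltac:(lra)); lra.
Qed.

Section first_order.
Context d (T : measurableType d) (R : realType).
Variables (mu : {sigma_finite_measure set T -> \bar R}).
Variables (f : R -> T -> R) (theta0 : R) (Theta omega : set R) (beta : R).
Hypothesis hf : forall theta, Theta theta -> is_density mu (f theta).
Hypotheses (omega_open : open omega) (omega_theta0 : omega theta0).
Hypothesis omega_sub : omega `<=` Theta.
Hypothesis hsupp : forall theta, Theta theta ->
  [set x | 0 < f theta x] = model_support f theta0.
Hypothesis beta0 : 0 <= beta.
Hypothesis hdiff :
  diff_under_integral mu 3 omega (fun theta x => f theta x `^ (1 + beta)).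

Let mf t : omega t -> measurable_fun [set: T] (f t).
Proof. by move=> /omega_sub /hf[]. Qed.

Let mlnf t : omega t -> measurable_fun [set: T] (fun x => ln (f t x)).
Proof. by move=> /mf mft; exact: (measurableT_comp (@measurable_ln R) mft). Qed.

Let mpow t : omega t -> measurable_fun [set: T] (fun x => f t x `^ beta).
Proof. by move=> /mf mft; exact: (measurableT_comp (measurable_powR beta) mft). Qed.

Let mlne t : omega t -> measurable_fun [set: T] (fun x => lne (f t x)%:E).
Proof.
move=> omt; rewrite /lne; apply: measurable_fun_ifT => //.
- by apply: measurable_fun_ler => //; exact: mf.
- by apply/measurable_EFinP; exact: mlnf.
Qed.

Let S x := model_support f theta0 x.

Let integrable_cst (Q : {measure set T -> \bar R}) (c : R) : Q setT = 1%E ->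
  Q.-integrable [set: T] (EFin \o (fun=> c)).
Proof.
move=> Q1; apply/integrableP; split; first exact: measurable_cst.
have -> : (\int[Q]_x `|(EFin \o (fun=> c)) x| = \int[Q]_x cst `|c|%:E x)%E.
  exact: eq_integral.
by rewrite integral_cst// Q1 mule1 ltry.
Qed.

Lemma measurable_dpd_point t : omega t ->
  measurable_fun [set: T] (dpd_point mu f beta ^~ t).
Proof.
move=> omt; rewrite /dpd_point; case: (beta == 0).
  by apply: measurable_funN; exact: mlnf.
by apply: measurable_funB => //; apply: measurable_funM => //; exact: mpow.
Qed.

Let power_fin t : omega t ->
  (\int[mu]_x (f t x `^ (1 + beta))%:E = (\int[mu]_x f t x `^ (1 + beta))%:E)%E.
Proof.
move=> omt; rewrite /Rintegral fineK//; apply: integrable_fin_num => //.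
by have := hdiff.1 t 0 omt isT.
Qed.

Let lne_ln (Q : {measure set T -> \bar R}) t : omega t -> {ae Q, forall x, S x} ->
  (\int[Q]_x lne (f t x)%:E = \int[Q]_x (ln (f t x))%:E)%E.
Proof.
move=> omt aeS; apply: ae_eq_integral => //; first exact: mlne.
  by apply/measurable_EFinP; exact: mlnf.
apply: filterS aeS => x Sx _; rewrite lne_EFin//.
exact: density_pos omega_sub hsupp x t Sx omt.
Qed.

(** The objective uses the extended logarithm and [dpd_point] the real one; for beta = 0 they are
    reconciled by having Q live on the support. *)
Lemma objective_dpd_point (Q : {measure set T -> \bar R}) t : Q setT = 1%E ->
  omega t -> (beta = 0 -> {ae Q, forall x, S x}) ->
  Q.-integrable [set: T] (EFin \o (dpd_point mu f beta ^~ t)) ->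
  dpd_objective mu f beta Q t = (\int[Q]_x dpd_point mu f beta x t)%:E.
Proof.
move=> Q1 omt; rewrite /dpd_objective /dpd_point.
have [b0 /(_ b0) aeS|b0 _] := eqVneq beta 0 => iq.
  rewrite lne_ln//.
  have iln := integrableZl_EFin (-1) iq.
  have lnE : (fun x => -1 * - ln (f t x)) = (fun x => ln (f t x)).
    by apply/funext => x; rewrite mulN1r opprK.
  rewrite lnE in iln.
  have -> : \int[Q]_x - ln (f t x) = - \int[Q]_x ln (f t x).
    rewrite -mulN1r -RintegralZl//; apply: eq_Rintegral => x _; by rewrite mulN1r.
  by rewrite EFinN /Rintegral fineK//; exact: integrable_fin_num.
set m := \int[mu]_y f t y `^ (1 + beta); set c := (1 + beta) / beta.
have c0 : c != 0.
  by rewrite mulf_neq0 ?invr_eq0// gt_eqF// ltr_wpDr.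
have Qcst : Q.-integrable [set: T] (EFin \o (fun=> m)).
  exact: integrable_cst.
have ipow : Q.-integrable [set: T] (EFin \o (fun x => f t x `^ beta)).
  have := integrableZl_EFin c^-1 (integrableB_EFin Qcst iq).
  congr (Q.-integrable _ (EFin \o _)); apply/funext => x.
  by rewrite opprB addrC subrK mulKf.
rewrite RintegralB//; last exact: integrableZl_EFin.
rewrite RintegralZl// Rintegral_cst// Q1 mulr1 power_fin// -/m -/c.
have e : (\int[Q]_x (f t x `^ beta)%:E = (\int[Q]_x f t x `^ beta)%:E)%E.
  by rewrite /Rintegral fineK//; exact: integrable_fin_num.
by rewrite EFinB [in RHS]EFinM -e.
Qed.

(** For beta = 0 an integrable extended logarithm is finite almost everywhere, which puts Q on the
    support; for beta > 0 a finite objective means a finite integral of f^beta. *)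
Lemma fin_objective_integrable (Q : {measure set T -> \bar R}) t : Q setT = 1%E ->
  omega t -> dpd_objective mu f beta Q t \is a fin_num ->
  Q.-integrable [set: T] (EFin \o (dpd_point mu f beta ^~ t)) /\
  (beta = 0 -> {ae Q, forall x, S x}).
Proof.
move=> Q1 omt; rewrite /dpd_objective /dpd_point.
have [b0|b0] := eqVneq beta 0.
  rewrite fin_numN => /(fin_num_integrable (mlne omt)) ilne.
  have aeS : {ae Q, forall x, S x}.
    apply: filterS (integrable_ae measurableT ilne) => x /(_ I).
    rewrite /lne; case: ifPn => //; rewrite -ltNge => fx _.
    by rewrite /S -(hsupp (omega_sub omt)).
  split => //.
  have mln : measurable_fun [set: T] (EFin \o (fun x => ln (f t x))).
    by apply/measurable_EFinP; exact: mlnf.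
  have iln : Q.-integrable [set: T] (EFin \o (fun x => ln (f t x))).
    apply: fin_num_integrable => //; rewrite -lne_ln//.
    exact: integrable_fin_num.
  have := integrableZl_EFin (-1) iln.
  by congr (Q.-integrable _ (EFin \o _)); apply/funext => x; rewrite mulN1r.
set m := \int[mu]_y f t y `^ (1 + beta); set c := (1 + beta) / beta.
have c0 : 0 < c.
  by rewrite divr_gt0 ?ltr_wpDr// lt_neqAle eq_sym b0.
rewrite power_fin// fin_numB => /andP[_ fc]; split; last by move=> b; rewrite b eqxx in b0.
have mpowE : measurable_fun [set: T] (EFin \o (fun x => f t x `^ beta)).
  by apply/measurable_EFinP; exact: mpow.
have ipow : Q.-integrable [set: T] (EFin \o (fun x => f t x `^ beta)).
  apply: fin_num_integrable => //; move: fc; case: (integral _ _ _) => //=.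
  - by rewrite gt0_muley ?lte_fin.
  - by rewrite gt0_muleNy ?lte_fin.
have Qcst : Q.-integrable [set: T] (EFin \o (fun=> m)).
  exact: integrable_cst.
exact: (integrableB_EFin Qcst (integrableZl_EFin c ipow)).
Qed.

Lemma objective_power_lty t : omega t ->
  (\int[mu]_x (f t x `^ (1 + beta))%:E < +oo)%E.
Proof. by move=> omt; rewrite power_fin// ltry. Qed.

Variables (M : T -> R) (r : R).
Hypothesis r0 : 0 < r.
Hypothesis r_omega : forall t, `|t - theta0| < r -> omega t.

(** With delta = t - theta0, minimality gives 0 <= E(D(t) - D(theta0)) <= delta E h1 + O(delta^2) +
    o(|delta|) for both signs of delta, which excludes a non-zero slope. *)
Lemma influence1_mean (G : probability T R) :
  {ae G, forall x, dpd_regular mu f theta0 omega beta M x} ->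
  G.-integrable [set: T] (EFin \o M) ->
  G.-integrable [set: T] (EFin \o influence1 mu f theta0 beta) ->
  G.-integrable [set: T] (EFin \o influence2 mu f theta0 beta) ->
  is_min_dpd mu f beta Theta G theta0 ->
  \int[G]_x influence1 mu f theta0 beta x = 0.
Proof.
move=> aeG iM ih1 ih2 [_ fin0 min0].
have G1 : G setT = 1%E by exact: probability_setT.
have [i0 S0] := fin_objective_integrable G1 omega_theta0 fin0.
set h1 := influence1 mu f theta0 beta in ih1 *.
set h2 := influence2 mu f theta0 beta in ih2.
have mh1 : measurable_fun [set: T] h1 by apply/measurable_EFinP; exact: measurable_int ih1.
pose rem t := `|power_mass mu f beta 0 t - power_mass mu f beta 0 theta0
                - power_mass mu f beta 1 theta0 * (t - theta0)|.
pose K x := `|h2 x| + `|M x| * r.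
have iK : G.-integrable [set: T] (EFin \o K).
  apply: integrableD_EFin; first exact: integrable_norm ih2.
  by apply: integrableZr_EFin; exact: integrable_norm iM.
pose bK := \int[G]_x K x.
have bK0 : 0 <= bK.
  by apply: Rintegral_ge0 => x _; rewrite addr_ge0// mulr_ge0// ltW.
have icst (c : R) : G.-integrable [set: T] (EFin \o (fun=> c)).
  by apply: (bounded_integrable G (C := `|c|)).
pose D x t := dpd_point mu f beta x t.
have bound t : `|t - theta0| < r -> - (bK * (t - theta0) ^+ 2 + rem t) <=
    (\int[G]_x h1 x) * (t - theta0).
  move=> tr; have omt := r_omega tr.
  have mD s : omega s -> measurable_fun [set: T] (D ^~ s) by exact: measurable_dpd_point.
  pose del x := D x t - D x theta0 - h1 x * (t - theta0).
  have mdel : measurable_fun [set: T] del.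
    apply: measurable_funB; first by apply: measurable_funB; exact: mD.
    exact: measurable_funM.
  pose bd x := K x * (t - theta0) ^+ 2 + rem t.
  have ibd : G.-integrable [set: T] (EFin \o bd).
    by apply: integrableD_EFin => //; exact: integrableZr_EFin.
  have aeb : {ae G, forall x, `|del x| <= bd x}.
    apply: filterS aeG => x rx.
    exact: (dpd_point_expansion hf omega_open omega_theta0 omega_sub hsupp beta0 hdiff r_omega rx tr).
  have idel := ae_le_integrable mdel ibd aeb.
  have ihd := integrableZr_EFin (t - theta0) ih1.
  have iDt : G.-integrable [set: T] (EFin \o (D ^~ t)).
    have := integrableD_EFin (integrableD_EFin idel ihd) i0.
    by congr (G.-integrable _ (EFin \o _)); apply/funext => x; rewrite /del /D subrK subrK.
  have := min0 t (omega_sub omt) (objective_power_lty omt).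
  rewrite !objective_dpd_point// lee_fin => le0t.
  have := ae_le_normr_Rintegral mdel ibd aeb.
  rewrite /bd (RintegralD measurableT (integrableZr_EFin _ iK) (icst _)).
  rewrite RintegralZr// Rintegral_cst//= probability_setT mulr1 -/bK.
  rewrite /del (RintegralB measurableT (integrableB_EFin iDt i0) ihd).
  rewrite (RintegralB measurableT iDt i0) RintegralZr// ler_norml => /andP[_ h].
  by rewrite lerNl; apply: le_trans _ h; rewrite lerDr subr_ge0.
apply: null_slope => e e0.
have [r' r'0 hr'] := @remainder_small _ _ _ mu f theta0 omega beta omega_theta0 hdiff 0 isT
  (e / 2) (divr_gt0 e0 (ltr0n _ 2)).
have bK1 : 0 < bK + 1 by rewrite ltr_wpDl.
(* Within this radius the quadratic term and the remainder each cost at most (e/2)|t|; adding 1 to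
   [bK] covers bK = 0. *)
exists (Num.min r (Num.min r' (e / (2 * (bK + 1))))).
  by rewrite !lt_min r0 r'0 divr_gt0// mulr_gt0.
move=> t; rewrite !lt_min => /and3P[tr tr' te].
have := bound (theta0 + t); have := hr' (theta0 + t).
have dt : theta0 + t - theta0 = t by rewrite addrAC subrr add0r.
rewrite dt => /(_ tr') rem_le /(_ tr); apply: le_trans.
rewrite lerN2; apply: (@le_trans _ _ ((bK + 1) * `|t| * `|t| + e / 2 * `|t|)).
  apply: lerD; last by rewrite /rem dt; exact: rem_le.
  rewrite -mulrA -expr2 real_normK ?num_real// ler_wpM2r ?sqr_ge0//.
  by rewrite lerDl.
rewrite -mulrDl ler_wpM2r// -lerBrDr.
move: te; rewrite ltr_pdivlMr ?mulr_gt0// => te.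
by lra.
Qed.

End first_order.

(** * Integrals against the empirical distribution and the root equation *)

Section empirical_integral.
Context dO d (Omega : measurableType dO) (T : measurableType d) (R : realType).
Variables (P : probability Omega R) (X : nat -> {RV P >-> T}).
Variables (n : nat) (w : Omega).
Hypothesis n0 : (0 < n)%N.
Let Q := empirical X n w.

Lemma ge0_integral_empirical (h : T -> \bar R) : measurable_fun [set: T] h ->
  (forall x, 0 <= h x)%E ->
  (\int[Q]_x h x = (n%:R^-1)%:E * \sum_(i < n) h (X i w))%E.
Proof.
move=> mh h0; rewrite ge0_integral_mscale//= ge0_integral_measure_sum//.
congr (_ * _)%E; apply: eq_bigr => i _.
by rewrite integral_dirac// diracT mul1e.
Qed.

Lemma empirical_setT : Q setT = 1%E.
Proof.
have := @ge0_integral_empirical (cst 1%E) (measurable_cst _) (fun=> lee01).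
rewrite integral_cst// mul1e => ->.
rewrite sumEFin sumr_const card_ord -EFinM mulVf// pnatr_eq0.
by rewrite -lt0n.
Qed.

Lemma integrable_empirical (h : T -> R) : measurable_fun [set: T] h ->
  Q.-integrable [set: T] (EFin \o h).
Proof.
move=> mh; apply/integrableP; split; first exact/measurable_EFinP.
rewrite ge0_integral_empirical//; last first.
  by apply: measurableT_comp => //; exact/measurable_EFinP.
by rewrite sumEFin -EFinM ltry.
Qed.

Lemma Rintegral_empirical (h : T -> R) : measurable_fun [set: T] h ->
  \int[Q]_x h x = n%:R^-1 * \sum_(i < n) h (X i w).
Proof.
move=> mh; pose hp x := Num.max (h x) 0; pose hn x := Num.max (- h x) 0.
have mhp : measurable_fun [set: T] hp by exact: measurable_maxr.
have mhn : measurable_fun [set: T] hn.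
  by apply: measurable_maxr => //; exact: measurable_funN.
have part (k : T -> R) : measurable_fun [set: T] k -> (forall x, 0 <= k x) ->
    \int[Q]_x k x = n%:R^-1 * \sum_(i < n) k (X i w).
  move=> mk k0; rewrite /Rintegral ge0_integral_empirical.
  - by rewrite sumEFin.
  - exact/measurable_EFinP.
  - by move=> x; rewrite lee_fin.
have hE x : h x = hp x - hn x.
  by rewrite /hp /hn; case: (lerP (h x) 0) => h0; case: (lerP (- h x) 0); lra.
have -> : \int[Q]_x h x = \int[Q]_x (hp x - hn x).
  by apply: eq_Rintegral => x _; exact: hE.
rewrite RintegralB//; [|exact: integrable_empirical..].
rewrite (part _ mhp) ?(part _ mhn); [|by move=> x; rewrite le_max lexx orbT..].
by rewrite -mulrBr -sumrB; congr (_ * _); apply: eq_bigr => i _; rewrite -hE.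
Qed.

Lemma ae_empirical (A : set T) : measurable A -> (forall i, (i < n)%N -> A (X i w)) ->
  {ae Q, forall x, A x}.
Proof.
move=> mA hA; exists (~` A); split; [exact: measurableC| |by []].
rewrite -(setIT (~` A)) -integral_indic//; last exact: measurableC.
rewrite ge0_integral_empirical//; last first.
  by apply/measurable_EFinP; exact/measurable_indic/measurableC.
rewrite big1 ?mule0// => i _; rewrite indicE memNset//=.
by apply; exact: hA.
Qed.

End empirical_integral.

Section empirical_first_order.
Context dO d (Omega : measurableType dO) (T : measurableType d) (R : realType).
Variables (P : probability Omega R) (X : nat -> {RV P >-> T}).
Variables (mu : {sigma_finite_measure set T -> \bar R}).
Variables (f : R -> T -> R) (theta0 : R) (Theta omega : set R) (beta : R).
Hypothesis hf : forall theta, Theta theta -> is_density mu (f theta).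
Hypotheses (omega_open : open omega) (omega_theta0 : omega theta0).
Hypothesis omega_sub : omega `<=` Theta.
Hypothesis hsupp : forall theta, Theta theta ->
  [set x | 0 < f theta x] = model_support f theta0.
Hypothesis beta0 : 0 <= beta.
Hypothesis hdiff :
  diff_under_integral mu 3 omega (fun theta x => f theta x `^ (1 + beta)).
Variables (M : T -> R) (r : R).
Hypothesis r_omega : forall t, `|t - theta0| < r -> omega t.

Lemma measurable_model_support : measurable (model_support f theta0).
Proof.
have [mf _ _] := hf (omega_sub omega_theta0).
have -> : model_support f theta0 = [set: T] `&` f theta0 @^-1` `]0, +oo[%classic.
  rewrite setTI; apply/seteqP; split => x;
    by rewrite /model_support/= in_itv/= andbT.
exact: mf.
Qed.

(** On a ball inside omega the empirical objective is the differentiable finite sum phi / n, and t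
    is an interior minimum. At beta = 0 all observations lie in the support, so the extended
    logarithm is finite at each of them. *)
Lemma empirical_first_order (n : nat) (w : Omega) (t : R) : (0 < n)%N ->
  (forall i, (i < n)%N -> dpd_regular mu f theta0 omega beta M (X i w)) ->
  `|t - theta0| < r -> is_min_dpd mu f beta Theta (empirical X n w) t ->
  \sum_(i < n) dpd_point1 mu f beta (X i w) t = 0.
Proof.
move=> n0 reg tr [_ _ mint].
pose phi (s : R) : R := \sum_(i < n) dpd_point mu f beta (X i w) s.
have dphi s : `|s - theta0| < r ->
    is_derive s (1 : R) phi (\sum_(i < n) dpd_point1 mu f beta (X i w) s).
  move=> sr.
  have -> : phi = \sum_(i < n) dpd_point mu f beta (X i w).
    by apply/funext => u; rewrite fct_sumE.
  apply: is_derive_sum => i.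
  exact: (derivable_dpd_point hf omega_open omega_sub hsupp hdiff (reg i (ltn_ord i)) (r_omega sr)).
have Q1 := empirical_setT X w n0.
have aeS : {ae empirical X n w, forall x, model_support f theta0 x} \/ beta != 0.
  have [b0|b0] := eqVneq beta 0; [left|by right].
  by apply: ae_empirical => [|i /reg[_ _ /(_ b0)]//]; exact: measurable_model_support.
have obj s : `|s - theta0| < r ->
    dpd_objective mu f beta (empirical X n w) s = (n%:R^-1 * phi s)%:E.
  move=> /r_omega oms.
  have mD := measurable_dpd_point beta hf omega_sub oms.
  rewrite (objective_dpd_point hf omega_sub hsupp beta0 hdiff Q1 oms).
  - by rewrite Rintegral_empirical.
  - by move=> b0; case: aeS => //; rewrite b0 eqxx.
  - exact: integrable_empirical.
have phi_min s : `|s - theta0| < r -> phi t <= phi s.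
  move=> sr; have oms := r_omega sr.
  have := mint s (omega_sub oms) (objective_power_lty hdiff oms).
  by rewrite !obj// lee_fin ler_pM2l// invr_gt0 ltr0n.
have in_ball s : (s \in `]theta0 - r, theta0 + r[%R) = (`|s - theta0| < r).
  by rewrite in_itv/= ltr_distl.
have d0 : is_derive t (1 : R) phi 0.
  apply: (derive1_at_min (a := theta0 - r) (b := theta0 + r)).
  - by rewrite lerD2l ge0_cp//; exact: le_trans (normr_ge0 _) (ltW tr).
  - by move=> s; rewrite in_ball => /dphi; exact: is_derive_derivable.
  - by rewrite in_ball.
  - by move=> s; rewrite in_ball; exact: phi_min.
by rewrite -(is_derive1E (dphi t tr)) (is_derive1E d0).
Qed.

End empirical_first_order.

(** * Expansion of the divergence *)

Section divergence.
Context d (T : measurableType d) (R : realType).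
Variables (mu : {sigma_finite_measure set T -> \bar R}).
Variables (f : R -> T -> R) (theta0 : R) (Theta omega : set R) (beta gam lam : R).
Hypothesis hf : forall theta, Theta theta -> is_density mu (f theta).
Hypotheses (omega_open : open omega) (omega_theta0 : omega theta0).
Hypothesis omega_sub : omega `<=` Theta.
Hypothesis hsupp : forall theta, Theta theta ->
  [set x | 0 < f theta x] = model_support f theta0.
Hypothesis hsmooth : {ae mu, forall x, smooth_at f theta0 omega x}.
Hypotheses (beta0 : 0 <= beta) (gam0 : 0 <= gam).
Hypothesis hJ : mu.-integrable [set: T]
  (fun x => (score f theta0 x ^+ 2 * f theta0 x `^ (1 + beta))%:E).
Hypothesis hreg : sdiv_regular mu f theta0 omega gam lam.
Hypothesis hfisher : (0 < fisher mu f theta0)%E.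

Let A : R := sdivA gam lam.
Let B : R := sdivB gam lam.
Let p := 1 + gam.
Let cross t x := sdiv_cross gam lam (f t) (f theta0) x.
Let power t x := f t x `^ (1 + gam).

Let p0 : 0 < p. Proof. by rewrite ltr_wpDr. Qed.
Let AB : A + B = p. Proof. by rewrite /A /B /sdivA /sdivB /p; lra. Qed.

Let C k t := \int[mu]_x derive1n k (cross ^~ x) t.
Let D k t := \int[mu]_x derive1n k (power ^~ x) t.

(** The theta-free part of the divergence, split off so that [s k] is the k-th derivative of the
    rest. *)
Let const0 : R :=
  if A == 0 then - (p^-1 * D 0 theta0) else if B == 0 then p^-1 * D 0 theta0
  else A^-1 * D 0 theta0.

Let s k t := sdiv_coef_cross gam lam * C k t + sdiv_coef_power gam lam * D k t.

Let integrable_cross k t : (k <= 2)%N -> omega t ->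
  mu.-integrable [set: T] (EFin \o (fun x => derive1n k (cross ^~ x) t)).
Proof. by move=> k2 omt; exact: (hreg.2.1 t k omt k2). Qed.

Let integrable_power k t : (k <= 2)%N -> omega t ->
  mu.-integrable [set: T] (EFin \o (fun x => derive1n k (power ^~ x) t)).
Proof. by move=> k2 omt; exact: (hreg.1.1 t k omt k2). Qed.

Let EFin_Rintegral (h : T -> R) : mu.-integrable [set: T] (EFin \o h) ->
  (\int[mu]_x (h x)%:E = (\int[mu]_x h x)%:E)%E.
Proof. by move=> ih; rewrite /Rintegral fineK//; exact: integrable_fin_num. Qed.

Let Rintegral_zero : \int[mu]_x (0 : R) = 0.
Proof. by rewrite /Rintegral integral0. Qed.

Let sdivE t : omega t ->
  sdiv mu gam lam (f t) (f theta0) = (const0 + s 0 t)%:E.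
Proof.
move=> omt.
have iC := integrable_cross (isT : (0 <= 2)%N) omt.
have iD := integrable_power (isT : (0 <= 2)%N) omt.
have iD0 := integrable_power (isT : (0 <= 2)%N) omega_theta0.
have diffE (h1 h2 : T -> R) : mu.-integrable [set: T] (EFin \o h1) ->
    mu.-integrable [set: T] (EFin \o h2) ->
    (\int[mu]_x ((h1 x - h2 x) / p)%:E = (p^-1 * (\int[mu]_x h1 x - \int[mu]_x h2 x))%:E)%E.
  move=> i1 i2; have i12 := integrableB_EFin i1 i2.
  rewrite (EFin_Rintegral (integrableZr_EFin p^-1 i12)) RintegralZr//.
  by rewrite RintegralB// mulrC.
rewrite /sdiv /s /const0 /sdiv_coef_cross /sdiv_coef_power -/A -/B -/p.
have eC : (\int[mu]_x (cross t x)%:E = (C 0 t)%:E)%E by exact: EFin_Rintegral.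
have eD : (\int[mu]_x (power t x)%:E = (D 0 t)%:E)%E by exact: EFin_Rintegral.
have eD0 : (\int[mu]_x (power theta0 x)%:E = (D 0 theta0)%:E)%E by exact: EFin_Rintegral.
case: eqVneq => A0; last case: eqVneq => B0.
- by rewrite eC diffE// -EFinB; congr EFin; rewrite /D /=; ring.
- by rewrite eC diffE// -EFinB; congr EFin; rewrite /D /=; ring.
- by rewrite eC eD eD0 -!EFinM -EFinB -EFinD; congr EFin; ring.
Qed.

Let cross_theta0 x : A != 0 -> B != 0 -> cross theta0 x = power theta0 x.
Proof.
move=> A0 B0; rewrite /cross /sdiv_cross (negbTE A0) (negbTE B0) /power -/p.
have [_ f0 _] := hf (omega_sub omega_theta0).
have := f0 x; rewrite le_eqVlt => /orP[/eqP <-|fx].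
  by rewrite !powR0// ?mul0r// gt_eqF.
rewrite -AB addrC [RHS]powRD//; apply/implyP => _; exact: lt0r_neq0.
Qed.

Let s_theta0 : const0 + s 0 theta0 = 0.
Proof.
rewrite /const0 /s /sdiv_coef_cross /sdiv_coef_power -/A -/B -/p.
have C0 : (A == 0) || (B == 0) -> C 0 theta0 = 0.
  move=> AB0; rewrite /C -[RHS]Rintegral_zero.
  apply: eq_Rintegral => x _; rewrite derive1n0 /cross /sdiv_cross -/A -/B.
  have l0 : ln (f theta0 x / f theta0 x) = 0.
    have [->|fx] := eqVneq (f theta0 x) 0; first by rewrite mul0r ln0.
    by rewrite divff// ln1.
  by case: (A == 0) AB0 => [_|/= ->]; rewrite l0 mulr0.
case: (eqVneq A 0) => A0; last case: (eqVneq B 0) => B0.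
- by rewrite C0 ?A0 ?eqxx//; ring.
- by rewrite C0 ?B0 ?eqxx ?orbT//; ring.
- have -> : C 0 theta0 = D 0 theta0.
    by apply: eq_Rintegral => x _; rewrite !derive1n0 cross_theta0.
  by rewrite -AB; field; rewrite A0 B0.
Qed.

Let is_derive_s k t : (k < 2)%N -> omega t ->
  is_derive t (1 : R) (s k) (s k.+1 t).
Proof.
move=> k2 omt.
have dC : is_derive t (1 : R) (C k) (C k.+1 t : R) := hreg.2.2 t k omt k2.
have dD : is_derive t (1 : R) (D k) (D k.+1 t : R) := hreg.1.2 t k omt k2.
exact: (is_deriveD (is_deriveZ (sdiv_coef_cross gam lam) dC)
                   (is_deriveZ (sdiv_coef_power gam lam) dD)).
Qed.

Let s_Rintegral k : (k <= 2)%N ->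
  mu.-integrable [set: T] (EFin \o (fun x =>
    sdiv_coef_cross gam lam * derive1n k (cross ^~ x) theta0 +
    sdiv_coef_power gam lam * derive1n k (power ^~ x) theta0)) /\
  s k theta0 = \int[mu]_x (sdiv_coef_cross gam lam * derive1n k (cross ^~ x) theta0 +
    sdiv_coef_power gam lam * derive1n k (power ^~ x) theta0).
Proof.
move=> k2; have iC := integrable_cross k2 omega_theta0.
have iD := integrable_power k2 omega_theta0.
have iC' := integrableZl_EFin (sdiv_coef_cross gam lam) iC.
have iD' := integrableZl_EFin (sdiv_coef_power gam lam) iD.
split; first exact: integrableD_EFin.
by rewrite (RintegralD measurableT iC' iD') !RintegralZl.
Qed.

Let derives x : smooth_at f theta0 omega x -> _ :=
  @sdiv_cross_derive _ _ _ _ f theta0 Theta omega hf omega_open omega_theta0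
    omega_sub hsupp gam lam gam0 x.

Let s1_theta0 : s 1 theta0 = 0.
Proof.
have [i1 ->] := s_Rintegral (isT : (1 <= 2)%N).
have ae0 : {ae mu, forall x, sdiv_coef_cross gam lam * derive1n 1 (cross ^~ x) theta0 +
    sdiv_coef_power gam lam * derive1n 1 (power ^~ x) theta0 = 0}.
  by apply: filterS hsmooth => x /derives[].
have [_ ->] := ae_eq_Rintegral (measurable_cst _) ae0 i1.
exact: Rintegral_zero.
Qed.

Let mscore q : 0 <= q ->
  measurable_fun [set: T] (fun x => score f theta0 x ^+ 2 * f theta0 x `^ (1 + q)).
Proof. exact: (measurable_score_sqr_power hf omega_theta0 omega_sub beta0 hJ). Qed.

Let s2_theta0 :
  mu.-integrable [set: T] (EFin \o (fun x => score f theta0 x ^+ 2 * f theta0 x `^ p)) /\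
  s 2 theta0 = A_model mu f gam theta0.
Proof.
have [i2 ->] := s_Rintegral (isT : (2 <= 2)%N).
have ae2 : {ae mu, forall x, sdiv_coef_cross gam lam * derive1n 2 (cross ^~ x) theta0 +
    sdiv_coef_power gam lam * derive1n 2 (power ^~ x) theta0 =
    p * (score f theta0 x ^+ 2 * f theta0 x `^ p)}.
  by apply: filterS hsmooth => x /derives[].
have ms : measurable_fun [set: T] (fun x => score f theta0 x ^+ 2 * f theta0 x `^ p).
  exact: mscore.
have [ip ->] := ae_eq_Rintegral (measurable_funM (measurable_cst p) ms) ae2 i2.
have is2 : mu.-integrable [set: T] (EFin \o (fun x => score f theta0 x ^+ 2 * f theta0 x `^ p)).
  have := integrableZl_EFin p^-1 ip.
  congr (mu.-integrable _ (EFin \o _)); apply/funext => x.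
  by rewrite mulKf// gt_eqF.
by split => //; rewrite RintegralZl.
Qed.

(** If the integral were 0, u^2 f^(1+gam) and hence u^2 f would vanish almost everywhere, against
    the positive Fisher information. *)
Lemma A_model_pos : 0 < A_model mu f gam theta0.
Proof.
have [is2 _] := s2_theta0; rewrite /A_model mulr_gt0//.
have q0 x : 0 <= score f theta0 x ^+ 2 * f theta0 x `^ p.
  by rewrite mulr_ge0 ?sqr_ge0 ?powR_ge0.
rewrite lt_neqAle /J_model Rintegral_ge0// andbT; apply/eqP => J0.
have ms : measurable_fun [set: T] (fun x => score f theta0 x ^+ 2 * f theta0 x `^ p).
  by apply/measurable_EFinP; exact: measurable_int is2.
have : (\int[mu]_x `|(score f theta0 x ^+ 2 * f theta0 x `^ p)%:E| = 0)%E.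
  have -> : (\int[mu]_x `|(score f theta0 x ^+ 2 * f theta0 x `^ p)%:E| =
      \int[mu]_x (score f theta0 x ^+ 2 * f theta0 x `^ p)%:E)%E.
    by apply: eq_integral => x _; rewrite abse_EFin ger0_norm.
  by rewrite (EFin_Rintegral is2) -J0.
move=> /(ae_eq_integral_abs mu measurableT (proj2 (measurable_EFinP _ _) ms)) ae0.
have := hfisher; rewrite /fisher.
have m1 : measurable_fun [set: T] (fun x => score f theta0 x ^+ 2 * f theta0 x).
  have := mscore (lexx 0); congr (measurable_fun _ _); apply/funext => x.
  by rewrite addr0 powRr1//; have [_ ->] := hf (omega_sub omega_theta0).
rewrite (ae_eq_integral (cst 0%E))//; first by rewrite integral0 ltxx.
  exact/measurable_EFinP.
apply: filterS ae0 => x /(_ I) /= [] sx _; congr EFin.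
move/eqP: sx; rewrite mulf_eq0 => /orP[/eqP ->|]; first by rewrite mul0r.
by rewrite powR_eq0 => /andP[/eqP -> _]; rewrite mulr0.
Qed.

(** The witness [y] records that the extended-valued divergence is finite near theta0. *)
Lemma sdiv_expansion (e : R) : 0 < e -> exists2 r : R, 0 < r &
  forall t, `|t - theta0| < r -> exists2 y : R,
    sdiv mu gam lam (f t) (f theta0) = y%:E &
    `|y - A_model mu f gam theta0 / 2 * (t - theta0) ^+ 2| <= e * (t - theta0) ^+ 2.
Proof.
move=> e0.
have [r0 /= r00 r0_omega] : exists2 r0 : R, 0 < r0 &
    forall t, `|t - theta0| < r0 -> omega t.
  have [r0 /= r00 sub] := open_nbhs_nbhs (conj omega_open omega_theta0).
  by exists r0 => // t tr; apply: sub; rewrite /= distrC.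
have ds1 t : `|t - theta0| < r0 -> is_derive t (1 : R) (s 0) (s 1 t).
  by move=> /r0_omega; exact: is_derive_s.
have [r1 r10 h1] := peano2 r00 ds1 s1_theta0 (is_derive_s (isT : (1 < 2)%N) omega_theta0) e0.
exists (Num.min r0 r1); first by rewrite lt_min r00.
move=> t; rewrite lt_min => /andP[/r0_omega omt tr1].
exists (const0 + s 0 t); first exact: sdivE.
have [_ <-] := s2_theta0; have := h1 t tr1.
by have -> : const0 + s 0 t = s 0 t - s 0 theta0 by have := s_theta0; lra.
Qed.

End divergence.

(** * Asymptotics of the statistic *)

Section asymptotically_sure.
Context dO (Omega : measurableType dO) (R : realType).
Variable P : probability Omega R.

(** Inner probability tending to 1: the events involve minimality and almost sure regularity of the
    sample, and are not known to be measurable. *)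
Definition asymptotically_sure (E : nat -> set Omega) : Prop :=
  forall eta : R, 0 < eta -> \forall n \near \oo,
    exists F, [/\ measurable F, F `<=` E n & 1 - eta <= fine (P F)].

Lemma fine_probabilityC (A : set Omega) : measurable A ->
  fine (P (~` A)) = 1 - fine (P A).
Proof.
by move=> mA; rewrite probability_setC// fineB// fin_num_measure.
Qed.

Lemma fine_probability_le (A B : set Omega) : measurable A -> measurable B ->
  A `<=` B -> fine (P A) <= fine (P B).
Proof.
by move=> mA mB AB; apply: fine_le; rewrite ?fin_num_measure// le_measure// inE.
Qed.

Lemma fine_probabilityU (A B : set Omega) : measurable A -> measurable B ->
  fine (P (A `|` B)) <= fine (P A) + fine (P B).
Proof.
move=> mA mB; rewrite -fineD ?fin_num_measure//.
apply: fine_le; rewrite ?fin_numD ?fin_num_measure//; first exact: measurableU.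
exact: measureU2.
Qed.

Lemma asymptotically_sureI (E1 E2 : nat -> set Omega) :
  asymptotically_sure E1 -> asymptotically_sure E2 ->
  asymptotically_sure (fun n => E1 n `&` E2 n).
Proof.
move=> h1 h2 eta eta0; have eta2 : 0 < eta / 2 by rewrite divr_gt0.
have := h1 _ eta2; have := h2 _ eta2; apply: filterS2 => n [F2 [m2 s2 p2]] [F1 [m1 s1 p1]].
exists (F1 `&` F2); split; [exact: measurableI|exact: setISS|].
have := fine_probabilityU (measurableC m1) (measurableC m2).
rewrite -setCI !fine_probabilityC//; last exact: measurableI.
by lra.
Qed.

Lemma asymptotically_sure_sub (E1 E2 : nat -> set Omega) :
  (\forall n \near \oo, E1 n `<=` E2 n) ->
  asymptotically_sure E1 -> asymptotically_sure E2.
Proof.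
move=> sub h eta eta0; have := h _ eta0; apply: filterS2 sub => n sub [F [mF FE pF]].
by exists F; split => //; exact: subset_trans sub.
Qed.

Lemma ae_asymptotically_sure (E : set Omega) : {ae P, forall w, E w} ->
  asymptotically_sure (fun=> E).
Proof.
move=> [N [mN PN sub]] eta eta0; near=> n; exists (~` N); split.
- exact: measurableC.
- by rewrite -[E]setCK; exact: subsetC.
- by rewrite fine_probabilityC// PN subr0 gerBl ltW.
Unshelve. all: by end_near. Qed.

Lemma asymptotically_sure_le (E A B : nat -> set Omega) : asymptotically_sure E ->
  (forall n, measurable (A n)) -> (forall n, measurable (B n)) ->
  (forall n, A n `&` E n `<=` B n) ->
  forall eta : R, 0 < eta -> \forall n \near \oo,
    fine (P (A n)) <= fine (P (B n)) + eta.
Proof.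
move=> h mA mB sub eta eta0; have := h _ eta0; apply: filterS => n [F [mF FE pF]].
have AB : A n `<=` B n `|` ~` F.
  by move=> w Aw; have [Fw|] := pselect (F w); [left; apply: sub; split=> //; exact: FE|right].
have mFc := measurableC mF.
apply: (le_trans (fine_probability_le (mA n) (measurableU _ _ (mB n) mFc) AB)).
apply: (le_trans (fine_probabilityU (mB n) mFc)).
by rewrite lerD2l fine_probabilityC//; lra.
Qed.

End asymptotically_sure.

(** Put z = Z / j, e = z + x and q = x^2. Then 2|e x| <= 6 th q and e^2 <= 9 th^2 q <= th q, so z^2
    lies between (1 - 6 th) q and (1 + 7 th) q. The claims become 1 + 7 th <= rho (1 - 2 th) and 1 +
    2 th <= rho (1 - 6 th), which follow from rho - 1 = 20 th rho; the 20 also ensures 9 th < 1. *)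
Lemma ratio_bounds (R : realType) (a j rho x Z xi : R) : 0 < a -> j != 0 -> 1 < rho ->
  let th := (rho - 1) / (20 * rho) in
  `|Z + j * x| <= 3 * th * (`|j| * `|x|) ->
  `|xi - a * x ^+ 2| <= 2 * th * (a * x ^+ 2) ->
  a / j ^+ 2 * Z ^+ 2 <= rho * xi /\ xi <= rho * (a / j ^+ 2 * Z ^+ 2).
Proof.
move=> a0 j0 rho1 th hZ hxi.
have rho0 : 0 < rho by lra.
have th0 : 0 < th by rewrite divr_gt0; lra.
have thE : 20 * (th * rho) = rho - 1 by rewrite /th; field; lra.
have th1 : th < 1 / 20.
  by rewrite /th ltr_pdivrMr; lra.
have rth : th <= th * rho by rewrite ler_peMr; lra.
pose z := Z / j; pose e := z + x.
have ezx : `|e| <= 3 * th * `|x|.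
  have -> : e = (Z + j * x) / j by rewrite /e /z mulrDl mulrAC divff// mul1r.
  by rewrite normrM normfV ler_pdivrMr ?normr_gt0//; lra.
have -> : a / j ^+ 2 * Z ^+ 2 = a * z ^+ 2 by rewrite /z; field.
set q := x ^+ 2 in hxi *; have q0 : 0 <= q by exact: sqr_ge0.
have xx : `|x| * `|x| = q by rewrite -normrM -expr2 ger0_norm.
have nx := normr_ge0 x; have ne := normr_ge0 e.
have ex : `|e * x| <= 3 * th * q.
  by rewrite normrM -xx mulrA ler_wpM2r.
have ee : e ^+ 2 <= th * q.
  have -> : e ^+ 2 = `|e| * `|e| by rewrite -normrM -expr2 ger0_norm ?sqr_ge0.
  apply: (@le_trans _ _ ((3 * th * `|x|) * (3 * th * `|x|))); first exact: ler_pM.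
  have -> : 3 * th * `|x| * (3 * th * `|x|) = th * ((9 * th) * q) by rewrite -xx; ring.
  by rewrite ler_pM2l// -[leRHS]mul1r ler_wpM2r//; lra.
have zz : z ^+ 2 = q - 2 * (e * x) + e ^+ 2 by rewrite /e /q; ring.
have e20 := sqr_ge0 e.
move: ex hxi; rewrite !ler_norml => /andP[ex1 ex2] /andP[hx1 hx2].
have zlo : (1 - 6 * th) * q <= z ^+ 2 by lra.
have zhi : z ^+ 2 <= (1 + 7 * th) * q by lra.
have aq : 0 <= a * q by rewrite mulr_ge0// ltW.
split.
- apply: (@le_trans _ _ (rho * ((1 - 2 * th) * (a * q)))); last first.
    by rewrite ler_pM2l//; lra.
  apply: (@le_trans _ _ (a * ((1 + 7 * th) * q))); first by rewrite ler_pM2l.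
  have -> : a * ((1 + 7 * th) * q) = (1 + 7 * th) * (a * q) by ring.
  by rewrite [leRHS]mulrA ler_wpM2r//; lra.
- apply: (@le_trans _ _ ((1 + 2 * th) * (a * q))); first by lra.
  apply: (@le_trans _ _ (rho * (a * ((1 - 6 * th) * q)))); last first.
    by rewrite ler_pM2l// ler_pM2l.
  have -> : rho * (a * ((1 - 6 * th) * q)) = (rho * (1 - 6 * th)) * (a * q) by ring.
  by rewrite ler_wpM2r//; lra.
Qed.

Lemma ler_norm_sqrt (R : rcfType) (z q : R) : 0 <= q ->
  (`|z| <= Num.sqrt q) = (z ^+ 2 <= q).
Proof. by move=> q0; rewrite -sqrtr_sqr ler_sqrt. Qed.

Lemma scaled_chi_square1_le (R : realType) (c s : R) :
  scaled_chi_square1 c `]-oo, s]%classic = centered_normal 1 [set z | c * z ^+ 2 <= s].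
Proof.
apply: etrans (esym (centered_normalE 1 _)).
rewrite /scaled_chi_square1 /chi_square1 /pushforward.
congr (normal_prob 0 1 _); apply/seteqP; by split => z; rewrite /= in_itv.
Qed.

(** * From the ratio bounds to the distribution functions *)

Section chi_square_limit.
Context d dO (T : measurableType d) (Omega : measurableType dO) (R : realType).
Variables (P : probability Omega R) (G : probability T R).
Variable X : nat -> {RV P >-> T}.
Hypothesis hX : iid_from G X.
Variables (h : T -> R) (xi : nat -> Omega -> \bar R) (a : R).
Hypothesis mh : measurable_fun [set: T] h.
Hypothesis ih2 : G.-integrable [set: T] (EFin \o (fun x => h x ^+ 2)).
Hypothesis h0 : \int[G]_x h x = 0.
Hypothesis a0 : 0 < a.
Hypothesis mxi : forall n, measurable_fun [set: Omega] (xi n).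

Let Z n w := (Num.sqrt n%:R)^-1 * \sum_(i < n) h (X i w).

Hypothesis ratio : forall rho, 1 < rho ->
  asymptotically_sure P (fun n => [set w | exists2 y, xi n w = y%:E &
    a * Z n w ^+ 2 <= rho * y /\ y <= rho * (a * Z n w ^+ 2)]).

Let v := \int[G]_x h x ^+ 2.
Let F (s : R) : R := fine (centered_normal 1 [set z : R | a * v * z ^+ 2 <= s]).
Let A t n := [set w | (xi n w <= t%:E)%E].

Let v0 : 0 <= v.
Proof. by apply: Rintegral_ge0 => x _; exact: sqr_ge0. Qed.

Let mZ n : measurable_fun [set: Omega] (Z n).
Proof. exact: (measurable_iid_sum X mh). Qed.

Let mA t n : measurable (A t n).
Proof.
have -> : A t n = [set: Omega] `&` xi n @^-1` `]-oo, t%:E]%classic.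
  by rewrite setTI; apply/seteqP; split => w; rewrite /A/= in_itv.
by apply: mxi => //; exact: emeasurable_itv.
Qed.

Let mball b n : measurable [set w | `|Z n w| <= b].
Proof. exact: measurable_ball_preimage. Qed.

Let F_ball s : 0 <= s ->
  fine (centered_normal 1 [set z | `|Num.sqrt v * z| <= Num.sqrt (s / a)]) = F s.
Proof.
move=> s0; rewrite /F; congr (fine (centered_normal 1 _)).
have sa : 0 <= s / a by rewrite divr_ge0// ltW.
apply/funext => z; rewrite /= ler_norm_sqrt// exprMn sqr_sqrtr// ler_pdivlMr//.
by congr (is_true (_ <= _)); ring.
Qed.

(** Two points s < q are inserted between max(t, 0) and u. The ratio bound with rho = q / s carries
    xi <= t into a Z^2 <= q, and the gap from q to u is left to the central limit theorem. The
    maximum keeps s positive when t <= 0. *)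
Let upper t u eta : t < u -> 0 < u -> 0 < eta ->
  \forall n \near \oo, fine (P (A t n)) <= F u + eta.
Proof.
move=> tu u0 eta0; pose s := (Num.max t 0 + u) / 2.
have ms : Num.max t 0 < u by rewrite gt_max tu u0.
have t_max : t <= Num.max t 0 by rewrite le_max lexx.
have max0 : 0 <= Num.max t 0 by rewrite le_max lexx orbT.
have s0 : 0 < s by rewrite /s; lra.
have su : s < u by rewrite /s; lra.
have ts : t <= s by rewrite /s; lra.
pose q := (s + u) / 2; have q0 : 0 < q by rewrite /q; lra.
have qu : q < u by rewrite /q; lra.
have rho1 : 1 < q / s by rewrite ltr_pdivlMr// mul1r /q; lra.
have eta2 : 0 < eta / 2 by rewrite divr_gt0.
have step n : A t n `&` [set w | exists2 y, xi n w = y%:E &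
    a * Z n w ^+ 2 <= q / s * y /\ y <= q / s * (a * Z n w ^+ 2)]
    `<=` [set w | `|Z n w| <= Num.sqrt (q / a)].
  move=> w [/= Aw [y xiy [hy _]]].
  rewrite ler_norm_sqrt; last exact: ltW (divr_gt0 q0 a0).
  rewrite ler_pdivlMr// mulrC; apply: (le_trans hy).
  move: Aw; rewrite /A/= xiy lee_fin => yt.
  rewrite mulrAC ler_pdivrMr// ler_pM2l//; lra.
have near1 := asymptotically_sure_le (ratio rho1) (mA t) (mball (Num.sqrt (q / a))) step eta2.
have AB : Num.sqrt (q / a) < Num.sqrt (u / a).
  by rewrite ltr_sqrt ?divr_gt0// ltr_pM2r ?invr_gt0.
have near2 := central_limit hX mh ih2 h0 (sqrtr_ge0 _) AB eta2.
apply: filterS2 near1 near2 => n p1 [p2 _].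
apply: (le_trans p1); move: p2; rewrite -/v F_ball; last exact: ltW.
by rewrite /Z; lra.
Qed.

Let lower t u eta : u < t -> 0 < u -> 0 < eta ->
  \forall n \near \oo, F u <= fine (P (A t n)) + eta.
Proof.
move=> ut u0 eta0; pose s := (u + t) / 2.
have s0 : 0 < s by rewrite /s; lra.
have us : u < s by rewrite /s; lra.
have st : s < t by rewrite /s; lra.
have rho1 : 1 < t / s by rewrite ltr_pdivlMr// mul1r.
have eta2 : 0 < eta / 2 by rewrite divr_gt0.
have step n : [set w | `|Z n w| <= Num.sqrt (s / a)] `&` [set w | exists2 y, xi n w = y%:E &
    a * Z n w ^+ 2 <= t / s * y /\ y <= t / s * (a * Z n w ^+ 2)]
    `<=` A t n.
  move=> w [/= + [y xiy [_ hy]]].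
  rewrite ler_norm_sqrt; last exact: ltW (divr_gt0 s0 a0).
  rewrite ler_pdivlMr// mulrC => Zs; rewrite /A/= xiy lee_fin; apply: (le_trans hy).
  rewrite mulrAC ler_pdivrMr// ler_pM2l//; lra.
have near1 := asymptotically_sure_le (ratio rho1) (mball (Num.sqrt (s / a))) (mA t) step eta2.
have AB : Num.sqrt (u / a) < Num.sqrt (s / a).
  by rewrite ltr_sqrt; [rewrite ltr_pM2r ?invr_gt0|exact: divr_gt0].
have near2 := central_limit hX mh ih2 h0 (sqrtr_ge0 _) AB eta2.
apply: filterS2 near1 near2 => n p1 [_ p2].
move: p2; rewrite -/v F_ball; last exact: ltW.
by move: p1; rewrite /Z; lra.
Qed.

(** The ratio bound, here with rho = 2, makes the statistic non-negative. *)
Let negative t eta : t < 0 -> 0 < eta ->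
  \forall n \near \oo, fine (P (A t n)) <= eta.
Proof.
move=> t0 eta0.
have step n : A t n `&` [set w | exists2 y, xi n w = y%:E &
    a * Z n w ^+ 2 <= 2 * y /\ y <= 2 * (a * Z n w ^+ 2)] `<=` set0.
  move=> w [/= Aw [y xiy [hy _]]]; move: Aw; rewrite /A/= xiy lee_fin => yt.
  have : 0 <= a * Z n w ^+ 2 by rewrite mulr_ge0 ?sqr_ge0// ltW.
  by move: (a * _) hy => q; lra.
have := asymptotically_sure_le (ratio (ltr1n _ 2)) (mA t) (fun=> measurable0) step eta0.
by apply: filterS => n; rewrite measure0 add0r.
Qed.

Let F_negative s : s < 0 -> F s = 0.
Proof.
move=> s0; rewrite /F; have -> : [set z : R | a * v * z ^+ 2 <= s] = set0.
  apply/seteqP; split => // z /=; have : 0 <= a * v * z ^+ 2.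
    exact: mulr_ge0 (mulr_ge0 (ltW a0) v0) (sqr_ge0 z).
  by move=> h1 h2; have := le_lt_trans (le_trans h1 h2) s0; rewrite ltxx.
by rewrite measure0.
Qed.

(** [upper] and [lower] bracket the distribution function at t by values of F at nearby points, and
    continuity of F at t closes the gap. If v = 0 the limit is the point mass at 0, and the
    continuity condition then excludes just t = 0. *)
Lemma chi_square_limit : cvg_in_law P xi (scaled_chi_square1 (a * v)).
Proof.
move=> t ct.
have E s : scaled_chi_square1 (a * v) `]-oo, s]%classic = (F s)%:E.
  have mc : measurable_fun [set: R] (fun z : R => a * v * z ^+ 2).
    by apply: measurable_funM => //; exact: measurable_funX.
  rewrite scaled_chi_square1_le /F fineK// fin_num_measure//.
  have -> : [set z : R | a * v * z ^+ 2 <= s] =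
      [set: R] `&` (fun z : R => a * v * z ^+ 2) @^-1` `]-oo, s]%classic.
    by rewrite setTI; apply/seteqP; split => z; rewrite /= in_itv.
  exact: mc.
have cF : F @ t --> F t.
  have EF : (fun s : R => scaled_chi_square1 (a * v) `]-oo, s]%classic) = EFin \o F.
    by apply/funext.
  have : (fun s : R => scaled_chi_square1 (a * v) `]-oo, s]%classic) @ t -->
      scaled_chi_square1 (a * v) `]-oo, t]%classic := ct.
  rewrite E EF.
  exact: fine_cvg.
rewrite E; apply/fine_cvgP; split.
  by near=> n; rewrite fin_num_measure//; exact: mA.
apply/cvgrPdist_le => e e0; have e2 : 0 < e / 2 by rewrite divr_gt0.
have [r /= r0 hr] : exists2 r : R, 0 < r & forall s, `|t - s| < r -> `|F t - F s| <= e / 2.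
  have /cvgrPdist_le/(_ _ e2)[r /= r0 hr] := cF.
  by exists r => // s ts; exact: hr.
have [t0|t0] := ltP t 0.
  have := negative t0 e0; apply: filterS => n pn.
  rewrite F_negative// sub0r normrN /= ger0_norm ?fine_ge0//.
have up : \forall n \near \oo, fine (P (A t n)) <= F t + e.
  have tu : t < t + r / 2 by lra.
  have u0 : 0 < t + r / 2 by lra.
  have := upper tu u0 e2; apply: filterS => n pn; apply: (le_trans pn).
  have : `|F t - F (t + r / 2)| <= e / 2.
    by apply: hr; rewrite opprD addrA subrr sub0r normrN ger0_norm; lra.
  by rewrite ler_norml => /andP[]; lra.
(* At t = 0 the lower bound is trivial, since continuity of F at 0 forces F 0 = 0. *)
have lo : \forall n \near \oo, F t <= fine (P (A t n)) + e.
  move: t0; rewrite le_eqVlt => /orP[/eqP t0|t0].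
    near=> n; have : `|F t - F (t - r / 2)| <= e / 2.
      by apply: hr; rewrite opprB addrCA subrr addr0 ger0_norm; lra.
    rewrite [F (t - _)]F_negative; last by lra.
    have : 0 <= fine (P (A t n)) by rewrite fine_ge0.
    by rewrite subr0 ler_norml => ? /andP[]; lra.
  pose u := Num.max (t / 2) (t - r / 2).
  have ut : u < t by rewrite /u gt_max; apply/andP; split; lra.
  have u0 : 0 < u by rewrite /u lt_max; apply/orP; left; lra.
  have ur : t - u <= r / 2 by rewrite lerBlDr -lerBlDl /u le_max lexx orbT.
  have := lower ut u0 e2; apply: filterS => n pn.
  have : `|F t - F u| <= e / 2 by apply: hr; rewrite ger0_norm; lra.
  by rewrite ler_norml => /andP[]; lra.
apply: filterS2 up lo => n up lo.
by rewrite ler_norml /=; apply/andP; split; move: up lo; rewrite /A; lra.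
Unshelve. all: by end_near. Qed.

End chi_square_limit.

Lemma ae_density d (T : measurableType d) (R : realType)
    (mu : {sigma_finite_measure set T -> \bar R}) (G : probability T R) (g : T -> R)
    (Q : T -> Prop) : measurable_fun [set: T] g ->
  (forall B : set T, measurable B -> G B = (\int[mu]_(x in B) (g x)%:E)%E) ->
  {ae mu, forall x, Q x} -> {ae G, forall x, Q x}.
Proof.
move=> mg Gg [N [mN muN sub]]; exists N; split=> //.
by have /null_content_dominatesP/(_ N mN muN) := density_dominates mg Gg.
Qed.

Lemma ae_sample d dO (T : measurableType d) (Omega : measurableType dO) (R : realType)
    (P : probability Omega R) (G : probability T R) (X : nat -> {RV P >-> T})
    (Q : T -> Prop) : iid_from G X ->
  {ae G, forall x, Q x} -> {ae P, forall w, forall i, Q (X i w)}.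
Proof.
move=> [_ law] [N [mN GN sub]]; apply: ae_foralln => i.
exists (X i @^-1` N); split.
- by rewrite -[X in measurable X]setTI; exact: measurable_funP.
- by have := law i N mN; rewrite GN.
- by move=> w Xw; apply: sub.
Qed.

(** S1, S2, SM are the sums of h1, h2, |M| and dt is the estimation error. Three errors remain after
    division by n, each at most th |j| |dt|: the quadratic term, as SM / n <= m + 1, the remainder
    of the x-free part, and the deviation of S2 / n from j. *)
Lemma linearized_root (R : realType) (n : nat) (S1 S2 SM dt rem th j m : R) :
  (0 < n)%N -> 0 <= m -> 0 <= SM ->
  `|S1 + S2 * dt| <= SM * dt ^+ 2 + n%:R * rem ->
  `|n%:R^-1 * S2 - j| <= th * `|j| -> `|n%:R^-1 * SM - m| <= 1 ->
  `|dt| * (m + 1) <= th * `|j| -> rem <= th * `|j| * `|dt| ->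
  `|(Num.sqrt n%:R)^-1 * S1 + j * (Num.sqrt n%:R * dt)|
  <= 3 * th * (`|j| * `|Num.sqrt n%:R * dt|).
Proof.
move=> n0 m0 SM0 h hS2 hSM hdt hrem.
have nR0 : 0 < (n%:R : R) by rewrite ltr0n.
set N := (n%:R : R) in nR0 h hS2 hSM *.
have s0 : 0 < Num.sqrt N by rewrite sqrtr_gt0.
have dd := normr_ge0 dt.
have ss : Num.sqrt N * Num.sqrt N = N by rewrite -expr2 sqr_sqrtr// ltW.
have -> : (Num.sqrt N)^-1 * S1 + j * (Num.sqrt N * dt)
    = Num.sqrt N * (N^-1 * S1 + j * dt).
  have -> : N^-1 = (Num.sqrt N)^-1 * (Num.sqrt N)^-1 by rewrite -invfM ss.
  by field; rewrite gt_eqF.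
have E : N^-1 * S1 + j * dt = N^-1 * (S1 + S2 * dt) - (N^-1 * S2 - j) * dt by ring.
have b1 : `|N^-1 * (S1 + S2 * dt)| <= 2 * (th * `|j| * `|dt|).
  rewrite normrM gtr0_norm ?invr_gt0//.
  apply: (@le_trans _ _ (N^-1 * (SM * dt ^+ 2 + N * rem))).
    by rewrite ler_pM2l// invr_gt0.
  have -> : N^-1 * (SM * dt ^+ 2 + N * rem) = (N^-1 * SM) * `|dt| * `|dt| + rem.
    rewrite -mulrA -expr2 real_normK ?num_real//; field.
    by rewrite gt_eqF.
  have SM1 : N^-1 * SM <= m + 1 by move: hSM; rewrite ler_norml => /andP[_]; lra.
  have : N^-1 * SM * `|dt| * `|dt| <= th * `|j| * `|dt|.
    apply: ler_wpM2r => //; apply: le_trans hdt; rewrite mulrC.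
    exact: ler_wpM2l.
  by lra.
have b2 : `|(N^-1 * S2 - j) * dt| <= th * `|j| * `|dt|.
  by rewrite normrM; exact: ler_wpM2r.
rewrite E !normrM (gtr0_norm s0).
have -> : 3 * th * (`|j| * (Num.sqrt N * `|dt|)) = Num.sqrt N * (3 * (th * `|j| * `|dt|)) by ring.
rewrite ler_pM2l//; apply: le_trans (ler_normB _ _) _; lra.
Qed.

(** * Assembling the limit of the statistic *)

Section statistic.
Context dO d (Omega : measurableType dO) (T : measurableType d) (R : realType).
Variables (P : probability Omega R) (mu : {sigma_finite_measure set T -> \bar R}).
Variables (Theta omega : set R) (f : R -> T -> R) (gam lam beta theta0 : R).
Variables (g : T -> R) (G : probability T R) (X : nat -> {RV P >-> T}).
Variable thetahat : nat -> {RV P >-> R}.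
Hypotheses (gam0 : 0 <= gam) (beta0 : 0 <= beta).
Hypothesis hf : forall theta, Theta theta -> is_density mu (f theta).
Hypothesis hg : is_density mu g.
Hypothesis hG : forall B : set T, measurable B ->
  G B = (\int[mu]_(x in B) (g x)%:E)%E.
Hypothesis hX : iid_from G X.
Hypotheses (omega_open : open omega) (omega_theta0 : omega theta0).
Hypothesis omega_sub : omega `<=` Theta.
Hypothesis hlehmann : lehmann_conditions mu f theta0 G omega.
Hypothesis hbasu : basu_conditions mu f theta0 G Theta omega beta.
Hypothesis hsdiv : sdiv_regular mu f theta0 omega gam lam.
Hypothesis hconst : constants_well_defined mu f beta g theta0.
Hypothesis H0 : is_min_dpd mu f beta Theta G theta0.
Hypothesis hthetahat : {ae P, forall w, forall n, (0 < n)%N ->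
  is_min_dpd mu f beta Theta (empirical X n w) (thetahat n w)}.
Hypothesis hconsistent : cvg_in_probability thetahat theta0.

Let p := 1 + beta.
Let p0 : 0 < p. Proof. by rewrite ltr_wpDr. Qed.
Let mg : measurable_fun [set: T] g. Proof. by have [] := hg. Qed.
Let g0 x : 0 <= g x. Proof. by have [] := hg. Qed.
Let hsupp := basu_support hbasu.
Let hdiff := basu_diff_integral hbasu.
Let hsmooth : {ae mu, forall x, smooth_at f theta0 omega x} := lehmann_A hlehmann.
Let hJ : mu.-integrable [set: T]
  (fun x => (score f theta0 x ^+ 2 * f theta0 x `^ (1 + beta))%:E).
Proof. by have [] := basu_J_pos hbasu omega_theta0. Qed.

Let h1 := influence1 mu f theta0 beta.
Let h2 := influence2 mu f theta0 beta.
Let v1 := score_power_version f theta0 beta.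
Let m1 := power_mass mu f beta 1 theta0.
Let m2 := power_mass mu f beta 2 theta0.
Let J := J_true mu f beta g theta0.
Let V := V_true mu f beta g theta0.

Let integrable_cst (c : R) : G.-integrable [set: T] (EFin \o (fun=> c)).
Proof. by apply: (bounded_integrable G (C := `|c|)). Qed.

Let Rintegral_const (c : R) : \int[G]_x c = c.
Proof. by rewrite Rintegral_cst//= probability_setT mulr1. Qed.

Let moments := score_power_version_moments hf omega_open omega_theta0 omega_sub
  hsupp hsmooth beta0 hdiff mg g0 hG hconst.

Let mean2 := info_power_version_mean hf omega_open omega_theta0 omega_sub
  hsupp hsmooth beta0 hdiff hJ mg g0 hG hconst.

Let ih1 : G.-integrable [set: T] (EFin \o h1).
Proof.
have [iv1 _ _] := moments.
exact: (integrableB_EFin (integrable_cst m1) (integrableZl_EFin p iv1)).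
Qed.

Let ih2 : G.-integrable [set: T] (EFin \o h2).
Proof.
have [iv2 _] := mean2.
exact: (integrableD_EFin (integrable_cst m2) (integrableZl_EFin p iv2)).
Qed.

Let mh1 : measurable_fun [set: T] h1.
Proof. by apply/measurable_EFinP; exact: measurable_int ih1. Qed.

Let mh2 : measurable_fun [set: T] h2.
Proof. by apply/measurable_EFinP; exact: measurable_int ih2. Qed.

Let h2_mean : \int[G]_x h2 x = p * J.
Proof.
have [iv2 E] := mean2.
rewrite /h2 /influence2 -/m2 -/p.
rewrite (RintegralD measurableT (integrable_cst m2) (integrableZl_EFin p iv2)).
rewrite Rintegral_const RintegralZl//.
by rewrite /m2 (power_mass2_theta0 hf omega_open omega_theta0 omega_sub hdiff) E.
Qed.

(** Having a density, G inherits the null sets of mu; the support clause at beta = 0 comes from the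
    finite objective at theta0. *)
Let third_bound : exists M : T -> R, G.-integrable [set: T] (EFin \o M) /\
  {ae G, forall x, dpd_regular mu f theta0 omega beta M x}.
Proof.
have [M [iM bM]] := basu_third_bound hbasu; exists M; split => //.
have [_ fin0 _] := H0; have G1 : G setT = 1%E by exact: probability_setT.
have [_ aeS] := fin_objective_integrable hf omega_sub hsupp beta0 hdiff G1 omega_theta0 fin0.
have sG := ae_density mg hG hsmooth; have bG := ae_density mg hG bM.
have [b0|b0] := eqVneq beta 0.
  by have := aeS b0; apply: filterS3 sG bG => x sx bx Sx.
apply: filterS2 sG bG => x sx bx; split => // b; by rewrite b eqxx in b0.
Qed.

Let omega_ball : exists2 r : R, 0 < r & forall t, `|t - theta0| < r -> omega t.
Proof.
have [r /= r0 sub] := open_nbhs_nbhs (conj omega_open omega_theta0).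
by exists r => // t tr; apply: sub; rewrite /= distrC.
Qed.

Let h1_mean : \int[G]_x h1 x = 0.
Proof.
have [M [iM rM]] := third_bound; have [r r0 r_omega] := omega_ball.
exact: (influence1_mean hf omega_open omega_theta0 omega_sub hsupp beta0 hdiff r0
  r_omega rM iM ih1 ih2 H0).
Qed.

Let ih12 : G.-integrable [set: T] (EFin \o (fun x => h1 x ^+ 2)).
Proof.
have [iv1 iv12 _] := moments.
have := integrableD_EFin (integrableD_EFin (integrable_cst (m1 ^+ 2))
  (integrableZl_EFin (- 2 * m1 * p) iv1)) (integrableZl_EFin (p ^+ 2) iv12).
congr (G.-integrable _ (EFin \o _)); apply/funext => x.
by rewrite /h1 /influence1 -/m1 -/p -/(v1 x); ring.
Qed.

(** E h1 = 0 identifies the constant in h1 with (1 + beta) E v1. Thus h1 is -(1 + beta) times the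
    centred v1, and the subtracted square in V appears. *)
Let h1_variance : \int[G]_x h1 x ^+ 2 = p ^+ 2 * V.
Proof.
have [iv1 iv12 EV] := moments.
have Em : m1 = p * \int[G]_x v1 x.
  have := h1_mean; rewrite /h1 /influence1 -/m1 -/p.
  rewrite (RintegralB measurableT (integrable_cst m1) (integrableZl_EFin p iv1)).
  by rewrite Rintegral_const RintegralZl// => /eqP; rewrite subr_eq0 => /eqP.
have -> : \int[G]_x h1 x ^+ 2 =
    \int[G]_x ((m1 ^+ 2 + (- 2 * m1 * p) * v1 x) + p ^+ 2 * v1 x ^+ 2).
  by apply: eq_Rintegral => x _; rewrite /h1 /influence1 -/m1 -/p -/(v1 x); ring.
have ia := integrableZl_EFin (- 2 * m1 * p) iv1.
have ib := integrableZl_EFin (p ^+ 2) iv12.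
rewrite (RintegralD measurableT (integrableD_EFin (integrable_cst (m1 ^+ 2)) ia) ib).
rewrite (RintegralD measurableT (integrable_cst (m1 ^+ 2)) ia).
rewrite Rintegral_const !RintegralZl// Em /V -EV -/v1.
by move: (\int[G]_x v1 x) (\int[G]_x v1 x ^+ 2) => s q; ring.
Qed.

Let asymptotically_ball (Y : nat -> Omega -> R) (e : R) :
  (forall n, measurable_fun [set: Omega] (Y n)) ->
  (forall eta, 0 < eta -> \forall n \near \oo,
     1 - eta <= fine (P [set w | `|Y n w| <= e])) ->
  asymptotically_sure P (fun n => [set w | `|Y n w| <= e]).
Proof.
move=> mY h eta eta0; apply: filterS (h eta eta0) => n pn.
by exists [set w | `|Y n w| <= e]; split => //; exact: measurable_ball_preimage.
Qed.

Let asymptotically_mean (h : T -> R) (e : R) : measurable_fun [set: T] h ->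
  G.-integrable [set: T] (EFin \o h) -> 0 < e ->
  asymptotically_sure P (fun n => [set w |
    `|n%:R^-1 * (\sum_(i < n) h (X i w)) - \int[G]_x h x| <= e]).
Proof.
move=> mh ih e0; apply: asymptotically_ball => [n|eta eta0].
  by apply: measurable_funB => //; exact: (measurable_iid_sum X mh).
exact: (weak_law hX mh ih e0 eta0).
Qed.

Let asymptotically_consistent (e : R) : 0 < e ->
  asymptotically_sure P (fun n => [set w | `|thetahat n w - theta0| <= e]).
Proof.
move=> e0; have mY n : measurable_fun [set: Omega] (fun w => thetahat n w - theta0).
  by apply: measurable_funB.
apply: asymptotically_ball => // eta eta0.
have /fine_cvg/cvgrPdist_le/(_ _ eta0) := hconsistent e0; apply: filterS => n /=.
have -> : [set w | e < `|thetahat n w - theta0|] =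
    ~` [set w | `|thetahat n w - theta0| <= e].
  by apply/seteqP; split => w /=; rewrite ltNge => /negP.
rewrite sub0r normrN /= fine_probabilityC; last exact: measurable_ball_preimage.
by rewrite ler_norml => /andP[_]; lra.
Qed.

(** In the sum of the pointwise expansions the derivatives at the estimator add up to 0. *)
Let path_expansion (M : T -> R) (r : R) (n : nat) (w : Omega) :
  (forall t, `|t - theta0| < r -> omega t) -> (0 < n)%N ->
  (forall i, dpd_regular mu f theta0 omega beta M (X i w)) ->
  `|thetahat n w - theta0| < r ->
  is_min_dpd mu f beta Theta (empirical X n w) (thetahat n w) ->
  `|\sum_(i < n) h1 (X i w) + (\sum_(i < n) h2 (X i w)) * (thetahat n w - theta0)| <=
  (\sum_(i < n) `|M (X i w)|) * (thetahat n w - theta0) ^+ 2 +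
  n%:R * `|power_mass mu f beta 1 (thetahat n w) - power_mass mu f beta 1 theta0
     - power_mass mu f beta 2 theta0 * (thetahat n w - theta0)|.
Proof.
move=> r_omega n0 reg tr min_t; set t := thetahat n w in tr min_t *.
have root := empirical_first_order hf omega_open omega_theta0 omega_sub hsupp beta0
  hdiff r_omega n0 (fun i _ => reg i) tr min_t.
have -> : \sum_(i < n) h1 (X i w) + (\sum_(i < n) h2 (X i w)) * (t - theta0) =
    - \sum_(i < n) (dpd_point1 mu f beta (X i w) t - h1 (X i w) - h2 (X i w) * (t - theta0)).
  have split3 (b c e : 'I_n -> R) :
    \sum_i (b i - c i - e i) = \sum_i b i - \sum_i c i - \sum_i e i by rewrite !sumrB.
  by rewrite (split3 (fun i => dpd_point1 mu f beta (X i w) t)) root mulr_suml; ring.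
rewrite normrN; apply: le_trans (ler_norm_sum _ _ _) _.
rewrite mulr_suml -[n in n%:R * _]card_ord mulr_natl -sumr_const -big_split/=.
apply: ler_sum => i _.
exact: (dpd_point1_expansion hf omega_open omega_theta0 omega_sub hsupp beta0 hdiff
  r_omega (reg i) tr).
Qed.

Let a := A_model mu f gam theta0.
Let j := p * J.

Let J0 : J != 0. Proof. by have [] := hconst. Qed.
Let j0 : j != 0. Proof. by rewrite mulf_neq0// gt_eqF. Qed.

Let hfisher : (0 < fisher mu f theta0)%E.
Proof. by have /andP[] := lehmann_C hlehmann omega_theta0. Qed.

Let a0 : 0 < a.
Proof.
exact: (A_model_pos hf omega_open omega_theta0 omega_sub hsupp hsmooth beta0 gam0
  hJ hsdiv hfisher).
Qed.

Let expansion e (e0 : 0 < e) := sdiv_expansion hf omega_open omega_theta0 omega_sub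
  hsupp hsmooth beta0 gam0 hJ hsdiv e0.

Let statistic_ratio rho : 1 < rho ->
  asymptotically_sure P (fun n => [set w | exists2 y,
    sdiv_statistic mu f gam lam theta0 thetahat n w = y%:E &
    a / j ^+ 2 * ((Num.sqrt n%:R)^-1 * \sum_(i < n) h1 (X i w)) ^+ 2 <= rho * y /\
    y <= rho * (a / j ^+ 2 * ((Num.sqrt n%:R)^-1 * \sum_(i < n) h1 (X i w)) ^+ 2)]).
Proof.
move=> rho1; pose th := (rho - 1) / (20 * rho).
have th0 : 0 < th by rewrite divr_gt0; lra.
have thj : 0 < th * `|j| by rewrite mulr_gt0 ?normr_gt0.
have [M [iM rM]] := third_bound; have [r r0 r_omega] := omega_ball.
have [rs rs0 hs] := expansion (mulr_gt0 th0 a0).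
have [rr rr0 hr] := remainder_small omega_theta0 hdiff (isT : (1 < 3)%N) thj.
have iaM : G.-integrable [set: T] (EFin \o (fun x => `|M x|)) := integrable_norm iM.
have maM : measurable_fun [set: T] (fun x => `|M x|).
  by apply/measurable_EFinP; exact: measurable_int iaM.
pose m := \int[G]_x `|M x|.
have m0 : 0 <= m by apply: Rintegral_ge0.
have m10 : 0 < m + 1 by lra.
(* The four radii serve omega, the expansion of the divergence, the remainder of [power_mass], and
   the bound |dt| (m + 1) <= th |j|. *)
pose r1 := Num.min r (Num.min rs (Num.min rr (th * `|j| / (m + 1)))).
have r10 : 0 < r1 by rewrite !lt_min r0 rs0 rr0 divr_gt0.
have ae_path : {ae P, forall w, (forall i, dpd_regular mu f theta0 omega beta M (X i w)) /\
    forall n, (0 < n)%N -> is_min_dpd mu f beta Theta (empirical X n w) (thetahat n w)}.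
  by apply: filterS2 (ae_sample hX rM) hthetahat => w; split.
(* Consistency is used at r1 / 2 because it yields a weak inequality and the expansions ask for a
   strict one. *)
have sure := asymptotically_sureI (asymptotically_sureI
  (ae_asymptotically_sure ae_path) (asymptotically_consistent (divr_gt0 r10 (ltr0n _ 2))))
  (asymptotically_sureI (asymptotically_mean mh2 ih2 thj) (asymptotically_mean maM iaM ltr01)).
apply: asymptotically_sure_sub sure; near=> n.
have n0 : (0 < n)%N by near: n; exact: nbhs_infty_gt.
move=> w [[[reg min_t] /= tr2] [/= mean_h2 mean_M]].
have : `|thetahat n w - theta0| < r1 by apply: (le_lt_trans tr2); lra.
rewrite !lt_min => /and4P[tr trs trr trm].
have [y sy hy] := hs _ trs.
exists (2 * n%:R * y); first by rewrite /sdiv_statistic sy.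
have path := path_expansion r_omega n0 reg tr (min_t n n0).
have SM0 : 0 <= \sum_(i < n) `|M (X i w)| by apply: sumr_ge0.
rewrite h2_mean in mean_h2; rewrite ltr_pdivlMr// in trm.
have lin := linearized_root n0 m0 SM0 path mean_h2 mean_M (ltW trm) (hr _ trr).
apply: (ratio_bounds a0 j0 rho1 lin).
set dt := thetahat n w - theta0 in hy *.
have -> : (Num.sqrt n%:R * dt) ^+ 2 = n%:R * dt ^+ 2 by rewrite exprMn sqr_sqrtr.
have -> : 2 * n%:R * y - a * (n%:R * dt ^+ 2) = 2 * n%:R * (y - a / 2 * dt ^+ 2) by field.
rewrite normrM ger0_norm; last by rewrite mulr_ge0.
have -> : 2 * th * (a * (n%:R * dt ^+ 2)) = 2 * n%:R * (th * a * dt ^+ 2) by ring.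
by rewrite ler_wpM2l// mulr_ge0.
Unshelve. all: by end_near. Qed.

Hypothesis hxi : forall n, measurable_fun [set: Omega]
  (sdiv_statistic mu f gam lam theta0 thetahat n).

Lemma statistic_limit :
  cvg_in_law P (sdiv_statistic mu f gam lam theta0 thetahat)
    (scaled_chi_square1 (a * V / J ^+ 2)).
Proof.
have := chi_square_limit hX mh1 ih12 h1_mean (divr_gt0 a0 _) hxi statistic_ratio.
(* The factors 1 + beta of h1 and of [j] cancel. *)
rewrite h1_variance; have -> : a / j ^+ 2 * (p ^+ 2 * V) = a * V / J ^+ 2.
  by rewrite /j; field; rewrite J0 gt_eqF.
by apply; rewrite exprn_even_gt0.
Qed.

End statistic.

Theorem theorem3p6 (R : realType) (d dO : measure_display)
  (T : measurableType d) (mu : {sigma_finite_measure set T -> \bar R})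
  (Omega : measurableType dO) (P : probability Omega R)
  (Theta : set R) (f : R -> T -> R) (gam lam beta theta0 : R)
  (g : T -> R) (G : probability T R) (X : nat -> {RV P >-> T})
  (thetahat : nat -> {RV P >-> R}) (omega : set R)
  (hgam : 0 <= gam <= 1) (hbeta : 0 <= beta)
  (hf : forall theta, Theta theta -> is_density mu (f theta))
  (hg : is_density mu g)
  (hG : forall B : set T, measurable B -> G B = (\int[mu]_(x in B) (g x)%:E)%E)
  (hX : iid_from G X)
  (omega_open : open omega) (omega_theta0 : omega theta0)
  (omega_sub : omega `<=` Theta)
  (hlehmann : lehmann_conditions mu f theta0 G omega)
  (hbasu : basu_conditions mu f theta0 G Theta omega beta)
  (hsdiv : sdiv_regular mu f theta0 omega gam lam)
  (hconst : constants_well_defined mu f beta g theta0)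
  (H0 : is_min_dpd mu f beta Theta G theta0)
  (hthetahat : {ae P, forall w, forall n, (0 < n)%N ->
     is_min_dpd mu f beta Theta (empirical X n w) (thetahat n w)})
  (hconsistent : cvg_in_probability thetahat theta0)
  (hxi : forall n, measurable_fun [set: Omega]
     (sdiv_statistic mu f gam lam theta0 thetahat n)) :
  cvg_in_law P (sdiv_statistic mu f gam lam theta0 thetahat)
    (scaled_chi_square1
       (A_model mu f gam theta0 * V_true mu f beta g theta0
        / J_true mu f beta g theta0 ^+ 2)).
Proof.
have /andP[gam0 _] := hgam.
exact: (statistic_limit gam0 hbeta hf hg hG hX omega_open omega_theta0 omega_sub
  hlehmann hbasu hsdiv hconst H0 hthetahat hconsistent hxi).
Qed.
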